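(* Let $\Omega\colon U\to V$ be a linear operator with the Gurarii property, acting between separable Banach spaces, and let $\mathbf\Omega\colon\mathbb G\to\mathbb G$ be the operator constructed in the context. Then $\Omega$ is isometric to $\mathbf\Omega$ in the sense that there exist bijective linear isometries $I\colon U\to\mathbb G$ and $J\colon V\to\mathbb G$ such that $\mathbf\Omega\circ I=J\circ\Omega$. Furthermore, $\Omega$ is almost homogeneous, that is: given $\varepsilon>0$, finite-dimensional spaces $X_0,X_1\subseteq U$, $Y_0,Y_1\subseteq V$ with $\Omega[X_0]\subseteq Y_0$, $\Omega[X_1]\subseteq Y_1$, and linear isometries $i\colon X_0\to X_1$, $j\colon Y_0\to Y_1$ such that $\Omega\circ i=j\circ\Omega$ on $X_0$, there exist bijective linear isometries $I\colon U\to U$, $J\colon V\to V$ such that $\Omega\circ I=J\circ\Omega$, $\|I\restriction X_0-i\|\le\varepsilon$ and $\|J\restriction Y_0-j\|\le\varepsilon$.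
   Context: All Banach spaces are real. An operator is a bounded linear operator; nonexpansive means of norm $\le 1$. An $\varepsilon$-embedding is a linear operator $f\colon X\to Y$ with $(1+\varepsilon)^{-1}\|x\|\le\|f(x)\|\le\|x\|$ for all $x\in X$. The Gurarii space $\mathbb G$ is the unique (up to linear isometry) separable Banach space such that, given finite-dimensional Banach spaces $X\subseteq Y$ and $\varepsilon>0$, every isometric embedding $i\colon X\to\mathbb G$ extends to an $\varepsilon$-embedding $j\colon Y\to\mathbb G$. Gurarii property. A linear operator $\Omega\colon U\to V$ between Banach spaces has the Gurarii property if $\|\Omega\|\le 1$ and: given $\varepsilon>0$, a nonexpansive operator $T\colon X\to Y$ between finite-dimensional Banach spaces, subspaces $X_0\subseteq X$, $Y_0\subseteq Y$ with $T[X_0]\subseteq Y_0$, and isometric embeddings $i\colon X_0\to U$, $j\colon Y_0\to V$ with $\Omega\circ i=j\circ(T\restriction X_0)$, there exist $\varepsilon$-embeddings $i'\colon X\to U$, $j'\colon Y\to V$ with $\|i'\restriction X_0-i\|<\varepsilon$, $\|j'\restriction Y_0-j\|<\varepsilon$ and $\|\Omega\circ i'-j'\circ T\|<\varepsilon$. Rational spaces and operators. A rational Banach space is a finite-dimensional Banach space $X$ together with a linear isomorphism $h\colon\mathbb R^n\to X$ such that $\|x\|=\max_{i<k}|f_i(x)|$ for finitely many linear functionals $f_0,\dots,f_{k-1}$ on $X$ with $f_i(h(\mathbb Q^n))\subseteq\mathbb Q$; the vectors in $h(\mathbb Q^n)$ are called rational. A linear operator between rational Banach spaces is rational if it has norm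 $\le1$ and maps rational vectors to rational vectors. A rational embedding is a rational operator that is isometric. Construction of $\mathbf\Omega$. Let $\mathcal U,\mathcal V$ be disjoint real vector spaces, each with a fixed countably infinite vector basis; rational vectors of $\mathcal U$ (of $\mathcal V$) are the rational linear combinations of the basis. A rational subspace of $\mathcal U$ (of $\mathcal V$) is a finite-dimensional subspace spanned by rational vectors, endowed with a norm that is rational with respect to the rational vectors it contains. Let $\mathcal F$ be the countable family of all triples $\langle T,e,k\rangle$, where $k$ is a natural number, $T\colon X\to Y$ is a rational operator between rational subspaces $X$ of $\mathcal U$ and $Y$ of $\mathcal V$, and $e=(i,j)$ is a pair of rational embeddings $i\colon X_0\to X$, $j\colon Y_0\to Y$ whose domains $X_0$, $Y_0$ are rational subspaces of $\mathcal U$, $\mathcal V$ respectively. Enumerate $\mathcal F$ as $\{\langle T_n,e_n,k_n\rangle\}_{n\in\omega}$, $e_n=(i_n,j_n)$, so that each triple occurs infinitely often. Define rational operators $F_n\colon U_n\to V_n$ between rational subspaces of $\mathcal U$ and $\mathcal V$ recursively. Put $U_0=0$, $V_0=0$, $F_0=0$. For $n>0$ consider the condition ($*$): $k:=k_n<n$, the domain of $i_n$ is $U_k$, the domain of $j_n$ is $V_k$ (with their norms), and $T_n\circ i_n=j_n\circ F_k$. If ($*$) fails, put $F_n=F_{n-1}$, $U_n=U_{n-1}$, $V_n=V_{n-1}$. If ($*$) holds, with $i_n\colon U_k\to X$, $j_n\colon V_k\to Y$, let $U_n$ be a rational subspace of $\mathcal U$ containing $U_{n-1}$ isometrically (by a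 rational embedding) which, together with a rational embedding $i'\colon X\to U_n$, is a pushout (in the category of Banach spaces with operators of norm $\le 1$) of $i_n\colon U_k\to X$ and the inclusion $U_k\subseteq U_{n-1}$ (so $i'\circ i_n$ is the identity on $U_k$); similarly let $V_n\supseteq V_{n-1}$ with $j'\colon Y\to V_n$ be such a pushout of $j_n\colon V_k\to Y$ and $V_k\subseteq V_{n-1}$, realized as a rational subspace of $\mathcal V$. Let $F_n\colon U_n\to V_n$ be the unique operator extending $F_{n-1}$ with $F_n\circ i'=j'\circ T_n$. (The pushout of $i\colon Z\to X$ and $f\colon Z\to Y$ is $(X\oplus_1 Y)/\{(i(z),-f(z)):z\in Z\}$ with the canonical maps.) Let $U_\infty$, $V_\infty$ be the completions of $\bigcup_n U_n$, $\bigcup_n V_n$, and let $\mathbf\Omega\colon U_\infty\to V_\infty$ be the unique continuous extension of $\bigcup_n F_n$. Both $U_\infty$ and $V_\infty$ are linearly isometric to $\mathbb G$, so $\mathbf\Omega$ is regarded as an operator $\mathbf\Omega\colon\mathbb G\to\mathbb G$.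
   Formalization: The Gurarii space is defined by exact extension of isometric embeddings to maps with (1+ε)^{-1}‖x‖ ≤ ‖j(x)‖ ≤ (1+ε)‖x‖, since with the stated nonexpansive bound ‖j(x)‖ ≤ ‖x‖ no separable space has the property. *)

(* Defs.v *)
From HB Require Import structures.
From mathcomp Require Import all_boot all_order all_algebra.
From mathcomp Require Import all_classical all_reals all_analysis.
Set Implicit Arguments.
Unset Strict Implicit.
Unset Printing Implicit Defensive.
Import Order.TTheory GRing.Theory Num.Theory.
Import numFieldNormedType.Exports.
Local Open Scope classical_set_scope.
Local Open Scope ring_scope.

(* Conventions.  Subspaces are sets closed under the linear operations, and an
   operator defined on a subspace is a total function of which only the values
   on that subspace matter (unless its values elsewhere are prescribed).  A
   finite-dimensional Banach space is a normedModType that is finitely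
   spanned, completeness being automatic in finite dimension. *)

Section Subspaces.
Variables (R : realType) (E F : lmodType R).

Definition subspace (A : set E) : Prop :=
  A 0 /\ forall (a : R) x y, A x -> A y -> A (a *: x + y).

Definition span n (v : 'I_n -> E) : set E :=
  range (fun c : 'I_n -> R => \sum_(i < n) c i *: v i).

Definition findim (A : set E) : Prop := exists n (v : 'I_n -> E), A = span v.

Definition linear_on (A : set E) (f : E -> F) : Prop :=
  forall (a : R) x y, A x -> A y -> f (a *: x + y) = a *: f x + f y.

Definition vector_basis (b : nat -> E) : Prop :=
  (forall n (c : 'I_n -> R),
     \sum_(i < n) c i *: b i = 0 -> forall i, c i = 0) /\
  (forall x, exists n (c : 'I_n -> R), x = \sum_(i < n) c i *: b i).

End Subspaces.

Section NormedSpaces.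
Variable R : realType.

Definition separable (X : normedModType R) : Prop :=
  exists2 D : set X, countable D & dense D.

(* The supremum is taken in the extended reals, so that the norm of an
   unbounded map is +oo. *)
Definition opnorm_on (X Y : normedModType R) (A : set X) (f : X -> Y) : \bar R :=
  ereal_sup [set (`|f x|)%:E | x in [set x | A x /\ `|x| <= 1]].

Definition opnorm (X Y : normedModType R) (f : X -> Y) : \bar R :=
  opnorm_on [set: X] f.

Definition isometric_embedding_on (X Y : normedModType R) (A : set X)
    (f : X -> Y) : Prop :=
  linear_on A f /\ forall x, A x -> `|f x| = `|x|.

Definition bijective_isometry (X Y : normedModType R) (f : {linear X -> Y}) :
    Prop :=
  bijective f /\ forall x, `|f x| = `|x|.

Definition eps_embedding (X Y : normedModType R) (eps : R)
    (f : {linear X -> Y}) : Prop :=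
  forall x, (1 + eps)^-1 * `|x| <= `|f x| /\ `|f x| <= `|x|.

(* In the definition of the Gurarii space, where the extension is exact, the
   upper bound is relaxed to 1 + eps: with the nonexpansive bound of
   eps_embedding no separable Banach space would satisfy the definition. *)
Definition eps_isometry (X Y : normedModType R) (eps : R)
    (f : {linear X -> Y}) : Prop :=
  forall x, (1 + eps)^-1 * `|x| <= `|f x| /\ `|f x| <= (1 + eps) * `|x|.

Definition gurarii_space (G : completeNormedModType R) : Prop :=
  separable G /\
  forall (Y : normedModType R) (X : set Y) (eps : R) (i : Y -> G),
    findim [set: Y] -> subspace X -> 0 < eps -> isometric_embedding_on X i ->
    exists j : {linear Y -> G},
      eps_isometry eps j /\ forall x, X x -> j x = i x.

Definition gurarii_property (U V : completeNormedModType R)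
    (Omega : {linear U -> V}) : Prop :=
  (opnorm Omega <= 1%:E)%E /\
  forall (eps : R) (X Y : normedModType R) (T : {linear X -> Y})
      (X0 : set X) (Y0 : set Y) (i : X -> U) (j : Y -> V),
    0 < eps -> findim [set: X] -> findim [set: Y] -> (opnorm T <= 1%:E)%E ->
    subspace X0 -> subspace Y0 -> T @` X0 `<=` Y0 ->
    isometric_embedding_on X0 i -> isometric_embedding_on Y0 j ->
    (forall x, X0 x -> Omega (i x) = j (T x)) ->
    exists (i' : {linear X -> U}) (j' : {linear Y -> V}),
      [/\ eps_embedding eps i', eps_embedding eps j',
          (opnorm_on X0 (fun x => (i' x - i x)%R) < eps%:E)%E,
          (opnorm_on Y0 (fun y => (j' y - j y)%R) < eps%:E)%E &
          (opnorm (fun x => (Omega (i' x) - j' (T x))%R) < eps%:E)%E].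

Definition almost_homogeneous (U V : completeNormedModType R)
    (Omega : {linear U -> V}) : Prop :=
  forall (eps : R) (X0 X1 : set U) (Y0 Y1 : set V) (i : U -> U) (j : V -> V),
    0 < eps ->
    findim X0 -> findim X1 -> findim Y0 -> findim Y1 ->
    Omega @` X0 `<=` Y0 -> Omega @` X1 `<=` Y1 ->
    isometric_embedding_on X0 i -> i @` X0 `<=` X1 ->
    isometric_embedding_on Y0 j -> j @` Y0 `<=` Y1 ->
    (forall x, X0 x -> Omega (i x) = j (Omega x)) ->
    exists (I : {linear U -> U}) (J : {linear V -> V}),
      [/\ bijective_isometry I, bijective_isometry J,
          forall x, Omega (I x) = J (Omega x),
          (opnorm_on X0 (fun x => (I x - i x)%R) <= eps%:E)%E &
          (opnorm_on Y0 (fun y => (J y - j y)%R) <= eps%:E)%E].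

End NormedSpaces.

Section RationalSpaces.
Variables (R : realType) (E : lmodType R).

(* A subspace of the vector space E together with a norm on it. *)
Record nspace := NSpace { carrier : set E; nnorm : E -> R }.

Definition is_norm_on (A : set E) (N : E -> R) : Prop :=
  [/\ forall x, A x -> N x = 0 -> x = 0,
      forall (a : R) x, A x -> N (a *: x) = `|a| * N x &
      forall x y, A x -> A y -> N (x + y) <= N x + N y].

Definition rational_row n : set 'rV[R]_n :=
  range (fun q : 'rV[rat]_n => map_mx ratr q).

(* (X, h) is a rational Banach space. *)
Definition rational_banach (X : nspace) n (h : {linear 'rV[R]_n -> E}) : Prop :=
  [/\ injective h, range h = carrier X, is_norm_on (carrier X) (nnorm X) &
      exists k (f : 'I_k -> E -> R^o),
        [/\ forall i, linear_on (carrier X) (f i),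
            forall i q, @rational_row n q -> exists r : rat, f i (h q) = ratr r &
            forall x, carrier X x ->
              nnorm X x = \big[Num.max/0]_(i < k) `|f i x|]].

Variable b : nat -> E.

Definition rational_vector : set E :=
  [set x | exists n (q : 'I_n -> rat), x = \sum_(i < n) ratr (q i) *: b i].

(* The norm is set to 0 outside the carrier, so that equality of nspaces is
   equality of the normed spaces they denote. *)
Definition rational_subspace (X : nspace) : Prop :=
  [/\ exists n (v : 'I_n -> E),
        (forall i, rational_vector (v i)) /\ carrier X = span v,
      exists n (h : {linear 'rV[R]_n -> E}),
        rational_banach X h /\
        h @` @rational_row n = carrier X `&` rational_vector &
      forall x, ~ carrier X x -> nnorm X x = 0].

(* P, with the maps p : X -> P and q : Y -> P, is the pushout of i : Z -> X and
   f : Z -> Y: the map (x, y) |-> p x + q y from the l^1-sum of X and Y is onto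
   P, its kernel is {(i z, - f z)}, and the norm of P is the quotient norm. *)
Definition is_pushout (Z X Y : nspace) (i f : E -> E) (P : nspace)
    (p q : E -> E) : Prop :=
  [/\ linear_on (carrier X) p /\ p @` carrier X `<=` carrier P,
      linear_on (carrier Y) q /\ q @` carrier Y `<=` carrier P,
      forall w, carrier P w ->
        exists x y, [/\ carrier X x, carrier Y y & w = p x + q y],
      forall x y, carrier X x -> carrier Y y ->
        (p x + q y = 0 <->
         exists z, [/\ carrier Z z, x = i z & y = - f z]) &
      forall w, carrier P w ->
        nnorm P w = inf [set r | exists x y,
          [/\ carrier X x, carrier Y y, w = p x + q y &
              r = nnorm X x + nnorm Y y]]].

(* Set to 0 off X, as required of a rational operator with domain X. *)
Definition inclusion (X : nspace) : E -> E :=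
  fun x => if x \in carrier X then x else 0.

Definition zero_nspace : nspace := NSpace [set 0] (fun=> 0).

(* G, with the map iota, is a completion of the union of the chain S. *)
Definition is_completion (S : nat -> nspace) (G : completeNormedModType R)
    (iota : E -> G) : Prop :=
  [/\ linear_on (\bigcup_n carrier (S n)) iota,
      forall n x, carrier (S n) x -> `|iota x| = nnorm (S n) x &
      dense (iota @` \bigcup_n carrier (S n))].

End RationalSpaces.

Section RationalOperators.
Variables (R : realType) (E F : lmodType R) (bE : nat -> E) (bF : nat -> F).

(* As for norms, T is set to 0 outside its domain X. *)
Definition rational_operator (X : nspace E) (Y : nspace F) (T : E -> F) : Prop :=
  [/\ linear_on (carrier X) T,
      T @` carrier X `<=` carrier Y,
      forall x, carrier X x -> nnorm Y (T x) <= nnorm X x,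
      forall x, carrier X x -> rational_vector bE x -> rational_vector bF (T x) &
      forall x, ~ carrier X x -> T x = 0].

Definition rational_embedding (X : nspace E) (Y : nspace F) (T : E -> F) : Prop :=
  rational_operator X Y T /\
  forall x, carrier X x -> nnorm Y (T x) = nnorm X x.

End RationalOperators.

Section Construction.
Variables (R : realType) (UU VV : lmodType R) (bU : nat -> UU) (bV : nat -> VV).

(* The data of a triple <T, (i, j), k> with T : X -> Y, i : X0 -> X and
   j : Y0 -> Y. *)
Record triple := Triple {
  t_X : nspace UU; t_Y : nspace VV; t_T : UU -> VV;
  t_X0 : nspace UU; t_i : UU -> UU;
  t_Y0 : nspace VV; t_j : VV -> VV;
  t_k : nat }.

Definition rational_triple : set triple := [set t |
  [/\ rational_subspace bU (t_X t), rational_subspace bV (t_Y t),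
      rational_subspace bU (t_X0 t) & rational_subspace bV (t_Y0 t)] /\
  [/\ rational_operator bU bV (t_X t) (t_Y t) (t_T t),
      rational_embedding bU bU (t_X0 t) (t_X t) (t_i t) &
      rational_embedding bV bV (t_Y0 t) (t_Y t) (t_j t)]].

Definition enumerates_infinitely_often (e : nat -> triple) : Prop :=
  (forall n, rational_triple (e n)) /\
  (forall t, rational_triple t -> forall N : nat, exists2 n, (N <= n)%N & e n = t).

Variables (e : nat -> triple).
Variables (U : nat -> nspace UU) (V : nat -> nspace VV) (F : nat -> UU -> VV).

Definition star (n : nat) : Prop :=
  let: k := t_k (e n) in
  [/\ (k < n)%N, t_X0 (e n) = U k, t_Y0 (e n) = V k &
      forall x, carrier (U k) x -> t_T (e n) (t_i (e n) x) = t_j (e n) (F k x)].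

(* The step from n to n.+1, which uses the triple e n.+1. *)
Definition extension_step (n : nat) : Prop :=
  let: t := e n.+1 in
  let: k := t_k t in
  exists (i' : UU -> UU) (j' : VV -> VV),
    [/\ rational_embedding bU bU (U n) (U n.+1)
          (inclusion (U n)),
        rational_embedding bU bU (t_X t) (U n.+1) i',
        forall x, carrier (U k) x -> i' (t_i t x) = x &
        is_pushout (U k) (t_X t) (U n) (t_i t) id (U n.+1) i' id] /\
    [/\ rational_embedding bV bV (V n) (V n.+1)
          (inclusion (V n)),
        rational_embedding bV bV (t_Y t) (V n.+1) j',
        forall y, carrier (V k) y -> j' (t_j t y) = y &
        is_pushout (V k) (t_Y t) (V n) (t_j t) id (V n.+1) j' id] /\
    (forall x, carrier (U n) x -> F n.+1 x = F n x) /\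
    (forall x, carrier (t_X t) x -> F n.+1 (i' x) = j' (t_T t x)).

Definition construction : Prop :=
  [/\ U 0%N = zero_nspace UU, V 0%N = zero_nspace VV & F 0%N = (fun=> 0)] /\
  (forall n, [/\ rational_subspace bU (U n), rational_subspace bV (V n) &
                 rational_operator bU bV (U n) (V n) (F n)]) /\
  (forall n, ~ star n.+1 -> [/\ U n.+1 = U n, V n.+1 = V n & F n.+1 = F n]) /\
  (forall n, star n.+1 -> extension_step n).

End Construction.

Section UniversalOperator.
Variable R : realType.

(* W : Uinf -> Vinf is an outcome of the construction, for some choice of the
   ambient spaces, of the enumeration and of the pushouts. *)
Definition constructed_operator (Uinf Vinf : completeNormedModType R)
    (W : {linear Uinf -> Vinf}) : Prop :=
  exists (UU VV : lmodType R) (bU : nat -> UU) (bV : nat -> VV)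
      (e : nat -> triple UU VV)
      (U : nat -> nspace UU) (V : nat -> nspace VV) (F : nat -> UU -> VV)
      (iU : UU -> Uinf) (iV : VV -> Vinf),
    [/\ vector_basis bU, vector_basis bV,
        enumerates_infinitely_often bU bV e & construction bU bV e U V F] /\
    [/\ is_completion U iU, is_completion V iV, continuous W &
        forall n x, carrier (U n) x -> W (iU x) = iV (F n x)].

(* The constructed operator regarded as an operator on the Gurarii space G,
   through linear isometries from Uinf and Vinf onto G. *)
Definition universal_operator (G : completeNormedModType R)
    (W : {linear G -> G}) : Prop :=
  gurarii_space G /\
  exists (Uinf Vinf : completeNormedModType R) (Winf : {linear Uinf -> Vinf})
      (a : {linear Uinf -> G}) (c : {linear Vinf -> G}),
    [/\ constructed_operator Winf, bijective_isometry a, bijective_isometry c &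
        forall x, W (a x) = c (Winf x)].

End UniversalOperator.

(* Main.v *)
Require Import Defs.
From HB Require Import structures.
From mathcomp Require Import all_boot all_order all_algebra.
From mathcomp Require Import all_classical all_reals all_analysis.
From mathcomp Require Import ring lra zify.
Set Implicit Arguments.
Unset Strict Implicit.
Unset Printing Implicit Defensive.
Import Order.TTheory GRing.Theory Num.Theory.
Import numFieldNormedType.Exports.
Local Open Scope classical_set_scope.
Local Open Scope ring_scope.

(* Idea.  Call finite tuples a in U and a' in U' almost isometric if
   | |sum c_i a_i| - |sum c_i a'_i| | <= eps * sum |c_i| for all c.  Let b, b' be
   almost isometric tuples in V, V' following the images of a, a' under two
   operators Om, Om'.  The largest seminorm on U x U' below the l^1-norm in which
   (a_i, - a'_i) is small is a norm that extends those of U and U', and (Om, Om')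
   is nonexpansive for these norms on U x U' and V x V'.  If Om' has the Gurarii
   property, applying it to finite-dimensional parts of (Om, Om') moves a', b' a
   little and makes the tuples longer and much closer to isometric.
   The constructed operator has the same one-step property: a', b' may be taken
   in U_n, V_n, and on U_n + span(new basis vectors) the amalgam norm is
   approximated by rational norms that agree with it on U_n.  The largest norm
   below a simple rational norm with prescribed rational bounds at finitely many
   rational vectors serves; it is rational by Fourier-Motzkin elimination, and
   sending the bounds along to the other side keeps the operator nonexpansive.
   The resulting triple is used at some later stage of the construction.
   Alternating between two operators with the one-step property, the tuples
   converge to dense sequences that correspond isometrically. *)

(** * A tactic for linear combinations *)

(** [one_step] asks only nonexpansiveness of the opposite operator, so the constructed operator
    never has to be shown to have the Gurarii property. The new error [delta] is free while
    displacements are at most ten times the old error; errors can thus be prescribed as a geometric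
    sequence, and displacements are summable. Images of domain vectors sit at the even positions of
    the codomain tuple, so that whatever is glued in the domain is glued in the codomain too; the
    odd positions are free for arbitrary codomain vectors. The obstacle for the constructed operator
    is that a triple enters the construction only if it extends [F n] through exact embeddings, so a
    rational norm merely close to the amalgam norm is useless: it must coincide with the old norm on
    [U n]. Maximality achieves this. The amalgam norm itself obeys the prescribed bounds, hence lies
    below the rational norm, which lies below the simple norm, and both outer norms restrict to the
    old one. So only upper bounds have to be prescribed, and a finite grid of them controls the norm
    up to [delta]. *)

Section LinearExpressions.
Variables (R : realType) (E : lmodType R).

Inductive linexp : Type :=
  | LinVar of nat | LinZero | LinAdd of linexp & linexp | LinOpp of linexp
  | LinScale of R & linexp.

Fixpoint linexp_eval (vs : seq E) e : E := match e with
  | LinVar i => nth 0 vs i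
  | LinZero => 0
  | LinAdd e1 e2 => linexp_eval vs e1 + linexp_eval vs e2
  | LinOpp e1 => - linexp_eval vs e1
  | LinScale c e1 => c *: linexp_eval vs e1
  end.

(** [eqn] instead of [==] lets [cbn] compute the coefficients at literal indices down to ring
    expressions. *)
Fixpoint linexp_coef e (i : nat) : R := match e with
  | LinVar j => if eqn i j then 1 else 0
  | LinZero => 0
  | LinAdd e1 e2 => linexp_coef e1 i + linexp_coef e2 i
  | LinOpp e1 => - linexp_coef e1 i
  | LinScale c e1 => c * linexp_coef e1 i
  end.

Fixpoint linexp_eq_below e1 e2 n : Prop :=
  if n is n'.+1 then
    linexp_coef e1 n' = linexp_coef e2 n' /\ linexp_eq_below e1 e2 n'
  else True.

Lemma linexp_evalE vs e :
  linexp_eval vs e = \sum_(i < size vs) linexp_coef e i *: nth 0 vs i.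
Proof.
elim: e => [j||e1 IH1 e2 IH2|e IH|c e IH] /=.
- case: (ltnP j (size vs)) => [js|js].
    rewrite (bigD1 (Ordinal js))//= eqnE eqxx scale1r big1 ?addr0// => i.
    by rewrite -val_eqE/= => /negPf ->; rewrite scale0r.
  rewrite nth_default// big1// => i _; rewrite eqnE ltn_eqF ?scale0r//.
  exact: leq_trans js.
- by rewrite big1// => i _; rewrite scale0r.
- by rewrite IH1 IH2 -big_split; apply: eq_bigr => i _; rewrite scalerDl.
- by rewrite IH -sumrN; apply: eq_bigr => i _; rewrite scaleNr.
- by rewrite IH scaler_sumr; apply: eq_bigr => i _; rewrite scalerA.
Qed.

Lemma linexp_eval_eq vs e1 e2 :
  linexp_eq_below e1 e2 (size vs) -> linexp_eval vs e1 = linexp_eval vs e2.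
Proof.
move=> h; rewrite !linexp_evalE; apply: eq_bigr => i _; congr (_ *: _).
move: (nat_of_ord i) (ltn_ord i) => {}i; move: (size vs) h.
by elim=> [|n IH]//= [h1 /IH{}IH]; rewrite ltnS leq_eqVlt => /predU1P[->|].
Qed.

End LinearExpressions.

Ltac linexp_mem x vs := lazymatch vs with
  | nil => constr:(false)
  | cons x _ => constr:(true)
  | cons _ ?t => linexp_mem x t
  end.
Ltac linexp_index x vs := lazymatch vs with
  | cons x _ => constr:(0%N)
  | cons _ ?t => let n := linexp_index x t in constr:(S n)
  end.
Ltac linexp_atoms vs t := lazymatch t with
  | @GRing.add _ ?a ?b => let vs := linexp_atoms vs a in linexp_atoms vs b
  | @GRing.opp _ ?a => linexp_atoms vs a
  | @GRing.scale _ _ _ ?a => linexp_atoms vs a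
  | @GRing.zero _ => vs
  | _ => let m := linexp_mem t vs in
         lazymatch m with true => vs | false => constr:(cons t vs) end
  end.
Ltac linexp_reify R vs t := lazymatch t with
  | @GRing.add _ ?a ?b => let a' := linexp_reify R vs a in
      let b' := linexp_reify R vs b in constr:(@LinAdd R a' b')
  | @GRing.opp _ ?a => let a' := linexp_reify R vs a in constr:(@LinOpp R a')
  | @GRing.scale _ _ ?c ?a =>
      let a' := linexp_reify R vs a in constr:(@LinScale R c a')
  | @GRing.zero _ => constr:(@LinZero R)
  | _ => let n := linexp_index t vs in constr:(@LinVar R n)
  end.
(** An identity between linear combinations is reduced to one scalar identity per atom, each closed
    by [ring]. *)
Ltac linear_identity R := lazymatch goal with |- @eq ?T ?l ?r =>
  let vs := linexp_atoms (@nil T) l in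
  let vs := linexp_atoms vs r in
  let e1 := linexp_reify R vs l in
  let e2 := linexp_reify R vs r in
  refine (@linexp_eval_eq R _ vs e1 e2 _); cbn; repeat split; ring end.

(** * Almost isometric sequences and their limits *)

Section AlmostIsometry.
Variables (R : realType).

Definition almost_isometric (E F : normedModType R) (p : nat) (eps : R)
    (a : nat -> E) (a' : nat -> F) : Prop :=
  forall c : nat -> R,
    `| `|\sum_(i < p) c i *: a i| - `|\sum_(i < p) c i *: a' i| |
      <= eps * \sum_(i < p) `|c i|.

Lemma almost_isometric_sym (E F : normedModType R) p eps (a : nat -> E)
    (a' : nat -> F) :
  almost_isometric p eps a a' -> almost_isometric p eps a' a.
Proof. by move=> h c; rewrite distrC. Qed.

Lemma norm_comb_sub (E : normedModType R) p eta (a x : nat -> E)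
    (c : nat -> R) :
  (forall i, (i < p)%N -> `|a i - x i| <= eta) ->
  `|\sum_(i < p) c i *: a i - \sum_(i < p) c i *: x i|
    <= eta * \sum_(i < p) `|c i|.
Proof.
move=> h; rewrite -sumrB (le_trans (ler_norm_sum _ _ _))// mulr_sumr.
apply: ler_sum => i _; rewrite -scalerBr normrZ mulrC.
by rewrite ler_wpM2r// h.
Qed.

(** The l^1 form of the error is what makes this work: moving each vector by [eta] moves a
    combination by at most [eta] times the l^1-norm of its coefficients. *)
Lemma almost_isometric_perturb (E F : normedModType R) p eps eta eta'
    (a x : nat -> E) (a' x' : nat -> F) :
  almost_isometric p eps a a' ->
  (forall i, (i < p)%N -> `|a i - x i| <= eta) ->
  (forall i, (i < p)%N -> `|a' i - x' i| <= eta') ->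
  almost_isometric p (eps + eta + eta') x x'.
Proof.
move=> h hx hx' c.
have h1 := norm_comb_sub c hx; have h2 := norm_comb_sub c hx'.
have h3 := h c.
have h4 := ler_dist_dist (\sum_(i < p) c i *: a i) (\sum_(i < p) c i *: x i).
have h5 := ler_dist_dist (\sum_(i < p) c i *: a' i) (\sum_(i < p) c i *: x' i).
move: (le_trans h4 h1) (le_trans h5 h2) h3; rewrite !mulrDl.
move: (eps * _) (eta * _) (eta' * _) => A B C.
by rewrite !ler_norml => /andP[? ?] /andP[? ?] /andP[? ?]; apply/andP; split; lra.
Qed.

Lemma le0_of_le_eps (x : R) : (forall eta, 0 < eta -> x <= eta) -> x <= 0.
Proof. by move=> h; apply/ler_addgt0Pr => e e0; rewrite add0r h. Qed.

Lemma dense_seq (E : normedModType R) : separable E ->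
  exists d : nat -> E, forall x eta, 0 < eta -> exists k, `|x - d k| < eta.
Proof.
move=> [D cD dD].
have D0 : D !=set0.
  have [||x [_ Dx]] := dD setT; [by exists 0|exact: openT|by exists x].
have /pcard_surjP[d dP] : (D #<= [set: nat])%card by exact: cD.
exists (fun k => d k) => x eta eta0.
have [||y [xy Dy]] := dD (ball x eta).
  by exists x; exact: ballxx.
  exact: ball_open.
have [k _ dk] := dP _ Dy.
by exists k; rewrite dk; move: xy; rewrite -ball_normE.
Qed.

(** The targets of the back-and-forth are met only up to an error that shrinks with the stage, so
    each target has to come up again at arbitrarily late stages. The 2-adic valuation takes every
    value infinitely often. *)
Lemma dense_sequence_repeating (E : normedModType R) : separable E ->
  exists d : nat -> E,
    forall x eta N, 0 < eta -> exists2 n, (N <= n)%N & `|x - d n| < eta.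
Proof.
move=> /dense_seq[d dP].
exists (fun n => d (logn 2 n)) => x eta N eta0.
have [k hk] := dP x _ eta0.
exists (2 ^ k * (2 * N + 1))%N.
  by rewrite (leq_trans _ (leq_pmull _ _)) ?expn_gt0//; lia.
rewrite lognM ?expn_gt0 ?addn1// pfactorK// lognE/=.
by rewrite dvdn2/= oddM/= addn0.
Qed.

Lemma cvg_geometric (E : completeNormedModType R) (x : nat -> E) (K : R) N :
  0 <= K ->
  (forall n, (N <= n)%N -> `|x n.+1 - x n| <= K * 2^-1 ^+ n) ->
  exists l, forall n, (N <= n)%N -> `|x n - l| <= 2 * K * 2^-1 ^+ n.
Proof.
move=> K0 h.
(* Subtracting the remaining tail makes the telescoped bound provable by induction on [m]. *)
have h1 n m : (N <= n)%N -> `|x (n + m)%N - x n| <= 2 * K * 2^-1 ^+ n - 2 * K * 2^-1 ^+ (n + m).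
  move=> Nn; elim: m => [|m IH]; first by rewrite addn0 !subrr normr0.
  rewrite addnS; have := h (n + m)%N (leq_trans Nn (leq_addr _ _)) => h2.
  have := ler_distD (x (n + m)%N) (x (n + m).+1) (x n) => h3.
  rewrite exprS; lra.
have p0 n : 0 <= K * (2^-1 : R) ^+ n by rewrite mulr_ge0// exprn_ge0.
have h2 n m : (N <= n)%N -> (n <= m)%N -> `|x m - x n| <= 2 * K * 2^-1 ^+ n.
  move=> Nn nm; have := h1 n (m - n)%N Nn; rewrite subnKC// => h2.
  have := p0 m; lra.
have cv : (2 * K * 2^-1 ^+ n) @[n --> \oo] --> (0 : R).
  rewrite -[X in _ --> X](mulr0 (2 * K)); apply: cvgMr; apply: cvg_expr.
  by rewrite ger0_norm// invf_lt1// ltr1n.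
have cx : cvg (x @ \oo).
  apply: cauchy_cvg; apply: cauchy_exP => e e0.
  have /cvgrPdist_lt /(_ e e0) [M _ hM] := cv.
  exists (x (maxn M N)); exists (maxn M N) => // m /= Mm.
  rewrite -ball_normE /= distrC (le_lt_trans (h2 _ _ (leq_maxr _ _) Mm))//.
  have := hM (maxn M N) (leq_maxl _ _).
  by rewrite sub0r normrN ger0_norm// -mulrA mulr_ge0.
exists (lim (x @ \oo)) => n Nn.
apply/ler_addgt0Pr => e e0.
have /cvgrPdist_lt /(_ e e0) [M _ hM] := cx.
have := hM (maxn M n) (leq_maxl _ _).
have := h2 n (maxn M n) Nn (leq_maxr _ _) => h3 h4.
have h5 := ler_distD (x (maxn M n)) (x n) (lim (x @ \oo)).
by move: h3 h4; rewrite distrC [`|lim _ - _|]distrC; lra.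
Qed.

(** Coefficients written as sums of indicators stay correct when some of [i], [j], [k] coincide. *)
Lemma comb3 (E : normedModType R) (a : nat -> E) (s : R) (i j k p : nat) :
  (i < p)%N -> (j < p)%N -> (k < p)%N ->
  \sum_(m < p) ((val m == k)%:R - s * (val m == i)%:R - (val m == j)%:R) *: a m
    = a k - (s *: a i + a j).
Proof.
have one l : (l < p)%N -> \sum_(m < p) (val m == l)%:R *: a m = a l.
  move=> lp; rewrite (bigD1 (Ordinal lp))//= eqxx scale1r big1 ?addr0// => m.
  by move=> /negPf; rewrite -val_eqE /= => ->; rewrite scale0r.
move=> ip jp kp; under eq_bigr do rewrite !scalerBl -scalerA.
by rewrite !sumrB -scaler_sumr !one// opprD addrA.
Qed.

(** * Closing up the graph of an isometric correspondence *)

Section DenseSequences.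
Variables (E F : completeNormedModType R) (a : nat -> E) (a' : nat -> F).
Hypothesis isom : forall p, almost_isometric p 0 a a'.

Let limit_pair x y :=
  forall eta : R, 0 < eta -> exists n, `|x - a n| < eta /\ `|y - a' n| < eta.

Let norm3 s i j k : `|a k - (s *: a i + a j)| = `|a' k - (s *: a' i + a' j)|.
Proof.
pose p := (i + j + k).+1.
have ip : (i < p)%N by rewrite /p; lia.
have jp : (j < p)%N by rewrite /p; lia.
have kp : (k < p)%N by rewrite /p; lia.
have := isom p (fun m => (m == k)%:R - s * (m == i)%:R - (m == j)%:R).
rewrite mul0r normr_le0 subr_eq0 => /eqP.
by rewrite !comb3.
Qed.

(** One identity with three uses: when one side vanishes it gives linearity, [s = -2] with three
    equal pairs gives preservation of norms, and [s = 0] gives single-valuedness. *)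
Lemma limit_pair_comb s x y x1 y1 x2 y2 :
  limit_pair x y -> limit_pair x1 y1 -> limit_pair x2 y2 ->
  `|x - (s *: x1 + x2)| = `|y - (s *: y1 + y2)|.
Proof.
move=> h h1 h2; apply/eqP; rewrite -subr_eq0 -normr_le0.
apply: le0_of_le_eps => eta eta0.
(* Moving the three vectors by [e] moves the combination by at most (2 + |s|) e, which is to be half
   of [eta]. *)
pose e := eta / (2 * (2 + `|s|)).
have e0 : 0 < e by rewrite divr_gt0// mulr_gt0// ltr_wpDr.
have [k [xk yk]] := h _ e0; have [i [xi yi]] := h1 _ e0.
have [j [xj yj]] := h2 _ e0.
have aux (W : normedModType R) (z z1 z2 b b1 b2 : W) :
    `|z - b| < e -> `|z1 - b1| < e -> `|z2 - b2| < e ->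
    `| `|z - (s *: z1 + z2)| - `|b - (s *: b1 + b2)| | <= eta / 2.
  move=> ? d1 ?; rewrite (le_trans (ler_dist_dist _ _))//.
  have -> : z - (s *: z1 + z2) - (b - (s *: b1 + b2)) =
      (z - b) - s *: (z1 - b1) - (z2 - b2).
    by linear_identity R.
  rewrite (le_trans (ler_normB _ _))//.
  have := ler_normB (z - b) (s *: (z1 - b1)); rewrite normrZ.
  have : `|s| * `|z1 - b1| <= `|s| * e by rewrite ler_wpM2l// ltW.
  have : eta / 2 = (2 + `|s|) * e.
    by rewrite /e; field; rewrite gt_eqF// ltr_wpDr.
  by rewrite mulrDl; lra.
have := aux _ _ _ _ _ _ _ xk xi xj; have := aux _ _ _ _ _ _ _ yk yi yj.
by rewrite norm3 !ler_norml => /andP[? ?] /andP[? ?]; apply/andP; split; lra.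
Qed.

Lemma limit_pair_norm x y : limit_pair x y -> `|x| = `|y|.
Proof.
move=> h; have := limit_pair_comb (- 2) h h h.
have -> (W : normedModType R) (z : W) : z - (- 2 *: z + z) = 2 *: z.
  by linear_identity R.
have -> (W : normedModType R) (z : W) : z - (- 2 *: z + z) = 2 *: z.
  by linear_identity R.
by rewrite !normrZ => /mulfI; apply; rewrite normr_eq0 pnatr_eq0.
Qed.

(** Approximants of [x] at distance 2^-k form a Cauchy sequence; the correspondence keeps distances,
    so their partners converge in the complete space [F]. *)
Lemma limit_pair_ex :
  (forall x eta, 0 < eta -> exists n, `|x - a n| < eta) ->
  forall x, exists y, limit_pair x y.
Proof.
move=> da x.
have /choice[f fP] : forall k : nat, exists n, `|x - a n| < 2^-1 ^+ k.
  by move=> k; apply: da; rewrite exprn_gt0// invr_gt0.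
have da' m n : `|a' m - a' n| = `|a m - a n|.
  have := norm3 0 m n m; rewrite !scale0r !add0r => <- //.
have [||l lP] := @cvg_geometric F (fun k => a' (f k)) 2 0.
- by [].
- move=> k _; rewrite da'.
  have := fP k; have := fP k.+1; rewrite exprS => h1 h2.
  have := ler_distD x (a (f k.+1)) (a (f k)).
  have : 0 <= (2^-1 : R) ^+ k by rewrite exprn_ge0.
  by rewrite [`|_ - x|]distrC; lra.
exists l => eta eta0.
have cv : (2 * 2 * 2^-1 ^+ n) @[n --> \oo] --> (0 : R).
  rewrite -[X in _ --> X](mulr0 (2 * 2)); apply: cvgMr; apply: cvg_expr.
  by rewrite ger0_norm// invf_lt1// ltr1n.
have /cvgrPdist_lt /(_ eta eta0) [M _ hM] := cv.
have := hM M (leqnn _).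
have p0 : 0 <= (2^-1 : R) ^+ M by rewrite exprn_ge0.
rewrite sub0r normrN ger0_norm; last by rewrite mulr_ge0.
move=> h1; exists (f M); have := fP M; have := lP M isT; rewrite distrC => h2 h3.
by split; [lra|exact: le_lt_trans h2 _].
Qed.

Lemma limit_pair_fun y1 y2 x : limit_pair x y1 -> limit_pair x y2 -> y1 = y2.
Proof.
move=> h1 h2; have := limit_pair_comb 0 h1 h1 h2.
rewrite !scale0r !add0r subrr normr0 => /esym/eqP.
by rewrite normr_eq0 subr_eq0 => /eqP.
Qed.

End DenseSequences.

(* The closure of the graph {(a n, a' n)} is the graph of the isometry. *)
Lemma isometry_of_dense_sequences (E F : completeNormedModType R)
    (a : nat -> E) (a' : nat -> F) :
  (forall p, almost_isometric p 0 a a') ->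
  (forall x eta, 0 < eta -> exists n, `|x - a n| < eta) ->
  (forall x eta, 0 < eta -> exists n, `|x - a' n| < eta) ->
  exists2 I : {linear E -> F}, bijective_isometry I & forall n, I (a n) = a' n.
Proof.
move=> isom da da'.
have isom' p : almost_isometric p 0 a' a by exact/almost_isometric_sym/isom.
have [I IP] := choice (limit_pair_ex isom da).
have [J JP] := choice (limit_pair_ex isom' da').
have linI : linear I.
  move=> s x y; apply/eqP; rewrite -subr_eq0 -normr_eq0.
  by rewrite -(limit_pair_comb isom s (IP _) (IP _) (IP _)) subrr normr0.
pose l := GRing.isLinear.Build R E F *:%R I linI.
pose I' : {linear E -> F} := HB.pack I l.
exists I'; last first.
  move=> n; apply: (limit_pair_fun isom (IP (a n))) => eta eta0.
  by exists n; rewrite !subrr !normr0.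
split=> [|x]; last by rewrite (limit_pair_norm isom (IP x)).
exists J => [x|y].
  apply: (limit_pair_fun isom' (JP _)) => eta eta0.
  by have [n [? ?]] := IP x _ eta0; exists n.
apply: (limit_pair_fun isom (IP _)) => eta eta0.
by have [n [? ?]] := JP y _ eta0; exists n.
Qed.

(** * Bounded coefficients in finite-dimensional spans *)

Lemma rV_norm_le_sum n (c : 'rV[R]_n) : `|c| <= \sum_i `|c 0 i|.
Proof.
rewrite [leLHS]/Num.norm/= mx_normrE; apply: bigmax_le => [|[i j] _].
  by apply: sumr_ge0.
by rewrite ord1 (bigD1 j)//= lerDl sumr_ge0.
Qed.

(** The spanning family may be dependent, so only some representation can be bounded. In the
    induction a last vector lying in the span of the others gets coefficient 0; otherwise it has
    positive distance to that span, by compactness. *)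
Lemma findim_bounded_coefs (E : normedModType R) n (v : 'I_n -> E) :
  exists2 M, 0 < M & forall x, Defs.span v x ->
    exists2 c : 'I_n -> R, x = \sum_i c i *: v i &
      \sum_i `|c i| <= M * `|x|.
Proof.
elim: n v => [|n IH] v.
  exists 1 => // x [c _ <-]; exists c => //.
  by rewrite !big_ord0 normr0 mulr0.
pose v' i := v (widen_ord (leqnSn n) i).
have [M M0 hM] := IH v'.
have [vn|vn] := pselect (Defs.span v' (v ord_max)).
  exists M => // x [c _ <-].
  have [d dE] : exists d : 'I_n -> R, v ord_max = \sum_i d i *: v' i.
    by case: vn => d _ <-; exists d.
  have [|c' c'E c'M] := hM (\sum_(i < n.+1) c i *: v i).
    exists (fun i => c (widen_ord (leqnSn n) i) + c ord_max * d i) => //.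
    rewrite big_ord_recr/= dE scaler_sumr -big_split/=; apply: eq_bigr => i _.
    by rewrite scalerDl scalerA.
  exists (fun i => if unlift ord_max i is Some j then c' j else 0).
    rewrite c'E big_ord_recr/= unlift_none scale0r addr0; apply: eq_bigr => i _.
    rewrite (_ : widen_ord _ i = lift ord_max i) ?liftK//.
      rewrite /v' (_ : widen_ord _ i = lift ord_max i)//; apply/val_inj.
      by rewrite /= /bump leqNgt ltn_ord.
    by apply/val_inj; rewrite /= /bump leqNgt ltn_ord.
  rewrite big_ord_recr/= unlift_none normr0 addr0 (le_trans _ c'M)//.
  apply: ler_sum => i _.
  rewrite (_ : widen_ord _ i = lift ord_max i) ?liftK//.
  by apply/val_inj; rewrite /= /bump leqNgt ltn_ord.
pose w := v ord_max.
have [d d0 hd] : exists2 d, 0 < d & forall y, Defs.span v' y -> d <= `|w - y|.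
  pose f (c : 'rV[R]_n) : R := `|w - \sum_i c 0 i *: v' i|.
  have cf : continuous f.
    have h : continuous (fun c : 'rV[R]_n => \sum_i c 0 i *: v' i).
      move=> c; apply: cvg_big => [||i _].
      - exact: add_continuous.
      - exact: nbhs_filter.
      - have hc : {for c, continuous (fun x : 'rV[R]_n => x 0 i)} :=
          @coord_continuous R 1 n 0 i c.
        exact: (cvgZr_tmp (a := v' i) hc).
    have g : continuous (fun c : 'rV[R]_n => w - \sum_i c 0 i *: v' i).
      by move=> c; exact: (cvgB (f := cst w) (cvg_cst w) (h c)).
    by move=> c; exact: (continuous_comp (g c) (@norm_continuous _ _ _)).
  (* Only [y] with |y| <= 2 |w| + 1 can be at distance less than 1 from [w], and such [y] have
     coefficients in this compact ball. *)
  pose B := [set c : 'rV[R]_n | `|c| <= M * (2 * `|w| + 1)].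
  have cB : compact B.
    apply: bounded_closed_compact.
      exists (M * (2 * `|w| + 1)); split; first exact: num_real.
      by move=> r hr c /= hc; exact: le_trans hc (ltW hr).
    have -> : B = (fun c : 'rV[R]_n => `|c|) @^-1` [set r | r <= M * (2 * `|w| + 1)].
      by [].
    by apply: closed_comp; [move=> *; exact: norm_continuous|exact: closed_le].
  have B0 : B !=set0.
    by exists 0; rewrite /B/= normr0 mulr_ge0// ?ltW// addr_ge0// mulr_ge0.
  have [c cB' cmin] := compact_EVT_min B0 cB (continuous_subspaceT cf).
  have fc0 : 0 < f c.
    rewrite normr_gt0 subr_eq0; apply/eqP => wE; apply: vn.
    by exists (fun i => c 0 i).
  exists (Num.min (f c) 1); first by rewrite lt_min fc0 ltr01.
  move=> y sy; have [c' c'E c'M] := hM _ sy.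
  have [yB|yB] := leP `|y| (2 * `|w| + 1).
    rewrite ge_min; apply/orP; left.
    have -> : `|w - y| = f (\row_i c' i).
      by rewrite /f c'E; under [in RHS]eq_bigr do rewrite mxE.
    apply: cmin; rewrite inE /B /=.
    rewrite (le_trans _ (ler_wpM2l (ltW M0) yB))//.
    rewrite (le_trans _ c'M)//.
    rewrite (le_trans (rV_norm_le_sum _))//.
    by apply: ler_sum => i _; rewrite mxE.
  rewrite ge_min; apply/orP; right.
  have := ler_distD w y 0; rewrite !subr0 distrC; have := normr_ge0 w; lra.
(* The last coefficient is at most |x| / d, and what remains of [x] has norm at most (1 + |w| / d)
   |x|. *)
exists (d^-1 + M * (1 + d^-1 * `|w|)).
  by rewrite addr_gt0// ?invr_gt0// mulr_gt0// ltr_pwDl// mulr_ge0// invr_ge0 ltW.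
move=> x [c _ <-]; set x' := (X in _ * `|X|).
pose y := \sum_i c (widen_ord (leqnSn n) i) *: v' i.
have xE : x' = y + c ord_max *: w by rewrite /x' big_ord_recr.
have tx : `|c ord_max| <= d^-1 * `|x'|.
  rewrite mulrC ler_pdivlMr//.
  have [->|t0] := eqVneq (c ord_max) 0; first by rewrite normr0 mul0r.
  have -> : x' = c ord_max *: (w - (- (c ord_max)^-1) *: y).
    by rewrite scalerBr scalerA mulrN divff// scaleN1r opprK xE addrC.
  rewrite normrZ ler_wpM2l// hd//.
  exists (fun i => (- (c ord_max)^-1) * c (widen_ord (leqnSn n) i)) => //.
  by rewrite scaler_sumr; apply: eq_bigr => i _; rewrite scalerA.
have [|c' c'E c'M] := hM y; first by exists (fun i => c (widen_ord (leqnSn n) i)).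
have lw (i : 'I_n) : widen_ord (leqnSn n) i = lift ord_max i.
  by apply/val_inj; rewrite /= /bump leqNgt ltn_ord.
exists (fun i => if unlift ord_max i is Some j then c' j else c ord_max).
  rewrite -/x' xE big_ord_recr/= unlift_none; congr (_ + _); rewrite c'E.
  by apply: eq_bigr => i _; rewrite {1}lw liftK.
rewrite big_ord_recr/= unlift_none.
under eq_bigr do rewrite lw liftK.
have hy : `|y| <= (1 + d^-1 * `|w|) * `|x'|.
  have -> : y = x' - c ord_max *: w by rewrite xE addrK.
  rewrite (le_trans (ler_normB _ _))// normrZ mulrDl mul1r lerD2l.
  by rewrite mulrAC ler_wpM2r.
rewrite addrC mulrDl lerD// (le_trans c'M)// -mulrA ler_wpM2l// ltW//.
Qed.

End AlmostIsometry.

(** * Back and forth *)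

Lemma dependent_choice_nat (T : Type) (P : nat -> T -> Prop)
    (Q : nat -> T -> T -> Prop) :
  (forall n t, P n t -> exists t', P n.+1 t' /\ Q n t t') ->
  forall t0, P 0%N t0 ->
    exists2 f : nat -> T, f 0%N = t0 &
      forall n, P n (f n) /\ Q n (f n) (f n.+1).
Proof.
move=> h t0 Pt0.
have /choice[g gP] : forall nt : nat * T, exists t',
    P nt.1 nt.2 -> P nt.1.+1 t' /\ Q nt.1 nt.2 t'.
  move=> [n t] /=; have [/h[t' ht']|nP] := pselect (P n t); first by exists t'.
  by exists t0.
pose f := fix f n := if n is n'.+1 then g (n', f n') else t0.
have Pf n : P n (f n) by elim: n => // n /(gP (n, f n)) [].
by exists f => // n; split=> //; have [] := gP (n, f n) (Pf n).
Qed.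

Section BackAndForth.
Variable R : realType.

Definition moved_by (E : normedModType R) p eta (a x : nat -> E) : Prop :=
  forall i, (i < p)%N -> `|x i - a i| <= eta.

(* The partial isometries a i |-> a' i and b j |-> b' j; the vectors b (2 i)
   and b' (2 i) stand for the images of a i and a' i under the operators. *)
Definition stage (U V U' V' : normedModType R) (Om : U -> V) (Om' : U' -> V')
    p eps (a : nat -> U) (a' : nat -> U') (b : nat -> V) (b' : nat -> V') :
    Prop :=
  [/\ almost_isometric p eps a a', almost_isometric p.*2 eps b b',
      forall i, (i < p)%N -> `|Om (a i) - b i.*2| <= eps &
      forall i, (i < p)%N -> `|Om' (a' i) - b' i.*2| <= eps].

Lemma stage_sym (U V U' V' : normedModType R) (Om : U -> V) (Om' : U' -> V')
    p eps (a : nat -> U) (a' : nat -> U') (b : nat -> V) (b' : nat -> V') :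
  stage Om Om' p eps a a' b b' -> stage Om' Om p eps a' a b' b.
Proof. by case=> h1 h2 h3 h4; split=> //; exact: almost_isometric_sym. Qed.

(** Position [p] receives [u], position [p.*2] is reserved for the image of [u], and [p.*2.+1]
    receives [v]. The factor 10 leaves room for both kinds of operators to which this is applied. *)
Definition one_step (U' V' : normedModType R) (Om' : {linear U' -> V'}) : Prop :=
  forall (U V : normedModType R) (Om : {linear U -> V}) p (eps delta : R)
      (a : nat -> U) (a' : nat -> U') (b : nat -> V) (b' : nat -> V')
      (u : U) (v : V),
    (forall x, `|Om x| <= `|x|) -> 0 < eps -> 0 < delta ->
    stage Om Om' p eps a a' b b' ->
    exists x x' y y', [/\ stage Om Om' p.+1 delta x x' y y',
      moved_by p (10 * eps) a x /\ moved_by p (10 * eps) a' x',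
      moved_by p.*2 (10 * eps) b y /\ moved_by p.*2 (10 * eps) b' y',
      x p = u & y p.*2.+1 = v].

Lemma moved_by_trans (E : normedModType R) p q eta eta' (a x y : nat -> E) :
  (p <= q)%N -> moved_by p eta a x -> moved_by q eta' x y ->
  moved_by p (eta + eta') a y.
Proof.
move=> pq h h' i ip; have := ler_distD (x i) (y i) (a i).
have := h i ip; have := h' i (leq_trans ip pq); lra.
Qed.

(** The first step takes in [u] and [v]; the second, with the roles of the operators exchanged,
    takes in [u'] and [v'] and displaces [u], [v] by at most [10 * eps]. *)
Lemma two_steps (U V U' V' : normedModType R) (Om : {linear U -> V})
    (Om' : {linear U' -> V'}) p (eps delta : R)
    (a : nat -> U) (a' : nat -> U') (b : nat -> V) (b' : nat -> V') u v u' v' :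
  one_step Om -> one_step Om' ->
  (forall x, `|Om x| <= `|x|) -> (forall x, `|Om' x| <= `|x|) ->
  0 < eps -> 0 < delta -> stage Om Om' p eps a a' b b' ->
  exists x x' y y', stage Om Om' p.+2 delta x x' y y' /\
    [/\ moved_by p (20 * eps) a x, moved_by p (20 * eps) a' x',
      moved_by p.*2 (20 * eps) b y & moved_by p.*2 (20 * eps) b' y'] /\
    [/\ `|x p - u| <= 20 * eps, `|y p.*2.+1 - v| <= 20 * eps,
      `|x' p.+1 - u'| <= 20 * eps & `|y' p.*2.+3 - v'| <= 20 * eps].
Proof.
move=> s s' n n' eps0 delta0 h.
have [x [x' [y [y' [h1 [xa xa'] [yb yb'] xp yp]]]]] :=
  s' U V Om p eps eps a a' b b' u v n eps0 eps0 h.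
have [z' [z [w' [w [h2 [zx' zx] [wy' wy] zp wp]]]]] :=
  s U' V' Om' p.+1 eps delta x' x y' y u' v' n' eps0 delta0 (stage_sym h1).
exists z, z', w, w'; split; first exact: stage_sym.
have e20 : 20 * eps = 10 * eps + 10 * eps by lra.
have p2 : (p.*2 <= p.+1.*2)%N by rewrite doubleS; lia.
split; first by split; rewrite e20; eapply moved_by_trans; eauto.
split.
- by rewrite -xp; have := zx p (leqnn _); lra.
- rewrite -yp; have := wy p.*2.+1; rewrite doubleS ltnS => /(_ (leqnn _)); lra.
- by rewrite zp subrr normr0; lra.
- by move: wp; rewrite doubleS => ->; rewrite subrr normr0; lra.
Qed.

Lemma geometric_small (C eta : R) : 0 < eta ->
  exists N, forall n, (N <= n)%N -> C * 2^-1 ^+ n < eta.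
Proof.
move=> eta0.
have cv : (C * 2^-1 ^+ n) @[n --> \oo] --> (0 : R).
  rewrite -[X in _ --> X](mulr0 C); apply: cvgMr; apply: cvg_expr.
  by rewrite ger0_norm// invf_lt1// ltr1n.
have /cvgrPdist_lt /(_ eta eta0) [M _ hM] := cv.
exists M => n Mn; have := hM n Mn.
by rewrite sub0r normrN; apply: le_lt_trans; exact: ler_norm.
Qed.

(** Entry [i] is meaningful only from some stage on; starting at the least such stage gives the
    estimate at every stage where the entry is meaningful. *)
Lemma nested_limits (E : completeNormedModType R) (x : nat -> nat -> E)
    (q : nat -> nat) (K : R) :
  0 <= K -> {homo q : m n / (m <= n)%N} -> (forall i, exists n, (i < q n)%N) ->
  (forall n, moved_by (q n) (K * 2^-1 ^+ n) (x n) (x n.+1)) ->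
  exists l : nat -> E, forall n, moved_by (q n) (2 * K * 2^-1 ^+ n) l (x n).
Proof.
move=> K0 hq exq h.
have /choice[l lP] : forall i, exists l, forall n, (i < q n)%N ->
    `|x n i - l| <= 2 * K * 2^-1 ^+ n.
  move=> i; case: (ex_minnP (exq i)) => N iN Nmin.
  have [|l lP] := @cvg_geometric R E (x^~ i) K N K0.
    by move=> n Nn; apply: h; apply: leq_trans iN _; exact: hq.
  by exists l => n iqn; apply: lP; exact: Nmin.
by exists l => n i iq; exact: lP.
Qed.

Lemma isometric_limits (E F : normedModType R) (x : nat -> nat -> E)
    (x' : nat -> nat -> F) (l : nat -> E) (l' : nat -> F) q (K eta : R) :
  {homo q : m n / (m <= n)%N} -> (forall i, exists n, (i < q n)%N) ->
  (forall n, almost_isometric (q n) (eta * 2^-1 ^+ n) (x n) (x' n)) ->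
  (forall n, moved_by (q n) (K * 2^-1 ^+ n) l (x n)) ->
  (forall n, moved_by (q n) (K * 2^-1 ^+ n) l' (x' n)) ->
  forall p, almost_isometric p 0 l l'.
Proof.
move=> hq exq isom xl xl' p c.
rewrite mul0r; apply: le0_of_le_eps => e e0.
have [m hm] := exq p.
pose S := \sum_(i < p) `|c i|.
have [N hN] := geometric_small ((eta + K + K) * S) e0.
pose n := maxn m N.
have pn : (p <= q n)%N by apply: leq_trans (ltnW hm) _; apply: hq; exact: leq_maxl.
have h1 : almost_isometric p (eta * 2^-1 ^+ n) (x n) (x' n).
  move=> d; have := isom n (fun i => if (i < p)%N then d i else 0).
  rewrite (big_ord_widen_cond (q n) predT (fun i => d i *: x n i))//.
  rewrite (big_ord_widen_cond (q n) predT (fun i => d i *: x' n i))//.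
  rewrite (big_ord_widen_cond (q n) predT (fun i => `|d i|))//.
  have aux (W : zmodType) (f : nat -> W) (g : nat -> R -> W) :
      (forall i, g i 0 = 0) ->
      \sum_(i < q n) g i (if (i < p)%N then d i else 0) =
      \sum_(i < q n | (i < p)%N) g i (d i).
    move=> g0; rewrite [RHS]big_mkcond/=; apply: eq_bigr => i _.
    by case: ifP.
  rewrite (aux _ (x n) (fun i s => s *: x n i)); last by move=> i; rewrite scale0r.
  rewrite (aux _ (x' n) (fun i s => s *: x' n i)); last by move=> i; rewrite scale0r.
  by rewrite (aux _ (fun=> 0 : R) (fun i s => `|s|)); last by rewrite normr0.
have := almost_isometric_perturb h1 (fun i ip => xl n i (leq_trans ip pn))
  (fun i ip => xl' n i (leq_trans ip pn)) c.
move=> /le_trans; apply; apply: ltW.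
have := hN n (leq_maxr _ _); rewrite -/S; congr (_ < _); ring.
Qed.

Lemma back_and_forth (U V U' V' : completeNormedModType R)
    (Om : {linear U -> V}) (Om' : {linear U' -> V'}) p (eta : R)
    (a : nat -> U) (a' : nat -> U') (b : nat -> V) (b' : nat -> V') :
  separable U -> separable V -> separable U' -> separable V' ->
  one_step Om -> one_step Om' ->
  (forall x, `|Om x| <= `|x|) -> (forall x, `|Om' x| <= `|x|) ->
  0 < eta -> stage Om Om' p eta a a' b b' ->
  exists (I : {linear U -> U'}) (J : {linear V -> V'}),
    [/\ bijective_isometry I, bijective_isometry J,
        forall x, Om' (I x) = J (Om x),
        forall i, (i < p)%N -> `|I (a i) - a' i| <= 80 * eta &
        forall j, (j < p.*2)%N -> `|J (b j) - b' j| <= 80 * eta].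
Proof.
move=> sU sV sU' sV' st st' nOm nOm' eta0 s0.
have [u uP] := dense_sequence_repeating sU.
have [v vP] := dense_sequence_repeating sV.
have [u' uP'] := dense_sequence_repeating sU'.
have [v' vP'] := dense_sequence_repeating sV'.
pose T := ((nat -> U) * (nat -> U') * ((nat -> V) * (nat -> V')))%type.
(* Each double step adds two domain vectors, one chosen on either side, and the error [e n]
   halves. *)
pose q n := (p + n.*2)%N.
pose e n : R := eta * 2^-1 ^+ n.
have e0 n : 0 < e n by rewrite mulr_gt0// exprn_gt0// invr_gt0.
pose P n (t : T) := stage Om Om' (q n) (e n) t.1.1 t.1.2 t.2.1 t.2.2.
pose Q n (t s : T) :=
  [/\ moved_by (q n) (20 * e n) t.1.1 s.1.1,
      moved_by (q n) (20 * e n) t.1.2 s.1.2,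
      moved_by (q n).*2 (20 * e n) t.2.1 s.2.1 &
      moved_by (q n).*2 (20 * e n) t.2.2 s.2.2] /\
  [/\ `|s.1.1 (q n) - u n| <= 20 * e n,
      `|s.2.1 (q n).*2.+1 - v n| <= 20 * e n,
      `|s.1.2 (q n).+1 - u' n| <= 20 * e n &
      `|s.2.2 (q n).*2.+3 - v' n| <= 20 * e n].
have qS n : q n.+1 = (q n).+2 by rewrite /q doubleS !addnS.
have [||f f0 fP] := @dependent_choice_nat T P Q _ ((a, a'), (b, b')).
- move=> n t Pt.
  have [x [x' [y [y' [h1 h2]]]]] :=
    two_steps (u n) (v n) (u' n) (v' n) st st' nOm nOm' (e0 n) (e0 n.+1) Pt.
  by exists ((x, x'), (y, y')); split=> //; rewrite /P qS.
- by rewrite /P /q /e addn0 expr0 mulr1.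
have qm : {homo q : m n / (m <= n)%N}.
  by move=> m n mn; rewrite /q leq_add2l leq_double.
have q2m : {homo (fun n => (q n).*2) : m n / (m <= n)%N}.
  by move=> m n mn; rewrite leq_double qm.
have qex i : exists n, (i < q n)%N by exists i.+1; rewrite /q; lia.
have q2ex i : exists n, (i < (q n).*2)%N by exists i.+1; rewrite /q; lia.
have K0 : 0 <= 20 * eta by lra.
have eE c n : c * e n = c * eta * 2^-1 ^+ n by rewrite /e mulrA.
have lim (E : completeNormedModType R) (x : nat -> nat -> E) r :
    {homo r : m n / (m <= n)%N} -> (forall i, exists n, (i < r n)%N) ->
    (forall n, moved_by (r n) (20 * e n) (x n) (x n.+1)) ->
    exists l : nat -> E, forall n, moved_by (r n) (2 * (20 * eta) * 2^-1 ^+ n) l (x n).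
  by move=> rm rex h; apply: (nested_limits K0 rm rex) => n; rewrite -eE.
have [l lP] := lim _ (fun n => (f n).1.1) q qm qex
  (fun n => let: conj _ (conj (And4 h _ _ _) _) := fP n in h).
have [l' lP'] := lim _ (fun n => (f n).1.2) q qm qex
  (fun n => let: conj _ (conj (And4 _ h _ _) _) := fP n in h).
have [k kP] := lim _ (fun n => (f n).2.1) _ q2m q2ex
  (fun n => let: conj _ (conj (And4 _ _ h _) _) := fP n in h).
have [k' kP'] := lim _ (fun n => (f n).2.2) _ q2m q2ex
  (fun n => let: conj _ (conj (And4 _ _ _ h) _) := fP n in h).
have il := isometric_limits qm qex
  (fun n => let: conj (And4 h _ _ _) _ := fP n in h) lP lP'.
have ik := isometric_limits q2m q2ex
  (fun n => let: conj (And4 _ h _ _) _ := fP n in h) kP kP'.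
(* A target [w n] close to [z] with [n] large is met within [20 * e n] at stage [n.+1], and the
   entry meeting it is within another [20 * e n] of its limit. *)
have dens (E : normedModType R) (w : nat -> E) (x : nat -> nat -> E) m r
    (ix : nat -> nat) :
    (forall x eta N, 0 < eta -> exists2 n, (N <= n)%N & `|x - w n| < eta) ->
    (forall n, moved_by (r n) (2 * (20 * eta) * 2^-1 ^+ n) m (x n)) ->
    (forall n, (ix n < r n.+1)%N) ->
    (forall n, `|x n.+1 (ix n) - w n| <= 20 * e n) ->
    forall z d, 0 < d -> exists n, `|z - m n| < d.
  move=> dw mx hix hw z d d0.
  have d20 : 0 < d / 2 by lra.
  have [N hN] := geometric_small (40 * eta) d20.
  have [n Nn zn] := dw z _ N d20; exists (ix n).
  have := mx n.+1 _ (hix n); have := hw n; have := hN n Nn.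
  have -> : 20 * e n = 20 * eta * 2^-1 ^+ n by rewrite eE.
  rewrite exprS distrC => h1 h2 h3.
  have := ler_distD (w n) z (m (ix n)).
  have := ler_distD (x n.+1 (ix n)) (w n) (m (ix n)).
  have : 2 * (20 * eta) * (2^-1 * 2^-1 ^+ n) = 20 * eta * 2^-1 ^+ n by field.
  have : 40 * eta * 2^-1 ^+ n = 20 * eta * 2^-1 ^+ n + 20 * eta * 2^-1 ^+ n by ring.
  move: h1 h2 h3; lra.
have dl := dens _ _ _ _ _ (fun n => q n) uP lP (fun n => _)
  (fun n => let: conj _ (conj _ (And4 h _ _ _)) := fP n in h).
have dk := dens _ _ _ _ _ (fun n => (q n).*2.+1) vP kP (fun n => _)
  (fun n => let: conj _ (conj _ (And4 _ h _ _)) := fP n in h).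
have dl' := dens _ _ _ _ _ (fun n => (q n).+1) uP' lP' (fun n => _)
  (fun n => let: conj _ (conj _ (And4 _ _ h _)) := fP n in h).
have dk' := dens _ _ _ _ _ (fun n => (q n).*2.+3) vP' kP' (fun n => _)
  (fun n => let: conj _ (conj _ (And4 _ _ _ h)) := fP n in h).
have [||I [Ibij Iiso] IP] := @isometry_of_dense_sequences R U U' l l' il.
- by apply: dl => n; rewrite qS.
- by apply: dl' => n; rewrite qS.
have [||J [Jbij Jiso] JP] := @isometry_of_dense_sequences R V V' k k' ik.
- by apply: dk => n; rewrite qS !doubleS; lia.
- by apply: dk' => n; rewrite qS !doubleS.
(* At stage [n] the image of entry [i] is within [e n] of entry [i.*2] of the codomain tuple, so in
   the limit the two agree exactly. *)
have img (E F : normedModType R) (A : {linear E -> F}) (x : nat -> nat -> E)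
    (y : nat -> nat -> F) m r :
    (forall x, `|A x| <= `|x|) ->
    (forall n, moved_by (q n) (2 * (20 * eta) * 2^-1 ^+ n) m (x n)) ->
    (forall n, moved_by (q n).*2 (2 * (20 * eta) * 2^-1 ^+ n) r (y n)) ->
    (forall n i, (i < q n)%N -> `|A (x n i) - y n i.*2| <= e n) ->
    forall i, A (m i) = r i.*2.
  move=> nA mx ry h i; apply/eqP; rewrite -subr_eq0 -normr_le0.
  apply: le0_of_le_eps => d d0.
  have [n0 hn0] := qex i.
  have [N hN] := geometric_small (81 * eta) d0.
  pose n := maxn n0 N.
  have iq : (i < q n)%N by apply: leq_trans hn0 _; apply: qm; exact: leq_maxl.
  have := h n i iq; have := mx n i iq.
  have := ry n i.*2; rewrite ltn_double => /(_ iq) h1 h2 h3.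
  have := hN n (leq_maxr _ _) => h4.
  have h5 := nA (m i - x n i); rewrite linearB in h5.
  rewrite distrC in h2.
  have := ler_distD (A (x n i)) (A (m i)) (r i.*2).
  have := ler_distD (y n i.*2) (A (x n i)) (r i.*2).
  have : 81 * eta * 2^-1 ^+ n = 2 * (20 * eta) * 2^-1 ^+ n + 2 * (20 * eta) * 2^-1 ^+ n + e n.
    by rewrite /e; ring.
  move: h1 h2 h3 h4 h5; lra.
have lk := img _ _ _ _ _ _ _ nOm lP kP
  (fun n => let: conj (And4 _ _ h _) _ := fP n in h).
have lk' := img _ _ _ _ _ _ _ nOm' lP' kP'
  (fun n => let: conj (And4 _ _ _ h) _ := fP n in h).
exists I, J; split.
- by split.
- by split.
- move=> x; apply/eqP; rewrite -subr_eq0 -normr_le0.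
  apply: le0_of_le_eps => d d0.
  have d20 : 0 < d / 2 by lra.
  have [|n hn] := dl _ x _ d20; first by move=> m; rewrite qS.
  have eq1 : Om' (I (l n)) = J (Om (l n)) by rewrite IP lk' lk JP.
  have h1 := nOm' (I (x - l n)); rewrite Iiso in h1.
  have h2 := nOm (x - l n); rewrite -(Jiso (Om _)) in h2.
  rewrite !linearB in h1 h2.
  rewrite eq1 in h1; rewrite distrC in h2.
  have := ler_distD (J (Om (l n))) (Om' (I x)) (J (Om x)); lra.
(* Both [a i] and [a' i] are within [40 * eta] of their limits, which correspond under [I]. *)
- move=> i ip.
  have := lP 0%N i; have := lP' 0%N i; rewrite /q addn0 expr0 mulr1 f0 /=.
  move=> /(_ ip) h1 /(_ ip) h2; rewrite -Iiso linearB IP in h2.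
  rewrite distrC in h1.
  have := ler_distD (l' i) (I (a i)) (a' i); lra.
- move=> i ip.
  have := kP 0%N i; have := kP' 0%N i; rewrite /q addn0 expr0 mulr1 f0 /=.
  move=> /(_ ip) h1 /(_ ip) h2; rewrite -Jiso linearB JP in h2.
  rewrite distrC in h1.
  have := ler_distD (k' i) (J (b i)) (b' i); lra.
Qed.

End BackAndForth.

(** * Amalgams and operators with the Gurarii property *)

Section NormedSubspace.
Variables (R : realType) (E : lmodType R) (A : set E) (N : E -> R).
Hypotheses (subA : Defs.subspace A) (normN : is_norm_on A N).

(** The proof is an argument so that the instances below can recover it from the predicate; likewise
    for the norm in [normed_subspace]. A type is required because the Gurarii property quantifies
    over normed spaces as types. *)
Definition subspace_pred (_ : Defs.subspace A) : {pred E} := [pred x | x \in A].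

Lemma subspace_pred_closed : submod_closed (subspace_pred subA).
Proof.
case: subA => A0 Alin; split; first by rewrite !inE.
by move=> s x y; rewrite !inE; exact: Alin.
Qed.

HB.instance Definition _ :=
  GRing.isSubmodClosed.Build R E (subspace_pred subA) subspace_pred_closed.

Definition normed_subspace (_ : is_norm_on A N) : Type :=
  {x : E | x \in subspace_pred subA}.

HB.instance Definition _ := SubChoice.on (normed_subspace normN).
HB.instance Definition _ :=
  [SubChoice_isSubLmodule of normed_subspace normN by <:].

Let norm (x : normed_subspace normN) : R := N (val x).

Lemma normed_subspace_mem (x : normed_subspace normN) : A (val x).
Proof. by have := valP x; rewrite !inE. Qed.

Let ler_normD x y : norm (x + y) <= norm x + norm y.
Proof. by case: normN => _ _; apply; exact: normed_subspace_mem. Qed.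

Let normrZ (l : R) x : norm (l *: x) = `|l| * norm x.
Proof. by case: normN => _ + _; apply; exact: normed_subspace_mem. Qed.

Let normr0_eq0 x : norm x = 0 -> x = 0.
Proof.
move=> x0; apply: val_inj; case: normN => + _ _; apply => //.
exact: normed_subspace_mem.
Qed.

HB.instance Definition _ := Lmodule_isNormed.Build R (normed_subspace normN)
  ler_normD normrZ normr0_eq0.

Lemma norm_normed_subspace (x : normed_subspace normN) : `|x| = N (val x).
Proof. by []. Qed.

Lemma mem_normed_subspace x : A x -> x \in subspace_pred subA.
Proof. by rewrite !inE. Qed.

Definition to_normed_subspace x (Ax : A x) : normed_subspace normN :=
  Sub x (mem_normed_subspace Ax).

Lemma findim_normed_subspace :
  findim A -> findim [set: normed_subspace normN].
Proof.
move=> [n [v Av]].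
have vA i : A (v i).
  rewrite Av; exists (fun j => (i == j)%:R) => //.
  rewrite (bigD1 i)//= eqxx scale1r big1 ?addr0// => j /negPf.
  by rewrite eq_sym => ->; rewrite scale0r.
exists n, (fun i => to_normed_subspace (vA i)).
apply/seteqP; split=> // x _.
have := normed_subspace_mem x; rewrite Av => -[c _ cE].
exists c => //; apply: val_inj.
by rewrite -cE raddf_sum; apply: eq_bigr.
Qed.

End NormedSubspace.

Section NormedSubspaceMap.
Variables (R : realType) (E E' : lmodType R) (A : set E) (A' : set E').
Variables (N : E -> R) (N' : E' -> R).
Variables (subA : Defs.subspace A) (subA' : Defs.subspace A').
Variables (normN : is_norm_on A N) (normN' : is_norm_on A' N').

Lemma normed_subspace_map (f : {linear E -> E'}) :
  (forall x, A x -> A' (f x)) ->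
  exists f' : {linear normed_subspace subA normN -> normed_subspace subA' normN'},
    forall x, val (f' x) = f (val x).
Proof.
move=> fA.
pose g (x : normed_subspace subA normN) : normed_subspace subA' normN' :=
  to_normed_subspace subA' normN' (fA _ (normed_subspace_mem x)).
have lg : linear g.
  move=> s x y; apply: val_inj.
  by rewrite linearP [LHS]/= linearP.
pose l := GRing.isLinear.Build R _ _ *:%R g lg.
pose g' : {linear normed_subspace subA normN -> normed_subspace subA' normN'} :=
  HB.pack g l.
by exists g'.
Qed.

End NormedSubspaceMap.

(** * Amalgam norms on products *)

Section Amalgam.
Variables (R : realType) (E F : normedModType R).
Variables (p : nat) (C : R) (a : nat -> E) (a' : nat -> F).

(** The cost of writing [z] as a vector of the l^1-sum minus sum c_i (a_i, - a'_i), where each (a_i,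
    - a'_i) is charged [C]. *)
Definition amalgam_bound (z : E * F) (c : nat -> R) : R :=
  `|z.1 + \sum_(i < p) c i *: a i| + `|z.2 - \sum_(i < p) c i *: a' i|
    + C * \sum_(i < p) `|c i|.

(* The largest seminorm bounded by the l^1-norm for which each (a i, - a' i)
   has norm at most C; it glues a i to a' i up to C. *)
Definition amalgam (z : E * F) : R := inf (range (amalgam_bound z)).

Hypothesis C0 : 0 < C.

Lemma amalgam_bound_ge0 z c : 0 <= amalgam_bound z c.
Proof. by rewrite !addr_ge0// mulr_ge0// ?sumr_ge0// ltW. Qed.

Lemma amalgam_le z c : amalgam z <= amalgam_bound z c.
Proof.
apply: ge_inf; last by exists c.
by exists 0 => _ [d _ <-]; exact: amalgam_bound_ge0.
Qed.

Lemma le_amalgam z m : (forall c, m <= amalgam_bound z c) -> m <= amalgam z.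
Proof.
move=> h; apply: lb_le_inf; first by exists (amalgam_bound z (fun=> 0)), (fun=> 0).
by move=> _ [c _ <-].
Qed.

Lemma amalgam_lt z m : amalgam z < m -> exists c, amalgam_bound z c < m.
Proof.
move=> zm; apply: contrapT => /forallNP h; move: zm; rewrite ltNge => /negP; apply.
by apply: le_amalgam => c; rewrite leNgt; apply/negP.
Qed.

Lemma amalgam_ge0 z : 0 <= amalgam z.
Proof. by apply: le_amalgam => c; exact: amalgam_bound_ge0. Qed.

Lemma amalgam_le_l1 z : amalgam z <= `|z.1| + `|z.2|.
Proof.
apply: le_trans (amalgam_le z (fun=> 0)) _.
rewrite /amalgam_bound !big1; do ?by move=> i _; rewrite ?scale0r ?normr0.
by rewrite addr0 subr0 mulr0 addr0.
Qed.

Lemma norm_comb_le (G : normedModType R) (x : nat -> G) (c : nat -> R) q :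
  `|\sum_(i < q) c i *: x i| <= (\sum_(i < q) `|x i|) * \sum_(i < q) `|c i|.
Proof.
rewrite (le_trans (ler_norm_sum _ _ _))// mulr_sumr; apply: ler_sum => i _.
rewrite normrZ mulrC ler_wpM2r//.
by rewrite (bigD1 i)//= lerDl sumr_ge0.
Qed.

(** Positivity of [C] yields definiteness: a cheap decomposition of [z] has small coefficients, so
    both components of [z] are small. Homogeneity follows from one inequality, used for [s] and for
    its inverse. *)
Lemma amalgam_norm : is_norm_on [set: E * F] amalgam.
Proof.
have leZ s z : amalgam (s *: z) <= `|s| * amalgam z.
  have [->|s0] := eqVneq s 0.
    rewrite normr0 mul0r scale0r (le_trans (amalgam_le_l1 _))//=.
    by rewrite !normr0 addr0.
  have s0' : 0 < `|s| by rewrite normr_gt0.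
  rewrite -ler_pdivrMl//; apply: le_amalgam => c.
  rewrite ler_pdivrMl//; apply: le_trans (amalgam_le _ (fun i => s * c i)) _.
  rewrite /amalgam_bound /= -[leLHS]/(_ + _ + _).
  under eq_bigr do rewrite -scalerA.
  rewrite -scaler_sumr -scalerDr normrZ.
  under [X in _ + `|_ - X|]eq_bigr do rewrite -scalerA.
  rewrite -scaler_sumr -scalerBr normrZ.
  under [X in _ + _ * X]eq_bigr do rewrite normrM.
  by rewrite -mulr_sumr !mulrDr mulrCA.
split=> [z _ z0|s z _|z w _ _].
- have fin (G : normedModType R) (x : G) (M : R) : 0 <= M ->
      (forall eta, 0 < eta -> `|x| <= eta * (1 + M / C)) -> x = 0.
    move=> M0 h; apply/eqP; rewrite -normr_le0; apply: le0_of_le_eps => eta eta0.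
    have k0 : 0 < 1 + M / C by rewrite ltr_pwDl// divr_ge0// ltW.
    by rewrite (le_trans (h (eta / (1 + M / C)) _)) ?divr_gt0// divfK// gt_eqF.
  have key eta : 0 < eta -> exists c : nat -> R, [/\ `|z.1 + \sum_(i < p) c i *: a i| <= eta,
      `|z.2 - \sum_(i < p) c i *: a' i| <= eta & \sum_(i < p) `|c i| <= eta / C].
    rewrite -{1}z0 => /amalgam_lt[c]; rewrite /amalgam_bound => h; exists c.
    have h1 : 0 <= C * \sum_(i < p) `|c i| by rewrite mulr_ge0 ?sumr_ge0// ltW.
    have := normr_ge0 (z.1 + \sum_(i < p) c i *: a i).
    have := normr_ge0 (z.2 - \sum_(i < p) c i *: a' i).
    by move: h h1 => + + ? ?; split; [lra|lra|rewrite ler_pdivlMr// mulrC; lra].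
  rewrite [z]surjective_pairing; congr pair.
    apply: (fin _ _ (\sum_(i < p) `|a i|)); first by rewrite sumr_ge0.
    move=> eta /key[c [h1 _ h3]].
    have := ler_normB (z.1 + \sum_(i < p) c i *: a i) (\sum_(i < p) c i *: a i).
    rewrite addrK => /le_trans; apply; rewrite mulrDr mulr1 lerD//.
    rewrite (le_trans (norm_comb_le _ _ _))// mulrCA.
    by rewrite ler_wpM2l// sumr_ge0.
  apply: (fin _ _ (\sum_(i < p) `|a' i|)); first by rewrite sumr_ge0.
  move=> eta /key[c [_ h1 h3]].
  have := ler_normD (z.2 - \sum_(i < p) c i *: a' i) (\sum_(i < p) c i *: a' i).
  rewrite subrK => /le_trans; apply; rewrite mulrDr mulr1 lerD//.
  rewrite (le_trans (norm_comb_le _ _ _))// mulrCA.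
  by rewrite ler_wpM2l// sumr_ge0.
- apply/eqP; rewrite eq_le leZ/=.
  have [->|s0] := eqVneq s 0; first by rewrite normr0 mul0r amalgam_ge0.
  have := leZ s^-1 (s *: z).
  by rewrite scalerA mulVf// scale1r normfV ler_pdivlMl// normr_gt0.
- apply/ler_addgt0Pr => eta eta0.
  have eta20 : 0 < eta / 2 by lra.
  have [|c hc] := @amalgam_lt z (amalgam z + eta / 2); first by rewrite ltrDl.
  have [|d hd] := @amalgam_lt w (amalgam w + eta / 2); first by rewrite ltrDl.
  apply: le_trans (amalgam_le _ (fun i => c i + d i)) _.
  move: hc hd; rewrite /amalgam_bound /=.
  have -> : \sum_(i < p) (c i + d i) *: a i =
      \sum_(i < p) c i *: a i + \sum_(i < p) d i *: a i.
    by rewrite -big_split; apply: eq_bigr => i _; rewrite scalerDl.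
  have -> : \sum_(i < p) (c i + d i) *: a' i =
      \sum_(i < p) c i *: a' i + \sum_(i < p) d i *: a' i.
    by rewrite -big_split; apply: eq_bigr => i _; rewrite scalerDl.
  have : C * \sum_(i < p) `|c i + d i| <=
      C * \sum_(i < p) `|c i| + C * \sum_(i < p) `|d i|.
    rewrite -mulrDr; apply: ler_wpM2l; first exact: ltW.
    by rewrite -big_split/=; apply: ler_sum => i _; exact: ler_normD.
  set A := \sum_(i < p) c i *: a i; set B := \sum_(i < p) d i *: a i.
  set A' := \sum_(i < p) c i *: a' i; set B' := \sum_(i < p) d i *: a' i.
  have -> : z.1 + w.1 + (A + B) = z.1 + A + (w.1 + B) by linear_identity R.
  have -> : z.2 + w.2 - (A' + B') = z.2 - A' + (w.2 - B') by linear_identity R.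
  have := ler_normD (z.1 + A) (w.1 + B); have := ler_normD (z.2 - A') (w.2 - B').
  by lra.
Qed.

Lemma amalgam_glue i : (i < p)%N -> amalgam (a i, - a' i) <= C.
Proof.
move=> ip; apply: le_trans (amalgam_le _ (fun j => - (j == i)%:R)) _.
have one (G : normedModType R) (x : nat -> G) :
    \sum_(j < p) - (val j == i)%:R *: x j = - x i.
  rewrite (bigD1 (Ordinal ip))//= eqxx scaleN1r big1 ?addr0// => j.
  by rewrite -val_eqE /= => /negPf ->; rewrite oppr0 scale0r.
rewrite /amalgam_bound /= !one subrr opprK addNr !normr0 !add0r.
rewrite (bigD1 (Ordinal ip))//= eqxx normrN1 big1 ?addr0 ?mulr1// => j.
by rewrite -val_eqE /= => /negPf ->; rewrite oppr0 normr0.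
Qed.

Hypothesis isom : almost_isometric p C a a'.

(** The charge C sum |c_i| is exactly what pays for exchanging the combination of the [a' i] for
    that of the [a i]; the triangle inequality then gives back [x]. *)
Lemma amalgam_left x : amalgam (x, 0) = `|x|.
Proof.
apply/eqP; rewrite eq_le; apply/andP; split.
  by rewrite (le_trans (amalgam_le_l1 _))//= normr0 addr0.
apply: le_amalgam => c; rewrite /amalgam_bound/= sub0r normrN.
have := ler_normB (x + \sum_(i < p) c i *: a i) (\sum_(i < p) c i *: a i).
rewrite addrK; have := isom c; rewrite ler_norml => /andP[]; lra.
Qed.

Lemma amalgam_right x : amalgam (0, x) = `|x|.
Proof.
apply/eqP; rewrite eq_le; apply/andP; split.
  by rewrite (le_trans (amalgam_le_l1 _))//= normr0 add0r.
apply: le_amalgam => c; rewrite /amalgam_bound/= add0r.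
have := ler_normD (x - \sum_(i < p) c i *: a' i) (\sum_(i < p) c i *: a' i).
rewrite subrK; have := isom c; rewrite ler_norml => /andP[]; lra.
Qed.

End Amalgam.

Lemma sum_even (G : nmodType) (f : nat -> G) p :
  (forall i, odd i -> f i = 0) -> \sum_(j < p.*2) f j = \sum_(i < p) f i.*2.
Proof.
move=> f0; elim: p => [|p IH]; first by rewrite !big_ord0.
rewrite doubleS !big_ord_recr/= IH (f0 p.*2.+1) ?addr0//=.
by rewrite odd_double.
Qed.

(** Domain coefficients are moved to the even positions of the codomain. Replacing [Om (a i)] by
    [b i.*2] and [Om' (a' i)] by [b' i.*2] costs [eps] each per unit of coefficient, on top of the
    glueing constant [eps]: hence [3 * eps]. *)
Lemma amalgam_operator (R : realType) (U V U' V' : normedModType R)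
    (Om : {linear U -> V}) (Om' : {linear U' -> V'}) p eps
    (a : nat -> U) (a' : nat -> U') (b : nat -> V) (b' : nat -> V') z :
  0 < eps -> (forall x, `|Om x| <= `|x|) -> (forall x, `|Om' x| <= `|x|) ->
  stage Om Om' p eps a a' b b' ->
  amalgam p.*2 eps b b' (Om z.1, Om' z.2) <= amalgam p (3 * eps) a a' z.
Proof.
move=> eps0 nOm nOm' [_ _ h h']; apply: le_amalgam => c.
pose d j := if odd j then 0 else c j./2.
have d0 j : odd j -> d j = 0 by rewrite /d => ->.
have dE i : d i.*2 = c i by rewrite /d odd_double doubleK.
apply: le_trans (@amalgam_le R V V' p.*2 eps b b' eps0 _ d) _; rewrite /amalgam_bound/=.
rewrite (@sum_even _ (fun j => d j *: b j)); last by move=> j /d0 ->; rewrite scale0r.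
rewrite (@sum_even _ (fun j => d j *: b' j)); last by move=> j /d0 ->; rewrite scale0r.
rewrite (@sum_even _ (fun j => `|d j|)); last by move=> j /d0 ->; rewrite normr0.
rewrite (eq_bigr (fun i : 'I_p => c i *: b i.*2)); last by move=> i; rewrite dE.
rewrite (eq_bigr (fun i : 'I_p => c i *: b' i.*2)); last by move=> i; rewrite dE.
rewrite (eq_bigr (fun i : 'I_p => `|c i|)); last by move=> i; rewrite dE.
set S := \sum_(i < p) `|c i|.
have e1 := norm_comb_sub c h; have e1' := norm_comb_sub c h'.
have e2 := nOm (z.1 + \sum_(i < p) c i *: a i).
have e2' := nOm' (z.2 - \sum_(i < p) c i *: a' i).
have sumZ (W Z : lmodType R) (f : {linear W -> Z}) (x : nat -> W) :
    f (\sum_(i < p) c i *: x i) = \sum_(i < p) c i *: f (x i).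
  by rewrite linear_sum; apply: eq_bigr => i _; rewrite linearZ.
rewrite linearD sumZ in e2; rewrite linearB sumZ in e2'.
rewrite -/S in e1 e1'.
move: e1 e1' e2 e2'.
set X := \sum_(i < p) c i *: Om (a i); set Y := \sum_(i < p) c i *: b i.*2.
set X' := \sum_(i < p) c i *: Om' (a' i); set Y' := \sum_(i < p) c i *: b' i.*2.
move=> e1 e1' e2 e2'.
have := ler_distD (Om z.1 + X) (Om z.1 + Y) 0.
have := ler_distD (Om' z.2 - X') (Om' z.2 - Y') 0.
rewrite !subr0.
have -> : Om' z.2 - Y' - (Om' z.2 - X') = X' - Y' by linear_identity R.
have -> : Om z.1 + Y - (Om z.1 + X) = - (X - Y) by linear_identity R.
by rewrite normrN; lra.
Qed.

(** * Operator norms and finite-dimensional hulls *)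

Section OperatorNorm.
Variables (R : realType) (X Y : normedModType R).

Lemma opnorm_on_bound (A : set X) (f : X -> Y) (e : R) :
  Defs.subspace A -> linear_on A f -> (opnorm_on A f <= e%:E)%E ->
  forall x, A x -> `|f x| <= e * `|x|.
Proof.
move=> [A0 Alin] flin fe x Ax.
have f0 : f 0 = 0.
  by have := flin (-1) 0 0 A0 A0; rewrite scaler0 addr0 scaleN1r addNr.
have fZ s y : A y -> A (s *: y) /\ f (s *: y) = s *: f y.
  move=> Ay; have := Alin s y 0 Ay A0; have := flin s y 0 Ay A0.
  by rewrite f0 !addr0.
have [->|x0] := eqVneq x 0; first by rewrite f0 !normr0 mulr0.
have nx0 : 0 < `|x| by rewrite normr_gt0.
have [Ax' fx'] := fZ `|x|^-1 x Ax.
have : (`|f (`|x|^-1 *: x)|%:E <= e%:E)%E.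
  apply: le_trans fe; apply: ereal_sup_ubound; exists (`|x|^-1 *: x) => //.
  by split=> //; rewrite normrZ normfV normr_id mulVf// gt_eqF.
by rewrite lee_fin fx' normrZ normfV normr_id ler_pdivrMl// mulrC.
Qed.

Lemma opnorm_on_le (A : set X) (f : X -> Y) (e : R) :
  (forall x, A x -> `|x| <= 1 -> `|f x| <= e) -> (opnorm_on A f <= e%:E)%E.
Proof.
move=> h; apply: ge_ereal_sup => _ [x [Ax x1] <-].
by rewrite lee_fin h.
Qed.

Lemma opnorm_le1P (f : {linear X -> Y}) :
  (opnorm f <= 1%:E)%E <-> forall x, `|f x| <= `|x|.
Proof.
split=> [h x|h].
  rewrite -[leRHS]mul1r; apply: opnorm_on_bound h _ _ => //.
  by move=> s y z _ _; rewrite linearP.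
by apply: opnorm_on_le => x _; apply: le_trans (h x).
Qed.

End OperatorNorm.

(** Minimality reduces the check that an operator maps one hull into another to the generators. *)
Lemma findim_hull (R : realType) (E : lmodType R) (s : seq E) :
  exists A : set E, [/\ Defs.subspace A, findim A, {in s, forall x, A x} &
    forall S, Defs.subspace S -> {in s, forall x, S x} -> A `<=` S].
Proof.
pose v i := tnth (in_tuple s) i.
exists (Defs.span v); split.
- split; first by exists (fun=> 0) => //; rewrite big1// => i _; rewrite scale0r.
  move=> k _ _ [c _ <-] [d _ <-]; exists (fun i => k * c i + d i) => //.
  rewrite scaler_sumr -big_split/=; apply: eq_bigr => i _.
  by rewrite scalerDl scalerA.
- by exists (size s), v.
- move=> _ /(tnthP (in_tuple s))[i ->]; exists (fun j => (j == i)%:R) => //.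
  rewrite (bigD1 i)//= eqxx scale1r big1 ?addr0// => j /negPf ->.
  by rewrite scale0r.
- move=> S [S0 Slin] sS _ [c _ <-]; apply: (big_ind S) => //.
    by move=> x y Sx Sy; rewrite -[x]scale1r; exact: Slin.
  move=> i _; rewrite -[_ *: _]addr0; apply: Slin => //; apply: sS.
  exact: mem_tnth.
Qed.

Lemma almost_isometric_le (R : realType) (E F : normedModType R) p (e e' : R)
    (a : nat -> E) (a' : nat -> F) :
  e <= e' -> almost_isometric p e a a' -> almost_isometric p e' a a'.
Proof.
by move=> ee h c; rewrite (le_trans (h c))// ler_wpM2r// sumr_ge0.
Qed.

Lemma norm_le_sum (R : realType) (E : normedModType R) p (x : nat -> E) i :
  (i < p)%N -> `|x i| <= \sum_(j < p) `|x j|.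
Proof.
by move=> ip; rewrite (bigD1 (Ordinal ip))//= lerDl sumr_ge0.
Qed.

Lemma subspace_preimage (R : realType) (E F : lmodType R) (f : {linear E -> F})
    (S : set F) : Defs.subspace S -> Defs.subspace (f @^-1` S).
Proof.
move=> [S0 Slin]; split=> [|s x y fx fy]; first by rewrite /preimage/= linear0.
by rewrite /preimage/= linearP; exact: Slin.
Qed.

Lemma comb_pair_left (R : realType) (E F : lmodType R) p (x : nat -> E)
    (c : nat -> R) :
  \sum_(i < p) c i *: (x i, 0 : F) = (\sum_(i < p) c i *: x i, 0).
Proof.
elim: p => [|p IH]; first by rewrite !big_ord0.
by rewrite !big_ord_recr/= IH; congr pair; rewrite /= scaler0 addr0.
Qed.

(** As 1 / (1 + e) >= 1 - e, the relative distortion is at most [e], and a combination has norm at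
    most (sum |x_i|) (sum |c_i|). *)
Lemma eps_embedding_almost_isometric (R : realType) (E W Z : normedModType R) p
    (e delta : R) (k : {linear W -> Z}) (x : nat -> E) (w : nat -> W) :
  eps_embedding e k ->
  (forall c : nat -> R, `|\sum_(i < p) c i *: w i| = `|\sum_(i < p) c i *: x i|) ->
  0 <= e -> e * \sum_(i < p) `|x i| <= delta ->
  almost_isometric p delta x (fun i => k (w i)).
Proof.
move=> ek wx e0 exd c.
have -> : \sum_(i < p) c i *: k (w i) = k (\sum_(i < p) c i *: w i).
  by rewrite linear_sum; apply: eq_bigr => i _; rewrite linearZ.
have [h1 h2] := ek (\sum_(i < p) c i *: w i).
rewrite wx in h1 h2; rewrite ger0_norm ?subr_ge0//.
have h3 : (1 - e) * `|\sum_(i < p) c i *: x i| <=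
    (1 + e)^-1 * `|\sum_(i < p) c i *: x i|.
  rewrite ler_wpM2r// -[leRHS]mul1r ler_pdivlMr ?ltr_wpDr//.
  by rewrite mulrDr mulr1 mulrBl mul1r; nra.
have h4 := norm_comb_le x c p.
have h5 : e * `|\sum_(i < p) c i *: x i| <= delta * \sum_(i < p) `|c i|.
  apply: le_trans (ler_wpM2l e0 h4) _; rewrite mulrA ler_wpM2r//.
  by rewrite sumr_ge0.
by lra.
Qed.

Section GurariiStep.
Variables (R : realType) (U' V' : completeNormedModType R).
Variable Om' : {linear U' -> V'}.

(* Apply the Gurarii property to the operator (Om, Om') on the amalgams. *)
Lemma gurarii_one_step : gurarii_property Om' -> one_step Om'.
Proof.
move=> [/opnorm_le1P nOm' gur].
move=> U V Om p eps delta a a' b b' u v nOm eps0 delta0 st.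
have [isoa isob hOm hOm'] := st.
have eps30 : 0 < 3 * eps by lra.
have {}isoa : almost_isometric p (3 * eps) a a'.
  by apply: almost_isometric_le isoa; lra.
pose x i := if (i < p)%N then a i else u.
(* The even entries are replaced by exact images of the [x i], which displaces the old ones by at
   most [eps]; the tuple in [U] is only extended. *)
pose y j := if odd j then (if (j < p.*2)%N then b j else v) else Om (x j./2).
have [SA [subA finA memA minA]] := findim_hull
  ([seq (x i, 0 : U') | i <- iota 0 p.+1] ++ [seq (0 : U, a' i) | i <- iota 0 p]).
have [SB [subB finB memB minB]] := findim_hull
  ([seq (y j, 0 : V') | j <- iota 0 p.+1.*2] ++
   [seq (b j, 0 : V') | j <- iota 0 p.*2] ++
   [seq (0 : V, b' j) | j <- iota 0 p.*2] ++
   [seq (0 : V, Om' (a' i)) | i <- iota 0 p]).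
have Ax i : (i < p.+1)%N -> SA (x i, 0).
  by move=> ip; apply: memA; rewrite mem_cat map_f// mem_iota.
have Aa' i : (i < p)%N -> SA (0, a' i).
  by move=> ip; apply: memA; rewrite mem_cat [X in _ || X]map_f ?orbT// mem_iota.
have By j : (j < p.+1.*2)%N -> SB (y j, 0).
  by move=> jp; apply: memB; rewrite !mem_cat map_f// mem_iota.
have Bb j : (j < p.*2)%N -> SB (b j, 0).
  move=> jp; apply: memB; rewrite !mem_cat.
  by rewrite [X in [|| _, X | _]]map_f ?orbT// mem_iota.
have Bb' j : (j < p.*2)%N -> SB (0, b' j).
  move=> jp; apply: memB; rewrite !mem_cat.
  by rewrite [X in [|| _, _, X | _]]map_f ?orbT// mem_iota.
have BOm' i : (i < p)%N -> SB (0, Om' (a' i)).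
  move=> ip; apply: memB; rewrite !mem_cat.
  by rewrite [X in [|| _, _, _ | X]]map_f ?orbT// mem_iota.
pose NA := amalgam p (3 * eps) a a'; pose NB := amalgam p.*2 eps b b'.
have normA : is_norm_on SA NA.
  have [h1 h2 h3] := amalgam_norm p a a' eps30.
  by split=> *; [apply: h1|apply: h2|apply: h3].
have normB : is_norm_on SB NB.
  have [h1 h2 h3] := amalgam_norm p.*2 b b' eps0.
  by split=> *; [apply: h1|apply: h2|apply: h3].
pose X := normed_subspace subA normA; pose Y := normed_subspace subB normB.
pose T0 (z : U * U') : V * V' := (Om z.1, Om' z.2).
have linT0 : linear T0 by move=> s z w; rewrite /T0 !linearP.
pose lT0 := GRing.isLinear.Build R _ _ *:%R T0 linT0.
pose T1 : {linear (U * U')%type -> (V * V')%type} := HB.pack T0 lT0.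
have yE i : y i.*2 = Om (x i) by rewrite /y odd_double doubleK.
have [|T TE] := @normed_subspace_map R _ _ SA SB NA NB subA subB normA normB T1.
  move=> z Az; apply: (minA (T1 @^-1` SB)) Az.
    exact: subspace_preimage.
  move=> w; rewrite mem_cat => /orP[] /mapP[i]; rewrite mem_iota add0n /= => ip ->.
    by rewrite /T0/= linear0 -yE; apply: By; rewrite ltn_double.
  by rewrite /T0/= linear0; apply: BOm'.
(* The parts of the hulls inside the copies of [U'] and [V']; the second projection embeds them
   isometrically. *)
pose X0 : set X := [set z | (val z).1 = 0].
pose Y0 : set Y := [set z | (val z).1 = 0].
(* [M] bounds all norms that occur, so the tolerance [e] turns relative errors into absolute ones
   below both [eps] and [delta]. *)
pose M := 1 + \sum_(i < p.+1) `|x i| + \sum_(i < p) `|a' i| +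
  \sum_(j < p.+1.*2) `|y j| + \sum_(j < p.*2) `|b' j|.
have S1 : 0 <= \sum_(i < p.+1) `|x i| by exact: sumr_ge0.
have S2 : 0 <= \sum_(i < p) `|a' i| by exact: sumr_ge0.
have S3 : 0 <= \sum_(j < p.+1.*2) `|y j| by exact: sumr_ge0.
have S4 : 0 <= \sum_(j < p.*2) `|b' j| by exact: sumr_ge0.
have M0 : 0 < M by rewrite /M; lra.
pose e := Num.min eps delta / M.
have e0 : 0 < e by rewrite divr_gt0// lt_min eps0.
have eM : e * M = Num.min eps delta by rewrite divfK// gt_eqF.
have eeps r : r <= M -> e * r <= eps.
  move=> rM; apply: le_trans (ler_wpM2l (ltW e0) rM) _.
  by rewrite eM ge_min lexx.
have edelta r : r <= M -> e * r <= delta.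
  move=> rM; apply: le_trans (ler_wpM2l (ltW e0) rM) _.
  by rewrite eM ge_min lexx orbT.
have sub0 (E F : lmodType R) (A : set (E * F)) (N : E * F -> R) (sA : Defs.subspace A)
    (nA : is_norm_on A N) :
    Defs.subspace [set z : normed_subspace sA nA | (val z).1 = 0].
  split; first by [].
  by move=> s z w /= z0 w0; rewrite z0 w0 scaler0 addr0.
have nT : (opnorm T <= 1%:E)%E.
  apply/opnorm_le1P => z; rewrite !norm_normed_subspace TE.
  exact: amalgam_operator st.
have TX0 : T @` X0 `<=` Y0.
  by move=> _ [z z0 <-]; rewrite /Y0 /= TE /= z0 linear0.
have iX0 : isometric_embedding_on X0 (fun z => (val z).2).
  split=> [s z w _ _|z z0]; first by [].
  rewrite norm_normed_subspace [in RHS](surjective_pairing (val z)) z0.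
  by rewrite /NA amalgam_right.
have iY0 : isometric_embedding_on Y0 (fun z => (val z).2).
  split=> [s z w _ _|z z0]; first by [].
  rewrite norm_normed_subspace [in RHS](surjective_pairing (val z)) z0.
  by rewrite /NB amalgam_right.
have iT z : X0 z -> Om' (val z).2 = (val (T z)).2 by move=> _; rewrite TE.
have [i' [j' [ei ej di dj dij]]] := gur e X Y T X0 Y0
  (fun z => (val z).2) (fun z => (val z).2) e0
  (findim_normed_subspace subA normA finA)
  (findim_normed_subspace subB normB finB) nT
  (sub0 _ _ _ _ _ _) (sub0 _ _ _ _ _ _) TX0 iX0 iY0 iT.
pose inX z : X := if pselect (SA z) is left h then to_normed_subspace subA normA h else 0.
pose inY z : Y := if pselect (SB z) is left h then to_normed_subspace subB normB h else 0.
have inXE z : SA z -> val (inX z) = z by rewrite /inX; case: pselect.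
have inYE z : SB z -> val (inY z) = z by rewrite /inY; case: pselect.
pose x' i := i' (inX (x i, 0)); pose y' j := j' (inY (y j, 0)).
have nX z : SA z -> `|inX z| = NA z by move=> Az; rewrite norm_normed_subspace inXE.
have nY z : SB z -> `|inY z| = NB z by move=> Bz; rewrite norm_normed_subspace inYE.
have di' z : X0 z -> `|i' z - (val z).2| <= e * `|z|.
  apply: opnorm_on_bound (ltW di) _; first exact: sub0.
  move=> s z1 z2 _ _; rewrite !linearP/=; linear_identity R.
have dj' z : Y0 z -> `|j' z - (val z).2| <= e * `|z|.
  apply: opnorm_on_bound (ltW dj) _; first exact: sub0.
  move=> s z1 z2 _ _; rewrite !linearP/=; linear_identity R.
have dij' z : `|Om' (i' z) - j' (T z)| <= e * `|z|.
  apply: opnorm_on_bound (ltW dij) _ _ => //.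
  by move=> s z1 z2 _ _; rewrite !linearP/=; linear_identity R.
have xM i : (i < p.+1)%N -> `|x i| <= M.
  by move=> ip; have := norm_le_sum x ip; clear -S2 S3 S4; rewrite /M; lra.
have aM i : (i < p)%N -> `|a' i| <= M.
  by move=> ip; have := norm_le_sum a' ip; clear -S1 S3 S4; rewrite /M; lra.
have bM j : (j < p.*2)%N -> `|b' j| <= M.
  by move=> ip; have := norm_le_sum b' ip; clear -S1 S2 S3; rewrite /M; lra.
have NB_triangle z1 z2 : NB (z1 + z2) <= NB z1 + NB z2.
  by have [_ _] := amalgam_norm p.*2 b b' eps0; apply.
have yb j : (j < p.*2)%N -> `|y j - b j| <= eps.
  move=> jp; rewrite /y; case: ifPn => oj.
    by rewrite jp subrr normr0 ltW.
  have jE : j = j./2.*2 by rewrite -[LHS]odd_double_half (negPf oj).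
  have jp2 : (j./2 < p)%N by rewrite -ltn_double -jE.
  by rewrite /x jp2 {2}jE; exact: hOm.
exists x, x', y, y'; split.
- split.
  + apply: (@eps_embedding_almost_isometric _ _ _ _ _ e _ _ x (fun i => inX (x i, 0))).
    * exact: ei.
    * move=> c; rewrite norm_normed_subspace raddf_sum/=.
      rewrite (eq_bigr (fun i : 'I_p.+1 => c i *: (x i, 0 : U'))); last first.
        move=> i _; rewrite -[LHS]/(c i *: val (inX (x i, 0))) inXE//.
        exact: Ax.
      by rewrite comb_pair_left /NA amalgam_left.
    * exact: ltW.
    * by apply: edelta; clear -S2 S3 S4; rewrite /M; lra.
  + apply: (@eps_embedding_almost_isometric _ _ _ _ _ e _ _ y (fun j => inY (y j, 0))).
    * exact: ej.
    * move=> c; rewrite norm_normed_subspace raddf_sum/=.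
      rewrite (eq_bigr (fun i : 'I_p.+1.*2 => c i *: (y i, 0 : V'))); last first.
        move=> i _; rewrite -[LHS]/(c i *: val (inY (y i, 0))) inYE//.
        exact: By.
      by rewrite comb_pair_left /NB amalgam_left.
    * exact: ltW.
    * by apply: edelta; clear -S1 S2 S4; rewrite /M; lra.
  + by move=> i ip; rewrite yE subrr normr0 ltW.
  + move=> i ip; rewrite /x' /y'.
    have -> : inY (y i.*2, 0) = T (inX (x i, 0)).
      apply: val_inj; apply: etrans (inYE _ _) _.
        by apply: By; rewrite ltn_double.
      apply/esym; apply: etrans (TE _) _; rewrite (inXE _ (Ax _ ip)).
      by rewrite yE -(linear0 Om').
    have := dij' (inX (x i, 0)).
    rewrite (nX _ (Ax _ ip)) /NA amalgam_left// => /le_trans; apply.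
    exact/edelta/xM.
- split=> i ip; first by rewrite /x ip subrr normr0 mulr_ge0// ltW.
  (* The glued difference contributes at most [3 * eps], as [i'] is nonexpansive, and the deviation
     of [i'] from the projection at most [eps]. *)
  have -> : x' i - a' i = i' (inX (x i, 0) - inX (0, a' i)) +
      (i' (inX (0, a' i)) - (val (inX (0, a' i))).2).
    rewrite (inXE _ (Aa' _ ip)) linearB -[(0, a' i).2]/(a' i) /x'.
    by rewrite addrA subrK.
  apply: le_trans (ler_normD _ _) _.
  have /di' h1 : X0 (inX (0, a' i)) by rewrite /X0/= (inXE _ (Aa' _ ip)).
  rewrite (nX _ (Aa' _ ip)) /NA amalgam_right// in h1.
  have h2 := eeps _ (aM _ ip).
  have [_ h3] := ei (inX (x i, 0) - inX (0, a' i)).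
  rewrite norm_normed_subspace in h3.
  have vE : val (inX (x i, 0) - inX (0, a' i)) = (a i, - a' i).
    have -> : val (inX (x i, 0) - inX (0, a' i)) =
      val (inX (x i, 0)) - val (inX (0, a' i)) by [].
    rewrite (inXE _ (Aa' _ ip)) (inXE _ (Ax _ (leqW ip))).
    by rewrite /x ip; congr pair; rewrite /= ?subr0 ?sub0r.
  rewrite vE in h3.
  have h4 := amalgam_glue a a' eps30 ip.
  apply: le_trans (lerD (le_trans h3 h4) (le_trans h1 h2)) _.
  by clear -eps0; lra.
- split=> j jp.
    by apply: le_trans (yb _ jp) _; clear -eps0; lra.
  have jp2 : (j < p.+1.*2)%N by rewrite doubleS; do 2 apply: leqW.
  have -> : y' j - b' j = j' (inY (y j, 0) - inY (0, b' j)) +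
      (j' (inY (0, b' j)) - (val (inY (0, b' j))).2).
    by rewrite (inYE _ (Bb' _ jp)) linearB -[(0, b' j).2]/(b' j) /y' addrA subrK.
  apply: le_trans (ler_normD _ _) _.
  have /dj' h1 : Y0 (inY (0, b' j)) by rewrite /Y0/= (inYE _ (Bb' _ jp)).
  rewrite (nY _ (Bb' _ jp)) /NB amalgam_right// in h1.
  have h2 := eeps _ (bM _ jp).
  have [_ h3] := ej (inY (y j, 0) - inY (0, b' j)).
  rewrite norm_normed_subspace in h3.
  (* Only [b j] is glued to [b' j]; passing from [y j] to [b j] costs another [eps]. *)
  have vE : val (inY (y j, 0) - inY (0, b' j)) = (y j - b j, 0) + (b j, - b' j).
    have -> : val (inY (y j, 0) - inY (0, b' j)) =
      val (inY (y j, 0)) - val (inY (0, b' j)) by [].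
    rewrite (inYE _ (Bb' _ jp)) (inYE _ (By _ jp2)).
    by congr pair; rewrite /= ?subr0 ?sub0r ?add0r ?subrK.
  rewrite vE in h3.
  have h4 := amalgam_glue b b' eps0 jp.
  have h5 := NB_triangle (y j - b j, 0) (b j, - b' j).
  rewrite [X in _ <= X + _]amalgam_left// in h5.
  have h6 := lerD (yb _ jp) h4.
  apply: le_trans (lerD (le_trans h3 (le_trans h5 h6)) (le_trans h1 h2)) _.
  by clear -eps0; lra.
- by rewrite /x ltnn.
- by rewrite /y/= odd_double/= ltnNge leqnSn.
Qed.

End GurariiStep.

(** * Rational polyhedral norms *)

Section Lines.
Variables (R : realType) (I : finType).

(* One step of Fourier-Motzkin elimination. *)
Lemma lines_below (A B : I -> R) (m : R) (l0 : I) :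
  B l0 < 0 ->
  (forall k, B k = 0 -> A k <= m) ->
  (forall k l, 0 < B k -> B l < 0 ->
     - B l * A k + B k * A l <= m * (B k - B l)) ->
  exists t, forall k, A k + t * B k <= m.
Proof.
move=> Bl0 h0 h.
(* A line of negative slope bounds [t] from below. The largest of these lower bounds is taken as
   [t], and the lines of positive slope are then checked against the one attaining it. *)
case: (@Order.TotalTheory.arg_maxP _ R I l0 (fun l => B l < 0)
  (fun l => (m - A l) / B l)) => // l Bl lmax.
exists ((m - A l) / B l) => k.
have [Bk|Bk|Bk] := ltgtP (B k) 0; last by rewrite Bk mulr0 addr0 h0.
  have : (m - A k) / B k <= (m - A l) / B l := lmax k Bk.
  by rewrite ler_ndivrMr// lerBrDl.
have := h k l Bk Bl => H.
rewrite -lerBrDl mulrAC ler_ndivrMr//.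
by move: H; rewrite !mulrBl !mulrBr; lra.
Qed.
End Lines.

Section PolyhedralNorms.
Variables (R : realType) (E : lmodType R) (A Q : set E).
Hypothesis subA : Defs.subspace A.

Definition rational_functional (f : E -> R) : Prop :=
  (forall (s : R) x y, A x -> A y -> f (s *: x + y) = s * f x + f y) /\
  forall x, A x -> Q x -> exists r : rat, f x = ratr r.

Definition seminorm_on (N : E -> R) : Prop :=
  (forall (s : R) x, A x -> N (s *: x) = `|s| * N x) /\
  (forall x y, A x -> A y -> N (x + y) <= N x + N y).

(* The index type is required to be inhabited so that the maximum of the
   functionals is attained. *)
Definition polyhedral (N : E -> R) : Prop :=
  exists (I : finType) (i0 : I) (f : I -> E -> R),
    (forall i, rational_functional (f i)) /\
    forall x, A x -> N x = \big[Num.max/0]_(i : I) `|f i x|.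

Lemma bigmax_attained (I : finType) (i0 : I) (g : I -> R) :
  (forall i, 0 <= g i) -> exists i, \big[Num.max/0]_i g i = g i.
Proof.
move=> g0; case: (@Order.TotalTheory.arg_maxP _ R I i0 predT g) => // i _ imax.
exists i; apply/eqP; rewrite eq_le le_bigmax andbT.
by apply: bigmax_le => // j _; exact: imax.
Qed.

Lemma subspaceB x y s : A x -> A y -> A (x - s *: y).
Proof.
by move=> Ax Ay; rewrite addrC -scaleNr; case: subA => _; apply.
Qed.

Lemma rational_functionalB f x y s : rational_functional f ->
  A x -> A y -> f (x - s *: y) = f x - s * f y.
Proof. by move=> [fl _] Ax Ay; rewrite addrC -scaleNr fl// mulNr addrC. Qed.

Lemma rational_functional0 f : rational_functional f -> f 0 = 0.
Proof.
move=> [fl _]; have [A0 _] := subA.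
by have := fl (-1) 0 0 A0 A0; rewrite scaler0 addr0 mulN1r addNr.
Qed.

Lemma rational_functional_comb f g (s t : rat) :
  rational_functional f -> rational_functional g ->
  rational_functional (fun x => ratr s * f x + ratr t * g x).
Proof.
move=> [fl fQ] [gl gQ]; split=> [c x y Ax Ay|x Ax Qx].
  by rewrite fl// gl//; ring.
have [q ->] := fQ x Ax Qx; have [q' ->] := gQ x Ax Qx.
by exists (s * q + t * q'); rewrite rmorphD !rmorphM.
Qed.

Lemma polyhedral_ge0 N x : polyhedral N -> A x -> 0 <= N x.
Proof.
by move=> [I [i0 [f [_ fE]]]] Ax; rewrite fE//; exact: bigmax_ge_id.
Qed.

Lemma polyhedral_seminorm N : polyhedral N -> seminorm_on N.
Proof.
move=> [I [i0 [f [fr fE]]]].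
have [A0 Alin] := subA.
have AZ s x : A x -> A (s *: x) by move=> Ax; rewrite -[_ *: _]addr0; exact: Alin.
have AD x y : A x -> A y -> A (x + y).
  by move=> Ax Ay; rewrite -[x]scale1r; exact: Alin.
have fZ i s x : A x -> f i (s *: x) = s * f i x.
  move=> Ax; rewrite -[s *: x]addr0 (fr i).1//.
  by rewrite (rational_functional0 (fr i)) addr0.
have fD i x y : A x -> A y -> f i (x + y) = f i x + f i y.
  by move=> Ax Ay; rewrite -{1}[x]scale1r (fr i).1// mul1r.
split=> [s x Ax|x y Ax Ay].
  rewrite !fE//; last exact: AZ.
  apply/eqP; rewrite eq_le; apply/andP; split.
    apply: bigmax_le; first by rewrite mulr_ge0// bigmax_ge_id.
    by move=> i _; rewrite fZ// normrM ler_wpM2l//; exact: (le_bigmax _ (fun i => `|f i x|)).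
  have [i ->] := @bigmax_attained I i0 (fun i => `|f i x|) (fun=> normr_ge0 _).
  by rewrite -normrM -fZ//; exact: (le_bigmax _ (fun i => `|f i (s *: x)|)).
rewrite !fE//; last exact: AD.
apply: bigmax_le; first by rewrite addr_ge0// bigmax_ge_id.
move=> i _; rewrite fD// (le_trans (ler_normD _ _))// lerD//.
  exact: (le_bigmax _ (fun i => `|f i x|)).
exact: (le_bigmax _ (fun i => `|f i y|)).
Qed.

(** |s| + K |t| is the larger of |s + K t| and |s - K t|, which doubles the family of
    functionals. *)
Lemma polyhedral_add_abs N phi (K : rat) : 0 <= K ->
  polyhedral N -> rational_functional phi ->
  polyhedral (fun x => N x + ratr K * `|phi x|).
Proof.
move=> K0 [I [i0 [f [fr fE]]]] phir.
exists (I * bool)%type, (i0, true),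
  (fun ib x => ratr 1 * f ib.1 x + ratr (if ib.2 then K else - K) * phi x).
split=> [[i b]|x Ax]; first exact: rational_functional_comb.
have K0' : 0 <= ratr K :> R by rewrite ler0q.
rewrite fE//; apply/eqP; rewrite eq_le; apply/andP; split; last first.
  apply: bigmax_le; first by rewrite addr_ge0 ?bigmax_ge_id// mulr_ge0.
  move=> [i b] _ /=; rewrite rmorph1 mul1r (le_trans (ler_normD _ _))// lerD//.
    exact: (le_bigmax _ (fun i => `|f i x|)).
  by rewrite normrM; case: b; rewrite ?rmorphN ?normrN (ger0_norm K0').
have [i ->] := @bigmax_attained I i0 (fun i => `|f i x|) (fun=> normr_ge0 _).
pose b := (0 <= f i x) == (0 <= phi x).
apply: le_trans (le_bigmax _ (fun ib : I * bool =>
  `|ratr 1 * f ib.1 x + ratr (if ib.2 then K else - K) * phi x|) (i, b)).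
rewrite /= rmorph1 mul1r /b.
case: (lerP 0 (f i x)) => hf; case: (lerP 0 (phi x)) => hp /=; rewrite ?rmorphN.
- by rewrite (ger0_norm hf) (ger0_norm hp) ler_norm.
- by rewrite (ger0_norm hf) (ltr0_norm hp) mulrN -mulNr ler_norm.
- rewrite (ltr0_norm hf) (ger0_norm hp) -[leRHS]normrN opprD mulNr opprK.
  exact: ler_norm.
- rewrite (ltr0_norm hf) (ltr0_norm hp) -[leRHS]normrN opprD -mulrN.
  exact: ler_norm.
Qed.

Lemma rational_functional_sub (f : E -> R) (g : E -> R) :
  (forall x, A x -> f x = g x) -> rational_functional f -> rational_functional g.
Proof.
move=> fg [fl fr]; split=> [s x y Ax Ay|x Ax Qx].
  by rewrite -!fg//; first exact: fl; case: subA => _; apply.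
by rewrite -fg//; exact: fr.
Qed.

Section Shrink.
Variables (P : E -> R) (w : E) (r : rat).
Hypotheses (polP : polyhedral P) (Aw : A w) (Qw : Q w) (r0 : 0 < r).

(* Infimal convolution with a rational segment, i.e. the quotient of the
   l^1-sum with a line, preserves polyhedrality. *)
Lemma polyhedral_shrink : exists2 P', polyhedral P' & forall z, A z ->
  (forall t, P' z <= P (z - t *: w) + ratr r * `|t|) /\
  exists t, P (z - t *: w) + ratr r * `|t| <= P' z.
Proof.
have [I [i0 [f [fr fE]]]] := polP.
have /choice[q qE] : forall i, exists q : rat, f i w = ratr q.
  by move=> i; exact: (fr i).2.
pose J := (I * (bool * bool))%type.
pose sg (b : bool) : rat := if b then 1 else -1.
(* For an index (i, (s, u)) with signs s and u, the line with value [L k z] at 0 and slope [B k] is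
   s f_i (z - t w) + u r t as a function of t. The maximum of these lines is P (z - t w) + r |t|. *)
pose B (k : J) : rat := - (sg k.2.1 * q k.1) + sg k.2.2 * r.
pose L (k : J) (z : E) : R := ratr (sg k.2.1) * f k.1 z.
(* The convex combination of two lines that has slope 0. It does not depend on t, and by elimination
   these combinations determine the minimum over t. *)
pose g (kl : J * J) (z : E) : R :=
  if (0 <= B kl.1) && (B kl.2 <= 0) && (B kl.2 < B kl.1) then
    ratr (- B kl.2 / (B kl.1 - B kl.2)) * L kl.1 z +
    ratr (B kl.1 / (B kl.1 - B kl.2)) * L kl.2 z
  else 0.
have Lr k : rational_functional (L k).
  apply: (@rational_functional_sub (fun z => ratr (sg k.2.1) * f k.1 z + ratr 0 * f k.1 z)).
    by move=> x _; rewrite rmorph0 mul0r addr0.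
  exact: rational_functional_comb.
have gr kl : rational_functional (g kl).
  rewrite /g; case: ((0 <= B kl.1) && (B kl.2 <= 0) && (B kl.2 < B kl.1)).
    exact: rational_functional_comb.
  by split=> [s x y _ _|x _ _]; [rewrite mulr0 addr0|exists 0; rewrite rmorph0].
pose j0 : J := (i0, (true, true)).
exists (fun z => \big[Num.max/0]_(kl : J * J) `|g kl z|).
  by exists (J * J)%type, (j0, j0), g.
move=> z Az.
have r0' : 0 < ratr r :> R by rewrite ltr0q.
have sgM b (c : R) : `|ratr (sg b) * c| = `|c|.
  by case: b; rewrite /sg ?rmorphN rmorph1 ?mulN1r ?mul1r ?normrN.
have Azt t : A (z - t *: w) by exact: subspaceB.
have lineE k t : L k z + t * ratr (B k) =
    ratr (sg k.2.1) * f k.1 (z - t *: w) + ratr (sg k.2.2) * ratr r * t.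
  rewrite (rational_functionalB _ (fr _))// qE /L /B rmorphD rmorphN !rmorphM/=.
  ring.
have line_le k t : `|L k z + t * ratr (B k)| <= P (z - t *: w) + ratr r * `|t|.
  rewrite lineE; apply: le_trans (ler_normD _ _) _.
  rewrite -mulrA !sgM normrM (gtr0_norm r0') lerD2r fE//.
  exact: (le_bigmax _ (fun i => `|f i (z - t *: w)|)).
have P0 t : 0 <= P (z - t *: w) + ratr r * `|t|.
  exact: addr_ge0 (polyhedral_ge0 polP (Azt t)) (mulr_ge0 (ltW r0') (normr_ge0 t)).
split=> [t|].
  apply: bigmax_le.
    exact: P0.
  move=> [k l] _; rewrite /g /=; case: ifP => [/andP[/andP[Bk Bl] Bkl]|_]; last first.
    by rewrite normr0 P0.
  have d0 : 0 < B k - B l by rewrite subr_gt0.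
  have d0' : B k - B l != 0 by rewrite gt_eqF.
  set alpha := - B l / _; set beta := B k / _.
  have al0 : 0 <= alpha by rewrite divr_ge0// ?oppr_ge0// ltW.
  have be0 : 0 <= beta by rewrite divr_ge0// ltW.
  have ab1 : alpha + beta = 1 by rewrite -mulrDl addrC divff.
  have abB : alpha * B k + beta * B l = 0 by rewrite /alpha /beta; field.
  have -> : ratr alpha * L k z + ratr beta * L l z =
      ratr alpha * (L k z + t * ratr (B k)) + ratr beta * (L l z + t * ratr (B l)).
    have : ratr (alpha * B k + beta * B l) = 0 :> R by rewrite abB rmorph0.
    rewrite rmorphD !rmorphM/= => H.
    rewrite !mulrDr addrACA -[LHS]addr0; congr (_ + _).
    by rewrite mulrCA [X in _ = _ + X]mulrCA -mulrDr H mulr0.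
  apply: le_trans (ler_normD _ _) _.
  rewrite (normrM (ratr alpha)) (normrM (ratr beta)).
  rewrite (ger0_norm (_ : 0 <= ratr alpha)) ?ler0q//.
  rewrite (ger0_norm (_ : 0 <= ratr beta)) ?ler0q//.
  have -> : P (z - t *: w) + ratr r * `|t| =
     ratr alpha * (P (z - t *: w) + ratr r * `|t|) + ratr beta * (P (z - t *: w) + ratr r * `|t|).
    by rewrite -mulrDl -rmorphD ab1 rmorph1 mul1r.
  by rewrite lerD// ler_wpM2l// ?ler0q.
set m := \big[Num.max/0]_(kl : J * J) `|g kl z|.
have gm kl : g kl z <= m.
  by rewrite (le_trans (ler_norm _))//; exact: (le_bigmax _ (fun kl => `|g kl z|)).
(* The index exhibited has negative slope, namely -(|q_i0| + r). *)
have [|||t tP] := @lines_below R J (fun k => L k z) (fun k => ratr (B k)) m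
    (i0, (0 <= q i0, false)).
- rewrite ltrq0 /B /sg /=; case: (leP 0 (q i0)) => q0.
    by rewrite mul1r mulN1r -opprD oppr_lt0 ltr_wpDl.
  by rewrite !mulN1r opprK subr_lt0 (lt_trans q0).
(* Flipping the sign in front of r turns a horizontal line into one of slope 2 r up to sign; paired
   with it, the horizontal line gets coefficient 1 in [g]. *)
- move=> [i [s u]] /= /eqP; rewrite fmorph_eq0 => /eqP Bk.
  have : B (i, (s, ~~ u)) = - (2 * sg u * r).
    by move: Bk; rewrite /B /=; case: u => /=; lra.
  have r20 : 0 < 2 * r by rewrite mulr_gt0.
  have r2n : 2 * r != 0 by rewrite gt_eqF.
  case: u Bk => /= Bk; rewrite /sg ?mulrN1 ?mulr1 ?mulNr ?opprK => Bk'.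
    have := gm ((i, (s, true)), (i, (s, false))).
    rewrite /g /= Bk Bk' lexx oppr_le0 oppr_lt0 r20 (ltW r20) /=.
    by rewrite !opprK add0r mul0r rmorph0 mul0r addr0 divff ?rmorph1 ?mul1r.
  have := gm ((i, (s, true)), (i, (s, false))).
  rewrite /g /= Bk Bk' lexx r20 (ltW r20) /=.
  by rewrite oppr0 mul0r rmorph0 mul0r add0r subr0 divff ?rmorph1 ?mul1r.
- move=> k l; rewrite ltr0q ltrq0 => Bk Bl.
  have := gm (k, l); rewrite /g /= (ltW Bk) (ltW Bl) (lt_trans Bl Bk)/=.
  have d0 : 0 < B k - B l by lra.
  have d0' : 0 < ratr (B k) - ratr (B l) :> R by rewrite -rmorphB ltr0q.
  have fd (x : rat) : ratr (x / (B k - B l)) = ratr x / (ratr (B k) - ratr (B l)) :> R.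
    by rewrite fmorph_div/= rmorphB.
  rewrite !fd rmorphN; move: d0'; set d := ratr (B k) - ratr (B l) => d0'.
  rewrite (mulrAC _ d^-1 (L k z)) (mulrAC _ d^-1 (L l z)) -mulrDl.
  by rewrite ler_pdivrMr.
exists t; rewrite fE//.
have [i ->] := @bigmax_attained I i0 (fun i => `|f i (z - t *: w)|) (fun=> normr_ge0 _).
(* The line whose signs match those of f_i (z - t w) and of t attains the value. *)
have := tP (i, (0 <= f i (z - t *: w), 0 <= t)); rewrite lineE /=; apply: le_trans.
rewrite /sg; apply: lerD.
  case: (lerP 0 (f i (z - t *: w))) => s; rewrite ?rmorphN rmorph1.
    by rewrite mul1r ger0_norm.
  by rewrite mulN1r ltr0_norm.
case: (lerP 0 t) => s; rewrite ?rmorphN rmorph1.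
  by rewrite mul1r ger0_norm.
by rewrite mulN1r mulNr -mulrN ltr0_norm.
Qed.

End Shrink.

(** Infimal convolution with one segment gives the largest seminorm that lies below the previous one
    and obeys one more bound. Definiteness survives because the infimum is attained. *)
Lemma rational_largest_norm (P : E -> R) (L : seq (E * rat)) :
  polyhedral P -> is_norm_on A P ->
  (forall wr, wr \in L -> [/\ A wr.1, Q wr.1 & 0 < wr.2]) ->
  exists N, [/\ polyhedral N, is_norm_on A N,
    forall x, A x -> N x <= P x,
    forall wr, wr \in L -> N wr.1 <= ratr wr.2 &
    forall S, seminorm_on S -> (forall x, A x -> S x <= P x) ->
      (forall wr, wr \in L -> S wr.1 <= ratr wr.2) ->
      forall x, A x -> S x <= N x].
Proof.
move=> polP normP; elim: L => [|[w r] L IH] hL; first by exists P; split.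
have [|N [polN normN NP NL Nmax]] := IH.
  by move=> wr wrL; apply: hL; rewrite inE wrL orbT.
have [/= Aw Qw r0] := hL _ (mem_head _ _).
have [N' polN' N'P] := polyhedral_shrink polN Aw Qw r0.
have r0' : 0 < ratr r :> R by rewrite ltr0q.
have N'N x : A x -> N' x <= N x.
  by move=> Ax; have [/(_ 0) + _] := N'P x Ax; rewrite scale0r subr0 normr0 mulr0 addr0.
have [A0 _] := subA.
exists N'; split=> //.
- have [N'Z N'D] := polyhedral_seminorm polN'; split=> // x Ax x0.
  have [_ [t]] := N'P x Ax; rewrite x0 => ht.
  have Nt : 0 <= N (x - t *: w) by apply: polyhedral_ge0 => //; exact: subspaceB.
  have rt : 0 <= ratr r * `|t| by rewrite mulr_ge0// ltW.
  have /eqP : ratr r * `|t| = 0 by lra.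
  rewrite mulf_eq0 gt_eqF//= normr_eq0 => /eqP t0.
  move: ht Nt; rewrite t0 scale0r subr0 normr0 mulr0 addr0 => h1 h2.
  by case: normN => + _ _; apply=> //; apply/eqP; rewrite eq_le h1.
- by move=> x Ax; rewrite (le_trans (N'N _ Ax))// NP.
- move=> wr; rewrite inE => /predU1P[->/=|wrL].
    have [/(_ 1) + _] := N'P w Aw.
    rewrite scale1r subrr normr1 mulr1; move/le_trans; apply.
    have [NZ _] := polyhedral_seminorm polN.
    by have := NZ 0 0 A0; rewrite scaler0 normr0 mul0r => ->; rewrite add0r.
  have [|Awr _ _] := hL wr; first by rewrite inE wrL orbT.
  by rewrite (le_trans (N'N _ _))// NL.
- move=> S [SZ SD] SP SL x Ax; have [_ [t]] := N'P x Ax; apply: le_trans.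
  have [_ Alin] := subA.
  have Atw : A (t *: w) by rewrite -[_ *: _]addr0; exact: Alin.
  have Axt : A (x - t *: w) by exact: subspaceB.
  have := SD _ _ Axt Atw; rewrite subrK => /le_trans; apply; apply: lerD.
    apply: Nmax => // wr wrL; apply: SL; rewrite inE wrL orbT//.
  by rewrite SZ// mulrC ler_wpM2r//; exact: (SL _ (mem_head _ _)).
Qed.

Lemma seminorm0 N : seminorm_on N -> N 0 = 0.
Proof.
move=> [NZ _]; have [A0 _] := subA.
by have := NZ 0 0 A0; rewrite scaler0 normr0 mul0r.
Qed.

(** * Finite grids of rational bounds *)

Section Grid.
Variables (n : nat) (h : {linear 'rV[R]_n -> E}).
Hypotheses (hA : range h = A) (hQ : forall q, rational_row q -> Q (h q)).

Let Ah x : A (h x). Proof. by rewrite -hA; exists x. Qed.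

Lemma seminorm_le_coords N x : seminorm_on N ->
  N (h x) <= \sum_i `|x 0 i| * N (h (delta_mx 0 i)).
Proof.
move=> Ns; have [NZ ND] := Ns.
rewrite {1}[x]row_sum_delta linear_sum/=.
have : A (\sum_i h (x 0 i *: delta_mx 0 i)) /\
    N (\sum_i h (x 0 i *: delta_mx 0 i)) <= \sum_i `|x 0 i| * N (h (delta_mx 0 i)).
  apply: (big_ind2 (fun y r => A y /\ N y <= r)).
  - by rewrite seminorm0//; split=> //; case: subA.
  - move=> y1 r1 y2 r2 [Ay1 h1] [Ay2 h2]; split.
      by rewrite -[y1]scale1r; case: subA => _; apply.
    by rewrite (le_trans (ND _ _ Ay1 Ay2))// lerD.
  - by move=> i _; split=> //; rewrite linearZ/= NZ.
by case.
Qed.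

Lemma seminorm_ge0 N x : seminorm_on N -> 0 <= N (h x).
Proof.
move=> Ns; have [NZ ND] := Ns.
have := ND (h x) (h (- x)) (Ah _) (Ah _).
have -> : h (- x) = -1 *: h x by rewrite linearN scaleN1r.
rewrite NZ// normrN1 mul1r scaleN1r subrr seminorm0//; lra.
Qed.

(* On a fine enough grid of the l^1-ball, prescribing almost the right values
   determines a seminorm up to delta. *)
Lemma rational_grid (P nu : E -> R) (delta : R) :
  seminorm_on P -> seminorm_on nu -> (forall x, A x -> nu x <= P x) -> 0 < delta ->
  exists L : seq (E * rat),
    (forall wr, wr \in L ->
       [/\ A wr.1, Q wr.1, 0 < wr.2 & nu wr.1 <= ratr wr.2]) /\
    forall S, seminorm_on S -> (forall x, A x -> S x <= P x) ->
      (forall wr, wr \in L -> S wr.1 <= ratr wr.2) ->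
      forall x, S (h x) <= nu (h x) + delta * \sum_i `|x 0 i|.
Proof.
move=> Ps nus nuP delta0.
pose K := \sum_i P (h (delta_mx 0 i)).
have K0 : 0 <= K by apply: sumr_ge0 => i _; exact: seminorm_ge0.
(* Rounding to the grid changes [S] and [nu] by at most K / M each, as [P] dominates both, and the
   rational bounds have slack 1 / M. *)
pose M := (Num.truncn ((2 * K + 1) / delta)).+1.
have M0 : 0 < M%:R :> R by rewrite ltr0n.
have Md : (2 * K + 1) / M%:R <= delta.
  by rewrite ler_pdivrMr// [leRHS]mulrC -ler_pdivrMr//; apply: ltW; exact: truncnS_gt.
pose T := {ffun 'I_n -> 'I_(2 * M).+1}.
(* The coordinates run through [-1, 1] with mesh 1 / M. *)
pose qr (k : T) : 'rV[rat]_n := \row_i ((k i)%:R / M%:R - 1).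
pose w (k : T) : E := h (map_mx ratr (qr k)).
have /choice[r rP] : forall k : T, exists r : rat,
    nu (w k) < ratr r < nu (w k) + M%:R^-1.
  move=> k; have : nu (w k) < nu (w k) + M%:R^-1 by rewrite ltrDl invr_gt0.
  by move=> /rat_in_itvoo[r]; rewrite in_itv/= => ?; exists r.
exists [seq (w k, r k) | k <- enum T]; split.
  move=> _ /mapP[k _ ->] /=; have /andP[r1 r2] := rP k.
  split; [exact: Ah|by apply: hQ; exists (qr k)| |exact: ltW].
  by rewrite -(ltr0q R) (le_lt_trans _ r1)// seminorm_ge0.
move=> S Ss SP SL.
have ball (x : 'rV[R]_n) : \sum_i `|x 0 i| <= 1 -> S (h x) <= nu (h x) + delta.
  move=> x1.
  have xi1 i : `|x 0 i| <= 1 by rewrite (le_trans _ x1)// (bigD1 i)//= lerDl sumr_ge0.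
  have pos i : 0 <= M%:R * (x 0 i + 1).
    by rewrite mulr_ge0//; have := xi1 i; rewrite ler_norml => /andP[]; lra.
  have bnd i : (Num.truncn (M%:R * (x 0 i + 1))%R < (2 * M).+1)%N.
    rewrite ltnS -(ler_nat R) natrM; have /andP[+ _] := truncn_itv (pos i).
    move=> /le_trans; apply.
    rewrite mulrC ler_wpM2r//; have := xi1 i; rewrite ler_norml => /andP[]; lra.
  pose k : T := [ffun i => Ordinal (bnd i)].
  have dist i : `|(x - map_mx ratr (qr k)) 0 i| <= M%:R^-1.
    rewrite !mxE rmorphB fmorph_div/= !ratr_nat rmorph1 ffunE/=.
    have -> : x 0 i - ((Num.truncn (M%:R * (x 0 i + 1)))%:R / M%:R - 1) =
        M%:R^-1 * (M%:R * (x 0 i + 1) - (Num.truncn (M%:R * (x 0 i + 1)))%:R).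
      by field; rewrite gt_eqF.
    rewrite normrM ger0_norm ?invr_ge0// ler_piMr ?invr_ge0//.
    have /andP[h1 h2] := truncn_itv (pos i).
    by rewrite ger0_norm ?subr_ge0//; move: h2; rewrite -natr1; lra.
  have close N : seminorm_on N -> (forall x, A x -> N x <= P x) ->
      N (h (x - map_mx ratr (qr k))) <= K / M%:R.
    move=> Ns NP; rewrite (le_trans (NP _ (Ah _)))//.
    rewrite (le_trans (seminorm_le_coords _ Ps))// /K mulr_suml.
    by apply: ler_sum => i _; rewrite mulrC ler_wpM2l// seminorm_ge0.
  have cS := close _ Ss SP; have cnu := close _ nus nuP.
  have := Ss.2 _ _ (Ah (x - map_mx ratr (qr k))) (Ah (map_mx ratr (qr k))).
  rewrite -linearD subrK => h1.
  have h2 : nu (w k) <= nu (h x) + K / M%:R.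
    have e1 : w k = h x + -1 *: h (x - map_mx ratr (qr k)).
      by rewrite linearB scaleN1r opprB addrCA subrr addr0.
    have := nus.2 (h x) (-1 *: h (x - map_mx ratr (qr k))) (Ah _).
    rewrite -e1 nus.1// normrN1 mul1r -linearZ => /(_ (Ah _)); lra.
  have /andP[_ h3] := rP k.
  have h4 : S (w k) <= ratr (r k).
    by apply: (SL (w k, r k)); apply/mapP; exists k => //; rewrite mem_enum.
  have : (2 * K + 1) / M%:R = K / M%:R + K / M%:R + M%:R^-1.
    by field; rewrite gt_eqF.
  move: h1 h4; rewrite /w; move: h2 h3; rewrite /w; lra.
move=> x; set s := \sum_i `|x 0 i|.
have s0 : 0 <= s by exact: sumr_ge0.
have [s00|sn0] := eqVneq s 0.
  rewrite s00 mulr0 addr0.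
  have -> : x = 0.
    apply/rowP => i; rewrite mxE; apply/eqP; rewrite -normr_le0.
    by rewrite -s00 /s (bigD1 i)//= lerDl sumr_ge0.
  by rewrite linear0 !seminorm0.
have sp : 0 < s by rewrite lt_neqAle eq_sym sn0.
have := ball (s^-1 *: x).
rewrite linearZ/= Ss.1// nus.1// ger0_norm ?invr_ge0//.
under eq_bigr do rewrite mxE normrM.
rewrite -mulr_sumr ger0_norm ?invr_ge0// mulVf// => /(_ (lexx _)).
rewrite ler_pdivrMl// mulrDr mulrA divff// mul1r.
by rewrite [s * _]mulrC.
Qed.

End Grid.

End PolyhedralNorms.

(** * Rational extensions of rational subspaces *)

Section Coordinates.
Variables (R : realType) (E : lmodType R) (b : nat -> E).

Definition coordinates (co : E -> nat -> R) : Prop :=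
  [/\ forall (s : R) x y k, co (s *: x + y) k = s * co x k + co y k,
      forall x, exists n, forall m, (n <= m)%N ->
        x = \sum_(i < m) co x i *: b i &
      forall i j, co (b i) j = (i == j)%:R].

Lemma coordinates_exist : vector_basis b -> exists co, coordinates co.
Proof.
move=> [free gen].
pose rep x f := exists n, (forall i, (n <= i)%N -> f i = 0 :> R) /\
  x = \sum_(i < n) f i *: b i.
have pad x f n m : (n <= m)%N -> (forall i, (n <= i)%N -> f i = 0 :> R) ->
    x = \sum_(i < n) f i *: b i -> x = \sum_(i < m) f i *: b i.
  move=> nm f0 ->; rewrite (big_ord_widen_cond m predT (fun i => f i *: b i))//=.
  rewrite big_mkcond/=; apply: eq_bigr => i _; case: ltnP => // ni.
  by rewrite f0// scale0r.
have uniq x f g : rep x f -> rep x g -> f = g.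
  move=> [n [f0 xf]] [m [g0 xg]]; apply/funext => i.
  pose k := maxn i.+1 (maxn n m).
  have ik : (i < k)%N by rewrite leq_max leqnn.
  have nk : (n <= k)%N by rewrite !leq_max leqnn orbT.
  have mk : (m <= k)%N by rewrite !leq_max leqnn !orbT.
  have := free k (fun i => f i - g i).
  under eq_bigr do rewrite scalerBl.
  rewrite sumrB -(pad _ _ _ _ nk f0 xf) -(pad _ _ _ _ mk g0 xg) subrr.
  by move=> /(_ erefl (Ordinal ik))/= /subr0_eq.
have ex x : exists f, rep x f.
  have [n [c ->]] := gen x.
  exists (fun i => if insub i is Some j then c j else 0), n; split.
    by move=> i ni; rewrite insubF// ltnNge ni.
  by apply: eq_bigr => i _; rewrite valK.
have [co coP] := choice ex.
exists co; split.
- move=> s x y k; have [n [x0 xE]] := coP x; have [m [y0 yE]] := coP y.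
  rewrite (@uniq (s *: x + y) (co (s *: x + y)) (fun k => s * co x k + co y k))//.
  exists (maxn n m); split.
    by move=> i; rewrite geq_max => /andP[ni mi]; rewrite x0// y0// mulr0 addr0.
  under eq_bigr do rewrite scalerDl -scalerA.
  rewrite big_split/= -scaler_sumr.
  by rewrite -(pad _ _ _ _ (leq_maxl n m) x0 xE) -(pad _ _ _ _ (leq_maxr n m) y0 yE).
- move=> x; have [n [x0 xE]] := coP x; exists n => m nm; exact: pad xE.
- move=> i j; rewrite (@uniq (b i) (co (b i)) (fun j => (i == j)%:R))//.
  exists i.+1; split; first by move=> k ik; rewrite ltn_eqF.
  rewrite big_ord_recr/= eqxx scale1r big1 ?add0r// => k _.
  by rewrite gtn_eqF ?scale0r.
Qed.

Variable co : E -> nat -> R.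
Hypothesis coP : coordinates co.

Lemma coord_lin s x y k : co (s *: x + y) k = s * co x k + co y k.
Proof. by case: coP. Qed.

Lemma coord0 k : co 0 k = 0.
Proof. by have := coord_lin (-1) 0 0 k; rewrite scaler0 addr0 mulN1r addNr. Qed.

Lemma coordD x y k : co (x + y) k = co x k + co y k.
Proof. by have := coord_lin 1 x y k; rewrite scale1r mul1r. Qed.

Lemma coordZ s x k : co (s *: x) k = s * co x k.
Proof. by have := coord_lin s x 0 k; rewrite !addr0 coord0 addr0. Qed.

Lemma coord_basis i j : co (b i) j = (i == j)%:R.
Proof. by case: coP. Qed.

Lemma coord_sum p (c : nat -> R) (x : nat -> E) k :
  co (\sum_(i < p) c i *: x i) k = \sum_(i < p) c i * co (x i) k.
Proof.
elim: p => [|p IH]; first by rewrite !big_ord0 coord0.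
by rewrite !big_ord_recr/= coordD IH coordZ.
Qed.

Lemma coord_finite x : exists n, forall i, (n <= i)%N -> co x i = 0.
Proof.
have [_ + _] := coP => /(_ x)[n xE]; exists n => i ni.
rewrite (xE n (leqnn n)) coord_sum big1// => j _.
by rewrite coord_basis ltn_eqF ?mulr0// (leq_trans (ltn_ord j)).
Qed.

Lemma rational_vectorP x :
  rational_vector b x <-> forall i, exists r : rat, co x i = ratr r.
Proof.
split=> [[n [q ->]] i|h].
  have -> : \sum_(i < n) ratr (q i) *: b i =
      \sum_(i < n) ratr (if insub (val i) is Some j then q j else 0) *: b i.
    by apply: eq_bigr => j _; rewrite valK.
  rewrite (coord_sum n (fun i => ratr (if insub i is Some j then q j else 0))).
  apply: (big_ind (fun s : R => exists r : rat, s = ratr r)).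
  - by exists 0; rewrite rmorph0.
  - by move=> _ _ [r ->] [s ->]; exists (r + s); rewrite rmorphD.
  - move=> j _; rewrite coord_basis;
    exists ((if insub (val j) is Some j then q j else 0) * (val j == i)%:R).
    by rewrite [in RHS]rmorphM/= rmorph_nat.
have [_ + _] := coP => /(_ x)[n xE].
have [q qE] := choice h.
exists n, q; rewrite {1}(xE n (leqnn n)); apply: eq_bigr => i _.
by rewrite qE.
Qed.

Lemma rational_vector_comb (s : rat) x y : rational_vector b x ->
  rational_vector b y -> rational_vector b (ratr s *: x + y).
Proof.
move=> /rational_vectorP hx /rational_vectorP hy; apply/rational_vectorP => i.
have [q xq] := hx i; have [r yr] := hy i.
by exists (s * q + r); rewrite coord_lin xq yr rmorphD rmorphM.
Qed.

Lemma rational_vector_basis i : rational_vector b (b i).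
Proof.
by apply/rational_vectorP => j; exists (i == j)%:R; rewrite coord_basis ratr_nat.
Qed.

Lemma rational_vector0 : rational_vector b 0.
Proof. by apply/rational_vectorP => j; exists 0; rewrite coord0 rmorph0. Qed.

Lemma rational_vector_sum p (c : nat -> rat) (x : nat -> E) :
  (forall i, (i < p)%N -> rational_vector b (x i)) ->
  rational_vector b (\sum_(i < p) ratr (c i) *: x i).
Proof.
elim: p => [|p IH] hx; first by rewrite big_ord0; exact: rational_vector0.
rewrite big_ord_recr/= addrC; apply: rational_vector_comb; first exact: hx.
by apply: IH => i ip; apply: hx; exact: ltnW.
Qed.

(** The coordinates of a rational Banach space are separated from its norm, because different norms
    are going to be put on one carrier. *)
Definition rational_frame (A : set E) n (h : {linear 'rV[R]_n -> E}) : Prop :=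
  [/\ injective h, range h = A &
      h @` @rational_row R n = A `&` rational_vector b].

Lemma frame_subspace A n (h : {linear 'rV[R]_n -> E}) :
  rational_frame A h -> Defs.subspace A.
Proof.
move=> [_ <- _]; split; first by exists 0 => //; rewrite linear0.
by move=> s _ _ [x _ <-] [y _ <-]; exists (s *: x + y) => //; rewrite linearP.
Qed.

Lemma polyhedral_eq (A Q : set E) (N N' : E -> R) :
  (forall x, A x -> N x = N' x) -> polyhedral A Q N -> polyhedral A Q N'.
Proof.
move=> NN' [I [i0 [f [fr fE]]]]; exists I, i0, f; split=> // x Ax.
by rewrite -NN'// fE.
Qed.

(** The basis vectors from [m] on are fresh for [X] and can be adjoined to it as new directions. *)
Lemma coord_bound X : rational_subspace b X ->
  exists m, forall x, carrier X x -> forall i, (m <= i)%N -> co x i = 0.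
Proof.
move=> [[n [v [_ ->]]] _ _].
have /choice[f fP] : forall k, exists m, forall i, (m <= i)%N -> co (v k) i = 0.
  by move=> k; exact: coord_finite.
exists (\max_(k < n) f k) => _ [c _ <-] i fi.
rewrite (big_morph (co^~ i) (fun x y => coordD x y i) (coord0 i)) big1// => k _.
by rewrite coordZ fP ?mulr0// (leq_trans (leq_bigmax k)).
Qed.

Lemma rational_subspace_frame X : rational_subspace b X ->
  exists n (h : {linear 'rV[R]_n -> E}), [/\ rational_frame (carrier X) h,
    polyhedral (carrier X) (rational_vector b) (nnorm X) &
    is_norm_on (carrier X) (nnorm X)].
Proof.
move=> [_ [n [h [[hinj hX normX [k [f [fl fr fE]]]] hQ]]] _].
exists n, h; split=> //.
(* The extra index carries the zero functional: it keeps the index type inhabited when [k] is 0 and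
   leaves the maximum unchanged. *)
exists (option 'I_k), None, (fun i => if i is Some j then f j else fun=> 0).
split=> [[i|]|x Xx].
- split=> [s x y Xx Xy|x Xx Qx]; first exact: fl.
  have : (h @` @rational_row R n) x by rewrite hQ.
  by move=> [q qr <-]; exact: fr.
- by split=> [s x y _ _|x _ _]; [rewrite mulr0 addr0|exists 0; rewrite rmorph0].
rewrite fE//; apply/eqP; rewrite eq_le; apply/andP; split.
  apply: bigmax_le => [|i _]; first exact: bigmax_ge_id.
  exact: (le_bigmax _ (fun o : option 'I_k =>
    `|(if o is Some j then f j else fun=> 0) x|) (Some i)).
apply: bigmax_le => [|[i|] _]; first exact: bigmax_ge_id.
  exact: (le_bigmax _ (fun j => `|f j x|)).
by rewrite normr0 bigmax_ge_id.
Qed.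

Definition patched (A : set E) (N : E -> R) (x : E) : R :=
  if x \in A then N x else 0.

Lemma patchedE A N x : A x -> patched A N x = N x.
Proof. by move=> Ax; rewrite /patched mem_set. Qed.

Lemma frame_rational_subspace A n (h : {linear 'rV[R]_n -> E}) N :
  rational_frame A h -> polyhedral A (rational_vector b) N -> is_norm_on A N ->
  rational_subspace b (NSpace A (patched A N)).
Proof.
move=> fr [I [i0 [f [frat fE]]]] [N0 NZ ND].
have [A0 Alin] := frame_subspace fr; have [hinj hA hQ] := fr.
have AZ s x : A x -> A (s *: x) by move=> Ax; rewrite -[_ *: _]addr0; exact: Alin.
have AD x y : A x -> A y -> A (x + y).
  by move=> Ax Ay; rewrite -[x]scale1r; exact: Alin.
split=> /=.
- exists n, (fun i => h (delta_mx 0 i)); split.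
    move=> i; have : (h @` @rational_row R n) (h (delta_mx 0 i)).
      exists (delta_mx 0 i) => //; exists (delta_mx 0 i) => //.
      by rewrite map_delta_mx.
    by rewrite hQ => -[].
  rewrite -hA; apply/seteqP; split=> [_ [x _ <-]|_ [c _ <-]].
    exists (fun i => x 0 i) => //.
    rewrite {2}[x]row_sum_delta linear_sum; apply: eq_bigr => i _.
    by rewrite linearZ.
  exists (\sum_i c i *: delta_mx 0 i) => //.
  by rewrite linear_sum; apply: eq_bigr => i _; rewrite linearZ.
- exists n, h; split=> //; split=> //=.
    split=> [x Ax|s x Ax|x y Ax Ay].
    + by rewrite patchedE//; exact: N0.
    + by rewrite !patchedE ?NZ//; exact: AZ.
    + by rewrite !patchedE ?ND//; exact: AD.
  exists #|I|, (fun i => f (enum_val i)); split.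
  + by move=> i s x y Ax Ay; apply: (frat _).1.
  + move=> i q qr; apply: (frat _).2; first by rewrite -hA; exists q.
    have : (h @` @rational_row R n) (h q) by exists q.
    by rewrite hQ => -[].
  + move=> x Ax; rewrite patchedE// fE//.
    exact: (reindex _ (onW_bij _ (@enum_val_bij I))).
- by move=> x Ax; rewrite /patched memNset.
Qed.

Lemma polyhedral_add_sum (A Q : set E) (N : E -> R) (phi : nat -> E -> R) K q :
  0 <= K -> polyhedral A Q N -> (forall i, rational_functional A Q (phi i)) ->
  polyhedral A Q (fun x => N x + ratr K * \sum_(i < q) `|phi i x|).
Proof.
move=> K0 polN hphi; elim: q => [|q IH].
  by apply: polyhedral_eq polN => x _; rewrite big_ord0 mulr0 addr0.
apply: polyhedral_eq (polyhedral_add_abs K0 IH (hphi q)) => x _.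
by rewrite big_ord_recr/= mulrDr addrA.
Qed.

(** * Adjoining fresh basis vectors to a rational subspace *)

Section Extension.
Variables (X0 : nspace E) (m p : nat).
Hypothesis ratX0 : rational_subspace b X0.
Hypothesis X0m : forall x, carrier X0 x -> forall i, (m <= i)%N -> co x i = 0.

Definition ext_tail (x : E) : E := \sum_(i < p) co x (m + i)%N *: b (m + i)%N.

Definition ext_head (x : E) : E := x - ext_tail x.

(** This is the sum of [X0] and the span of the [p] basis vectors from [m] on. As a preimage,
    membership is a statement about the head alone. *)
Definition ext_carrier : set E := ext_head @^-1` carrier X0.

Lemma ext_head_linear : linear ext_head.
Proof.
move=> s x y.
have tl : ext_tail (s *: x + y) = s *: ext_tail x + ext_tail y.
  rewrite /ext_tail scaler_sumr -big_split; apply: eq_bigr => i _.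
  by rewrite coord_lin scalerDl scalerA.
by rewrite /ext_head tl; linear_identity R.
Qed.

Lemma ext_head_old x : carrier X0 x -> ext_head x = x.
Proof.
move=> Xx; rewrite /ext_head /ext_tail big1 ?subr0// => i _.
by rewrite (X0m Xx) ?scale0r// leq_addr.
Qed.

Lemma ext_carrier_old x : carrier X0 x -> ext_carrier x.
Proof. by move=> Xx; rewrite /ext_carrier/= ext_head_old. Qed.

Lemma coord_old x i : carrier X0 x -> co x (m + i)%N = 0.
Proof. by move=> Xx; rewrite (X0m Xx)// leq_addr. Qed.

Lemma ext_decomp x : x = ext_head x + ext_tail x.
Proof. by rewrite subrK. Qed.

Lemma ext_tail_comb (c : nat -> R) :
  ext_tail (\sum_(i < p) c i *: b (m + i)%N) = \sum_(i < p) c i *: b (m + i)%N.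
Proof.
apply: eq_bigr => i _; congr (_ *: _).
rewrite (coord_sum p c (fun i => b (m + i)%N)) (bigD1 i)//= coord_basis eqxx mulr1.
rewrite big1 ?addr0// => j /negPf ji.
by rewrite coord_basis eqn_add2l val_eqE ji mulr0.
Qed.

Lemma ext_head_new i : (i < p)%N -> ext_head (b (m + i)%N) = 0.
Proof.
move=> ip; rewrite /ext_head.
have -> : b (m + i)%N = \sum_(j < p) (val j == i)%:R *: b (m + j)%N.
  rewrite (bigD1 (Ordinal ip))//= eqxx scale1r big1 ?addr0// => j.
  by rewrite -val_eqE/= => /negPf ->; rewrite scale0r.
by rewrite (ext_tail_comb (fun j : nat => (j == i)%:R)) subrr.
Qed.

Lemma ext_head_comb u (c : nat -> R) : carrier X0 u ->
  ext_head (u + \sum_(i < p) c i *: b (m + i)%N) = u.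
Proof.
move=> Xu; rewrite -{1}[u]scale1r ext_head_linear ext_head_old// scale1r.
by rewrite {1}/ext_head ext_tail_comb subrr addr0.
Qed.

Lemma coord_comb u (c : nat -> R) i : carrier X0 u -> (i < p)%N ->
  co (u + \sum_(i < p) c i *: b (m + i)%N) (m + i)%N = c i.
Proof.
move=> Xu ip; rewrite coordD coord_old// add0r.
rewrite (coord_sum p c (fun i => b (m + i)%N)) (bigD1 (Ordinal ip))//=.
rewrite coord_basis eqxx mulr1 big1 ?addr0// => j; rewrite -val_eqE/= => /negPf ji.
by rewrite coord_basis eqn_add2l ji mulr0.
Qed.

Lemma ext_carrier_new i : (i < p)%N -> ext_carrier (b (m + i)%N).
Proof.
move=> ip; rewrite /ext_carrier/= ext_head_new//.
have [n [h [fr _ _]]] := rational_subspace_frame ratX0.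
by case: (frame_subspace fr).
Qed.

Lemma subspace_old : Defs.subspace (carrier X0).
Proof.
by have [n [h [fr _ _]]] := rational_subspace_frame ratX0; exact: frame_subspace fr.
Qed.

Lemma ext_head_rational z : rational_vector b z -> rational_vector b (ext_head z).
Proof.
move=> Qz; have /rational_vectorP /choice[r rE] := Qz.
rewrite /ext_head addrC -scaleN1r -(rmorphN1 (@ratr R)).
apply: rational_vector_comb => //; rewrite /ext_tail.
under eq_bigr do rewrite rE.
apply: (@rational_vector_sum p (fun i => r (m + i)%N) (fun i => b (m + i)%N)) => i _.
exact: rational_vector_basis.
Qed.

Lemma ext_frame : exists n (h : {linear 'rV[R]_n -> E}), rational_frame ext_carrier h.
Proof.
have [n [h [[hinj hX hQ] _ _]]] := rational_subspace_frame ratX0.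
have hc y : carrier X0 (h y) by rewrite -hX; exists y.
pose g (x : 'rV[R]_(n + p)) : E :=
  h (lsubmx x) + \sum_(i < p) rsubmx x 0 i *: b (m + i)%N.
have lg : linear g.
  move=> s x y.
  have tl : \sum_(i < p) rsubmx (s *: x + y) 0 i *: b (m + i)%N =
      s *: (\sum_(i < p) rsubmx x 0 i *: b (m + i)%N) +
      \sum_(i < p) rsubmx y 0 i *: b (m + i)%N.
    rewrite scaler_sumr -big_split; apply: eq_bigr => i _.
    by rewrite !mxE scalerDl scalerA.
  have -> : g (s *: x + y) = s *: h (lsubmx x) + h (lsubmx y) +
      \sum_(i < p) rsubmx (s *: x + y) 0 i *: b (m + i)%N.
    by rewrite /g linearP linearP.
  by rewrite tl /g scalerDr addrACA.
pose lg' := GRing.isLinear.Build R _ _ *:%R g lg.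
pose g' : {linear 'rV[R]_(n + p) -> E} := HB.pack g lg'.
pose cx (x : 'rV[R]_(n + p)) i := if insub i is Some j then rsubmx x 0 j else 0.
have cxE x : \sum_(i < p) rsubmx x 0 i *: b (m + i)%N =
    \sum_(i < p) cx x i *: b (m + i)%N.
  by apply: eq_bigr => i _; rewrite /cx valK.
have headg x : ext_head (g x) = h (lsubmx x).
  rewrite /g cxE -[h _]scale1r ext_head_linear scale1r ext_head_old//.
  by rewrite /ext_head ext_tail_comb subrr addr0 scale1r.
have cog x (i : 'I_p) : co (g x) (m + i)%N = rsubmx x 0 i.
  rewrite /g coordD coord_old// add0r cxE (coord_sum p _ (fun i => b (m + i)%N)).
  rewrite (bigD1 i)//= coord_basis eqxx mulr1 big1 ?addr0 /cx ?valK// => j /negPf ji.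
  by rewrite coord_basis eqn_add2l val_eqE ji mulr0.
exists (n + p)%N, g'; split.
- move=> x y /= gxy.
  have e1 : lsubmx x = lsubmx y by apply: hinj; rewrite -!headg gxy.
  have e2 : rsubmx x = rsubmx y by apply/rowP => i; rewrite -!cog gxy.
  by rewrite -[x]hsubmxK -[y]hsubmxK e1 e2.
- apply/seteqP; split=> [_ [x _ <-]|z]; first by rewrite /ext_carrier/= headg.
  rewrite /ext_carrier/= -hX => -[y _ yE].
  exists (row_mx y (\row_(i < p) co z (m + i)%N)) => //=.
  rewrite /g row_mxKl row_mxKr yE [RHS]ext_decomp; congr (_ + _).
  by apply: eq_bigr => i _; rewrite mxE.
- apply/seteqP; split=> [_ [_ [q _ <-] <-]|z [Xz Qz]].
    split; first by rewrite /ext_carrier/= headg.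
    rewrite /= /g addrC.
    have -> : \sum_(i < p) rsubmx (map_mx ratr q) 0 i *: b (m + i)%N =
        \sum_(i < p) ratr (if insub (val i) is Some j then rsubmx q 0 j else 0) *: b (m + i)%N.
      by apply: eq_bigr => i _; rewrite valK !mxE.
    rewrite -[X in X + _]scale1r -(rmorph1 (@ratr R)); apply: rational_vector_comb.
      apply: (@rational_vector_sum p (fun i => if insub i is Some j then rsubmx q 0 j else 0)
        (fun i => b (m + i)%N)).
      by move=> i _; exact: rational_vector_basis.
    have : (h @` @rational_row R n) (h (lsubmx (map_mx ratr q))).
      by exists (lsubmx (map_mx ratr q)) => //; exists (lsubmx q) => //; rewrite map_lsubmx.
    by rewrite hQ => -[].
  have /rational_vectorP /choice[r rE] := Qz.
  have Qh := ext_head_rational Qz.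
  have : (h @` @rational_row R n) (ext_head z) by rewrite hQ.
  move=> [_ [q _ <-] qE].
  exists (map_mx ratr (row_mx q (\row_(i < p) r (m + i)%N))).
    by exists (row_mx q (\row_(i < p) r (m + i)%N)).
  rewrite map_row_mx /= /g row_mxKl row_mxKr qE [RHS]ext_decomp; congr (_ + _).
  by apply: eq_bigr => i _; rewrite !mxE rE.
Qed.

Lemma subspace_ext : Defs.subspace ext_carrier.
Proof. by have [n [h /frame_subspace]] := ext_frame. Qed.

(** An l^1-type sum. With [K] above the norms of the vectors represented by the new directions it
    dominates the amalgam seminorm. *)
Definition ext_norm (K : rat) (x : E) : R :=
  nnorm X0 (ext_head x) + ratr K * \sum_(i < p) `|co x (m + i)%N|.

Lemma ext_norm_polyhedral K : 0 < K ->
  polyhedral ext_carrier (rational_vector b) (ext_norm K).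
Proof.
move=> K0; apply: (polyhedral_add_sum (phi := fun i x => co x (m + i)%N)).
- exact: ltW.
- have [n [h [_ [I [i0 [f [fr fE]]]] _]]] := rational_subspace_frame ratX0.
  exists I, i0, (fun i x => f i (ext_head x)).
  split=> [i|x Ax]; last by rewrite fE.
  split=> [s x y Ax Ay|x Ax Qx]; first by rewrite ext_head_linear; apply: (fr i).1.
  by apply: (fr i).2 => //; exact: ext_head_rational.
- by move=> k; split=> [s x y _ _|x _ /rational_vectorP/(_ (m + k)%N)//]; exact: coord_lin.
Qed.

Lemma ext_norm_is_norm K : 0 < K -> is_norm_on ext_carrier (ext_norm K).
Proof.
move=> K0; have [NZ ND] := polyhedral_seminorm subspace_ext (ext_norm_polyhedral K0).
split=> // x Ax x0.
have K0' : 0 < ratr K :> R by rewrite ltr0q.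
have [n [h [_ polX0 [X00 _ _]]]] := rational_subspace_frame ratX0.
have s0 : 0 <= \sum_(i < p) `|co x (m + i)%N| by exact: sumr_ge0.
have h0 := polyhedral_ge0 polX0 Ax.
have s0' : 0 <= ratr K * \sum_(i < p) `|co x (m + i)%N| by rewrite mulr_ge0// ltW.
have /eqP : ratr K * \sum_(i < p) `|co x (m + i)%N| = 0.
  by move: x0; rewrite /ext_norm; lra.
rewrite mulf_eq0 gt_eqF//= psumr_eq0// => /allP c0.
have x00 : ext_head x = 0 by apply: X00 => //; move: x0; rewrite /ext_norm; lra.
rewrite [x]ext_decomp x00 add0r /ext_tail big1// => i _.
have := c0 i (mem_index_enum _); rewrite /= normr_eq0 => /eqP ->.
by rewrite scale0r.
Qed.

Lemma ext_norm_old K x : carrier X0 x -> ext_norm K x = nnorm X0 x.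
Proof.
move=> Xx; rewrite /ext_norm ext_head_old// big1 ?mulr0 ?addr0// => i _.
by rewrite coord_old// normr0.
Qed.

(** [nu] competes in the maximality of the new norm, which therefore lies between [nu] and
    [ext_norm]; these agree on [X0], so the inclusion is isometric. Maximality is recorded because
    it serves to bound operators defined on [X]. *)
Lemma rational_extension K (nu : E -> R) (L : seq (E * rat)) :
  0 < K -> seminorm_on ext_carrier nu ->
  (forall x, ext_carrier x -> nu x <= ext_norm K x) ->
  (forall x, carrier X0 x -> nu x = nnorm X0 x) ->
  (forall wr, wr \in L -> [/\ ext_carrier wr.1, rational_vector b wr.1,
     0 < wr.2 & nu wr.1 <= ratr wr.2]) ->
  exists X : nspace E,
    [/\ carrier X = ext_carrier, rational_subspace b X,
        rational_embedding b b X0 X (inclusion X0) &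
        seminorm_on ext_carrier (nnorm X)] /\
    [/\ forall x, ext_carrier x -> nu x <= nnorm X x,
        forall x, ext_carrier x -> nnorm X x <= ext_norm K x,
        forall wr, wr \in L -> nnorm X wr.1 <= ratr wr.2 &
        forall S, seminorm_on ext_carrier S ->
          (forall x, ext_carrier x -> S x <= ext_norm K x) ->
          (forall wr, wr \in L -> S wr.1 <= ratr wr.2) ->
          forall x, ext_carrier x -> S x <= nnorm X x].
Proof.
move=> K0 nus nuP nu0 hL.
have sub := subspace_ext.
have [|N [polN normN NP NL Nmax]] := rational_largest_norm sub
    (ext_norm_polyhedral K0) (ext_norm_is_norm K0) (L := L).
  by move=> wr /hL[].
have [n [h fr]] := ext_frame.
pose X := NSpace ext_carrier (patched ext_carrier N).
have nuN x : ext_carrier x -> nu x <= N x.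
  by apply: Nmax => // wr /hL[].
have NE x : ext_carrier x -> nnorm X x = N x by exact: patchedE.
have N_old x : carrier X0 x -> N x = nnorm X0 x.
  move=> Xx; have Ax := ext_carrier_old Xx; apply/eqP; rewrite eq_le.
  by rewrite -{2}nu0// nuN// andbT (le_trans (NP _ Ax))// ext_norm_old.
have ratX : rational_subspace b X by exact: frame_rational_subspace fr polN normN.
exists X; split; split=> //.
- have incl x : carrier X0 x -> inclusion X0 x = x.
    by move=> Xx; rewrite /inclusion mem_set.
  split; last by move=> x Xx; rewrite incl// NE ?N_old//; exact: ext_carrier_old.
  split.
  + move=> s x y Xx Xy; rewrite !incl//.
    by case: subspace_old => _; apply.
  + by move=> _ [x Xx <-]; rewrite incl//; exact: ext_carrier_old.
  + by move=> x Xx; rewrite incl// NE ?N_old//; exact: ext_carrier_old.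
  + by move=> x Xx Qx; rewrite incl.
  + by move=> x Xx; rewrite /inclusion memNset.
- have [NZ ND] := polyhedral_seminorm sub polN; have [A0 Alin] := sub.
  split=> [s x Ax|x y Ax Ay].
    have Asx : ext_carrier (s *: x) by rewrite -[_ *: _]addr0; exact: Alin.
    by rewrite !NE// NZ.
  have Axy : ext_carrier (x + y) by rewrite -[x]scale1r; exact: Alin.
  by rewrite !NE// ND.
- by move=> x Ax; rewrite NE// nuN.
- by move=> x Ax; rewrite NE// NP.
- by move=> wr wrL; have [Aw _ _ _] := hL _ wrL; rewrite NE// NL.
- by move=> S Ss SP SL x Ax; rewrite NE//; exact: Nmax.
Qed.

(** The error of the grid is measured in coordinates; dividing [delta] by a bound for the
    coordinates of the [t i] expresses it in the coefficients [c]. *)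
Lemma rational_family_grid K (nu : E -> R) q (t : nat -> E) (delta : R) :
  0 < K -> seminorm_on ext_carrier nu ->
  (forall x, ext_carrier x -> nu x <= ext_norm K x) ->
  (forall i, (i < q)%N -> ext_carrier (t i)) -> 0 < delta ->
  exists L : seq (E * rat),
    (forall wr, wr \in L -> [/\ ext_carrier wr.1, rational_vector b wr.1,
       0 < wr.2 & nu wr.1 <= ratr wr.2]) /\
    forall S, seminorm_on ext_carrier S ->
      (forall x, ext_carrier x -> S x <= ext_norm K x) ->
      (forall wr, wr \in L -> S wr.1 <= ratr wr.2) ->
      forall c : nat -> R, S (\sum_(i < q) c i *: t i) <=
        nu (\sum_(i < q) c i *: t i) + delta * \sum_(i < q) `|c i|.
Proof.
move=> K0 nus nuP tA delta0.
have [n [h [hinj hA hQ]]] := ext_frame.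
have /choice[g gE] : forall i, exists x, (i < q)%N -> h x = t i.
  move=> i; case: (ltnP i q) => [iq|_]; last by exists 0.
  by move: (tA i iq); rewrite -hA => -[x _ <-]; exists x.
pose M := 1 + \sum_(i < q) \sum_j `|g i 0 j|.
have M1 : 1 <= M by rewrite lerDl sumr_ge0// => i _; exact: sumr_ge0.
have M0 : 0 < M by lra.
have hQ' x : @rational_row R n x -> rational_vector b (h x).
  move=> Qx; have : (h @` @rational_row R n) (h x) by exists x.
  by rewrite hQ => -[].
have [L [hL hS]] := rational_grid subspace_ext hA hQ'
  (polyhedral_seminorm subspace_ext (ext_norm_polyhedral K0)) nus nuP
  (divr_gt0 delta0 M0).
exists L; split=> // S Ss SP SL c.
have -> : \sum_(i < q) c i *: t i = h (\sum_(i < q) c i *: g i).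
  by rewrite linear_sum; apply: eq_bigr => i _; rewrite linearZ/= gE.
apply: le_trans (hS S Ss SP SL _) _; rewrite lerD2l -mulrA; apply: ler_wpM2l; first exact: ltW.
rewrite ler_pdivrMl//.
have -> : \sum_j `|(\sum_(i < q) c i *: g i) 0 j| = \sum_j `|\sum_(i < q) c i * g i 0 j|.
  apply: eq_bigr => j _; congr `|_|; rewrite summxE; apply: eq_bigr => i _.
  by rewrite mxE.
apply: (@le_trans _ _ (\sum_j \sum_(i < q) `|c i| * `|g i 0 j|)).
  apply: ler_sum => j _; apply: le_trans (ler_norm_sum _ _ _) _.
  by apply: ler_sum => i _; rewrite normrM.
rewrite exchange_big mulr_sumr; apply: ler_sum => i _.
rewrite -mulr_sumr mulrC ler_wpM2r//.
apply: le_trans (_ : \sum_(i < q) \sum_j `|g i 0 j| <= M); last by rewrite lerDr.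
rewrite [leRHS](bigD1 i)//= lerDl; apply: sumr_ge0 => k _; exact: sumr_ge0.
Qed.

(** * Pulling an amalgam norm back to the extension *)

Section Glue.
Variables (G1 G2 : normedModType R) (NN : G1 * G2 -> R).
Hypotheses (normNN : is_norm_on [set: G1 * G2] NN)
  (NN1 : forall x, NN (x, 0) = `|x|) (NN2 : forall x, NN (0, x) = `|x|)
  (NN_le : forall z, NN z <= `|z.1| + `|z.2|).
Variables (g : nat -> G1) (iota : E -> G2).
Hypotheses (iota_lin : linear_on (carrier X0) iota)
  (iota_iso : forall x, carrier X0 x -> `|iota x| = nnorm X0 x).

(* The seminorm of NN pulled back along b (m + i) |-> g i and iota. *)
Definition glue (x : E) : R :=
  NN (\sum_(i < p) co x (m + i)%N *: g i, iota (ext_head x)).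

Lemma iota0 : iota 0 = 0.
Proof.
have [A0 _] := subspace_old.
by have := iota_lin (-1) A0 A0; rewrite scaler0 addr0 scaleN1r addNr.
Qed.

Lemma iotaN x : carrier X0 x -> iota (- x) = - iota x.
Proof.
move=> Xx; have [A0 _] := subspace_old.
by have := iota_lin (-1) Xx A0; rewrite iota0 !addr0 !scaleN1r.
Qed.

Lemma glue_comb u (c : nat -> R) : carrier X0 u ->
  glue (u + \sum_(i < p) c i *: b (m + i)%N) = NN (\sum_(i < p) c i *: g i, iota u).
Proof.
move=> Xu; rewrite /glue ext_head_comb//; congr (NN (_, _)).
by apply: eq_bigr => i _; rewrite coord_comb.
Qed.

Lemma glue_old u : carrier X0 u -> glue u = nnorm X0 u.
Proof.
move=> Xu; rewrite /glue ext_head_old// big1 ?NN2 ?iota_iso// => i _.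
by rewrite coord_old// scale0r.
Qed.

Lemma glue_seminorm : seminorm_on ext_carrier glue.
Proof.
have [_ NZ ND] := normNN.
have lin s x y : ext_carrier x -> ext_carrier y ->
    (\sum_(i < p) co (s *: x + y) (m + i)%N *: g i, iota (ext_head (s *: x + y))) =
    s *: (\sum_(i < p) co x (m + i)%N *: g i, iota (ext_head x)) +
    (\sum_(i < p) co y (m + i)%N *: g i, iota (ext_head y)).
  move=> Ax Ay; rewrite ext_head_linear (iota_lin s Ax Ay); congr (_, _) => /=.
  rewrite scaler_sumr -big_split; apply: eq_bigr => i _.
  by rewrite coord_lin scalerDl scalerA.
have [A0 _] := subspace_ext.
split=> [s x Ax|x y Ax Ay].
  rewrite /glue -[s *: x]addr0 lin//.
  have -> : (\sum_(i < p) co 0 (m + i)%N *: g i, iota (ext_head 0)) = 0.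
    congr (_, _); first by rewrite big1// => i _; rewrite coord0 scale0r.
    by rewrite ext_head_old ?iota0//; case: subspace_old.
  by rewrite addr0 NZ.
by rewrite /glue -{1 2}[x]scale1r lin// scale1r ND.
Qed.

Lemma glue_le (K : rat) x : 0 < K -> (forall i, (i < p)%N -> `|g i| <= ratr K) ->
  ext_carrier x -> glue x <= ext_norm K x.
Proof.
move=> K0 gK Ax; apply: le_trans (NN_le _) _ => /=.
rewrite iota_iso// addrC lerD2l (le_trans (ler_norm_sum _ _ _))// mulr_sumr.
by apply: ler_sum => i _; rewrite normrZ mulrC ler_wpM2r// gK.
Qed.

(** Two grids are joined: one for combinations of the fresh vectors, where [glue <= S] supplies the
    other half of a two-sided estimate, and one for the differences [b (m + i) - z i], where an
    upper bound suffices. *)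
Lemma glue_grid (K : rat) q (z : nat -> E) (delta : R) :
  0 < K -> (forall i, (i < p)%N -> `|g i| <= ratr K) -> (q <= p)%N ->
  (forall i, (i < q)%N -> carrier X0 (z i)) -> 0 < delta ->
  exists L : seq (E * rat),
    (forall wr, wr \in L -> [/\ ext_carrier wr.1, rational_vector b wr.1,
       0 < wr.2 & glue wr.1 <= ratr wr.2]) /\
    forall S, seminorm_on ext_carrier S ->
      (forall x, ext_carrier x -> glue x <= S x) ->
      (forall x, ext_carrier x -> S x <= ext_norm K x) ->
      (forall wr, wr \in L -> S wr.1 <= ratr wr.2) ->
      (forall c : nat -> R,
         `| `|\sum_(i < p) c i *: g i| - S (\sum_(i < p) c i *: b (m + i)%N)|
           <= delta * \sum_(i < p) `|c i|) /\
      (forall i, (i < q)%N ->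
         S (b (m + i)%N - z i) <= NN (g i, - iota (z i)) + delta).
Proof.
move=> K0 gK qp zX delta0.
have one (G : lmodType R) (x : nat -> G) n i : (i < n)%N ->
    \sum_(j < n) (val j == i)%:R *: x j = x i.
  move=> ni; rewrite (bigD1 (Ordinal ni))//= eqxx scale1r big1 ?addr0// => j.
  by rewrite -val_eqE/= => /negPf ->; rewrite scale0r.
have [A0 Alin] := subspace_ext; have [X00 X0lin] := subspace_old.
have zN i : (i < q)%N -> carrier X0 (- z i).
  by move=> iq; rewrite -[- _]addr0 -scaleN1r; apply: X0lin => //; exact: zX.
have tA i : (i < q)%N -> ext_carrier (b (m + i)%N - z i).
  move=> iq; rewrite -[b _]scale1r; apply: Alin.
    by apply: ext_carrier_new; exact: leq_trans iq qp.
  by apply: ext_carrier_old; exact: zN.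
have gle x : ext_carrier x -> glue x <= ext_norm K x by exact: glue_le.
have [L1 [hL1 L1S]] := @rational_family_grid K glue p (fun i => b (m + i)%N) delta
  K0 glue_seminorm gle ext_carrier_new delta0.
have [L2 [hL2 L2S]] := @rational_family_grid K glue q (fun i => b (m + i)%N - z i) delta
  K0 glue_seminorm gle tA delta0.
exists (L1 ++ L2); split=> [wr|S Ss gS SP SL].
  by rewrite mem_cat => /orP[]; [exact: hL1|exact: hL2].
split=> [c|i iq].
  have gc : glue (\sum_(i < p) c i *: b (m + i)%N) = `|\sum_(i < p) c i *: g i|.
    by rewrite -[X in glue X]add0r glue_comb// iota0 NN1.
  have := L1S S Ss SP _ c; rewrite gc => h1.
  have := gS (\sum_(i < p) c i *: b (m + i)%N); rewrite gc => h2.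
  rewrite distrC ger0_norm; last first.
    rewrite subr_ge0 h2//; apply: (big_ind ext_carrier) => //.
      by move=> x y Ax Ay; rewrite -[x]scale1r; exact: Alin.
    move=> i _; rewrite -[_ *: _]addr0; apply: Alin => //.
    exact: ext_carrier_new.
  by rewrite lerBlDl h1// => wr wrL; apply: SL; rewrite mem_cat wrL.
have := L2S S Ss SP _ (fun j => (j == i)%:R).
rewrite (one _ (fun i => b (m + i)%N - z i) q i iq).
have -> : \sum_(j < q) `|(val j == i)%:R : R| = 1.
  have := one R^o (fun=> 1) q i iq; under eq_bigr do rewrite [_ *: _]mulr1.
  by move=> s1; rewrite -[RHS]s1; apply: eq_bigr => j _; rewrite ger0_norm.
rewrite mulr1 => h.
have -> : NN (g i, - iota (z i)) = glue (b (m + i)%N - z i).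
  rewrite addrC -(one _ (fun i => b (m + i)%N) p i (leq_trans iq qp)).
  rewrite (glue_comb (fun j => (j == i)%:R)); last exact: zN.
  by rewrite one ?iotaN//; [exact: zX|exact: leq_trans qp].
by apply: h => wr wrL; apply: SL; rewrite mem_cat wrL orbT.
Qed.

End Glue.

End Extension.

End Coordinates.

Section RationalAmalgam.
Variables (R : realType) (UU VV : lmodType R) (bU : nat -> UU) (bV : nat -> VV).
Variables (coU : UU -> nat -> R) (coV : VV -> nat -> R).
Hypotheses (coUP : coordinates bU coU) (coVP : coordinates bV coV).
Variables (X0 : nspace UU) (Y0 : nspace VV) (F0 : UU -> VV).
Hypotheses (ratX0 : rational_subspace bU X0) (ratY0 : rational_subspace bV Y0)
  (ratF0 : rational_operator bU bV X0 Y0 F0).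
Variables (Ui Vi : normedModType R) (W : {linear Ui -> Vi}).
Variables (iU : UU -> Ui) (iV : VV -> Vi).
Hypotheses (nW : forall x, `|W x| <= `|x|)
  (iU_lin : linear_on (carrier X0) iU) (iV_lin : linear_on (carrier Y0) iV)
  (iU_iso : forall x, carrier X0 x -> `|iU x| = nnorm X0 x)
  (iV_iso : forall y, carrier Y0 y -> `|iV y| = nnorm Y0 y)
  (WF0 : forall x, carrier X0 x -> W (iU x) = iV (F0 x)).
Variables (U V : normedModType R) (Om : {linear U -> V}).
Hypothesis nOm : forall x, `|Om x| <= `|x|.
Variables (p : nat) (eps delta : R) (a : nat -> U) (b : nat -> V).
Variables (z : nat -> UU) (w : nat -> VV) (x : nat -> U) (y : nat -> V).
Hypotheses (eps0 : 0 < eps) (delta0 : 0 < delta)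
  (st : stage Om W p eps a (iU \o z) b (iV \o w))
  (zX0 : forall i, (i < p)%N -> carrier X0 (z i))
  (wY0 : forall j, (j < p.*2)%N -> carrier Y0 (w j))
  (yx : forall i, y i.*2 = Om (x i)).

(* The extension X of X0 is spanned by X0 and copies of the x i, normed up to
   delta as in the amalgam of U and Ui; similarly for Y. *)
Lemma rational_amalgam :
  exists (X : nspace UU) (Y : nspace VV) (T : UU -> VV) (e : nat -> UU) (f : nat -> VV),
    [/\ rational_subspace bU X, rational_subspace bV Y,
        rational_operator bU bV X Y T,
        rational_embedding bU bU X0 X (inclusion X0) &
        rational_embedding bV bV Y0 Y (inclusion Y0)] /\
    [/\ forall u, carrier X0 u -> T u = F0 u,
        forall i, (i < p.+1)%N -> carrier X (e i),
        forall j, (j < p.+1.*2)%N -> carrier Y (f j) &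
        forall i, (i < p.+1)%N -> T (e i) = f i.*2] /\
    [/\ forall c : nat -> R,
         `| `|\sum_(i < p.+1) c i *: x i| - nnorm X (\sum_(i < p.+1) c i *: e i)|
           <= delta * \sum_(i < p.+1) `|c i|,
        forall c : nat -> R,
         `| `|\sum_(j < p.+1.*2) c j *: y j| - nnorm Y (\sum_(j < p.+1.*2) c j *: f j)|
           <= delta * \sum_(j < p.+1.*2) `|c j|,
        forall i, (i < p)%N -> nnorm X (e i - z i) <=
          amalgam p (3 * eps) a (iU \o z) (x i, - iU (z i)) + delta &
        forall j, (j < p.*2)%N -> nnorm Y (f j - w j) <=
          amalgam p.*2 eps b (iV \o w) (y j, - iV (w j)) + delta].
Proof.
have [mU hmU] := coord_bound coUP ratX0.
have [mV hmV] := coord_bound coVP ratY0.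
have [isoa isob _ _] := st.
have eps30 : 0 < 3 * eps by rewrite mulr_gt0.
have {}isoa : almost_isometric p (3 * eps) a (iU \o z).
  by apply: almost_isometric_le isoa; rewrite ler_peMl ?ler1n// ltW.
(* A common [K] for both sides makes [T0] nonexpansive already for the simple norms. *)
have [K K0 [Kx Ky]] : exists2 K : rat, 0 < K &
    (forall i, (i < p.+1)%N -> `|x i| <= ratr K) /\
    (forall j, (j < p.+1.*2)%N -> `|y j| <= ratr K).
  pose M := \sum_(i < p.+1) `|x i| + \sum_(j < p.+1.*2) `|y j|.
  have Sx : 0 <= \sum_(i < p.+1) `|x i| by exact: sumr_ge0.
  have Sy : 0 <= \sum_(j < p.+1.*2) `|y j| by exact: sumr_ge0.
  have : M < M + 1 by rewrite ltrDl.
  move=> /rat_in_itvoo[K]; rewrite in_itv/= => /andP[MK _]; exists K.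
    by rewrite -(ltr0q R) (le_lt_trans _ MK)// addr_ge0.
  split=> i ip; apply: le_trans (ltW MK).
    by rewrite (le_trans (norm_le_sum x ip))// lerDl.
  by rewrite (le_trans (norm_le_sum y ip))// lerDr.
pose NA := amalgam p (3 * eps) a (iU \o z).
pose NB := amalgam p.*2 eps b (iV \o w).
pose AX := ext_carrier bU coU X0 mU p.+1.
pose AY := ext_carrier bV coV Y0 mV p.+1.*2.
pose nuX := glue bU coU mU p.+1 NA x iU.
pose nuY := glue bV coV mV p.+1.*2 NB y iV.
have nNA := amalgam_norm p a (iU \o z) eps30.
have nNB := amalgam_norm p.*2 b (iV \o w) eps0.
have NA1 u : NA (u, 0) = `|u| by exact: amalgam_left.
have NA2 u : NA (0, u) = `|u| by exact: amalgam_right.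
have NB1 u : NB (u, 0) = `|u| by exact: amalgam_left.
have NB2 u : NB (0, u) = `|u| by exact: amalgam_right.
have NAle := amalgam_le_l1 p a (iU \o z) eps30.
have NBle := amalgam_le_l1 p.*2 b (iV \o w) eps0.
have p2 : (p.*2 <= p.+1.*2)%N by rewrite leq_double.
have [LX [hLX LXS]] := glue_grid coUP ratX0 hmU nNA NA1 NAle iU_lin iU_iso
  K0 Kx (leqnSn p) zX0 delta0.
have [LY [hLY LYS]] := glue_grid coVP ratY0 hmV nNB NB1 NBle iV_lin iV_iso
  K0 Ky p2 wY0 delta0.
have [F0lin F0Y F0n F0Q F0out] := ratF0.
have F0c u : carrier X0 u -> carrier Y0 (F0 u) by move=> Xu; apply: F0Y; exists u.
(* Fresh vector [i] goes to fresh vector [i.*2], mirroring [y i.*2 = Om (x i)]. *)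
pose T0 u := F0 (ext_head bU coU mU p.+1 u) +
  \sum_(i < p.+1) coU u (mU + i)%N *: bV (mV + i.*2)%N.
pose d u j := if odd j then 0 else coU u (mU + j./2)%N.
have T0E u : T0 u = F0 (ext_head bU coU mU p.+1 u) +
    \sum_(j < p.+1.*2) d u j *: bV (mV + j)%N.
  rewrite (@sum_even _ (fun j => d u j *: bV (mV + j)%N)).
    congr (_ + _); apply: eq_bigr => i _.
    by rewrite /d odd_double doubleK.
  by move=> j oj; rewrite /d oj scale0r.
have subX := subspace_ext coUP p.+1 ratX0 hmU.
have subY := subspace_ext coVP p.+1.*2 ratY0 hmV.
have [AX0 AXlin] := subX; have [AY0 AYlin] := subY.
have [X00 X0lin] := subspace_old ratX0.
have headT u : AX u -> ext_head bV coV mV p.+1.*2 (T0 u) = F0 (ext_head bU coU mU p.+1 u).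
  by move=> Au; rewrite T0E (ext_head_comb coVP p.+1.*2 hmV)//; exact: F0c.
have T0A u : AX u -> AY (T0 u).
  by move=> Au; rewrite /AY /ext_carrier/= headT//; exact: F0c.
have coT u j : AX u -> (j < p.+1.*2)%N -> coV (T0 u) (mV + j)%N = d u j.
  by move=> Au jp; rewrite T0E (coord_comb coVP hmV)//; exact: F0c.
have T0lin s u v : AX u -> AX v -> T0 (s *: u + v) = s *: T0 u + T0 v.
  move=> Au Av; rewrite /T0 (ext_head_linear coUP mU p.+1) F0lin//.
  have -> : \sum_(i < p.+1) coU (s *: u + v) (mU + i)%N *: bV (mV + i.*2)%N =
     s *: (\sum_(i < p.+1) coU u (mU + i)%N *: bV (mV + i.*2)%N) +
     \sum_(i < p.+1) coU v (mU + i)%N *: bV (mV + i.*2)%N.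
    rewrite scaler_sumr -big_split; apply: eq_bigr => i _.
    by rewrite (coord_lin coUP) scalerDl scalerA.
  by rewrite scalerDr addrACA.
have T00 : T0 0 = 0.
  by have := T0lin (-1) 0 0 AX0 AX0; rewrite scaler0 addr0 scaleN1r addNr.
have T0P u : AX u -> ext_norm bV coV Y0 mV p.+1.*2 K (T0 u) <=
    ext_norm bU coU X0 mU p.+1 K u.
  move=> Au; rewrite /ext_norm headT// lerD ?F0n// ler_wpM2l ?ler0q ?(ltW K0)//.
  rewrite (eq_bigr (fun j : 'I_p.+1.*2 => `|d u j|)); last by move=> j _; rewrite coT.
  rewrite (@sum_even _ (fun j => `|d u j|)); last by move=> j oj; rewrite /d oj normr0.
  by apply: ler_sum => i _; rewrite /d odd_double doubleK.
(* This makes the bounds sent along from [LX] compatible with [nuY]. *)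
have T0nu u : AX u -> nuY (T0 u) <= nuX u.
  move=> Au; rewrite /nuY /nuX /glue headT// -WF0//.
  rewrite (eq_bigr (fun j : 'I_p.+1.*2 => d u j *: y j)); last first.
    by move=> j _; rewrite coT.
  rewrite (@sum_even _ (fun j => d u j *: y j)); last first.
    by move=> j oj; rewrite /d oj scale0r.
  have -> : \sum_(i < p.+1) d u i.*2 *: y i.*2 =
      Om (\sum_(i < p.+1) coU u (mU + i)%N *: x i).
    rewrite linear_sum; apply: eq_bigr => i _.
    by rewrite linearZ /d odd_double doubleK yx.
  exact: (amalgam_operator (_, _) eps0 nOm nW st).
have T0Q u : AX u -> rational_vector bU u -> rational_vector bV (T0 u).
  move=> Au Qu; rewrite /T0 addrC.
  have /(rational_vectorP coUP)/choice[r rE] := Qu.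
  have -> : \sum_(i < p.+1) coU u (mU + i)%N *: bV (mV + i.*2)%N =
      ratr 1 *: \sum_(i < p.+1) ratr (r (mU + i)%N) *: bV (mV + i.*2)%N.
    by rewrite rmorph1 scale1r; apply: eq_bigr => i _; rewrite rE.
  apply: (rational_vector_comb coVP).
    apply: (@rational_vector_sum _ _ _ _ coVP _ (fun i => r (mU + i)%N)
      (fun i => bV (mV + i.*2)%N)) => i _.
    exact: rational_vector_basis coVP _.
  by apply: F0Q => //; exact: (ext_head_rational coUP).
have [X [[cX rX eX nX] [nuXX XP XL Xmax]]] :=
  rational_extension coUP ratX0 hmU K0
    (glue_seminorm coUP p.+1 ratX0 hmU nNA x iU_lin)
    (fun u => @glue_le _ _ _ _ _ _ _ _ _ _ NAle _ _ iU_iso K u K0 Kx)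
    (glue_old bU p.+1 hmU NA2 x iU_iso) hLX.
pose LYT := LY ++ [seq (T0 wr.1, wr.2) | wr <- LX].
have hLYT wr : wr \in LYT -> [/\ AY wr.1, rational_vector bV wr.1,
    0 < wr.2 & nuY wr.1 <= ratr wr.2].
  rewrite mem_cat => /orP[|/mapP[v vL ->] /=]; first exact: hLY.
  have [Av Qv r0 vn] := hLX _ vL; split=> //; [exact: T0A|exact: T0Q|].
  exact: le_trans (T0nu _ Av) vn.
have [Y [[cY rY eY nY] [nuYY YP YL Ymax]]] :=
  rational_extension coVP ratY0 hmV K0
    (glue_seminorm coVP p.+1.*2 ratY0 hmV nNB y iV_lin)
    (fun u => @glue_le _ _ _ _ _ _ _ _ _ _ NBle _ _ iV_iso K u K0 Ky)
    (glue_old bV p.+1.*2 hmV NB2 y iV_iso) hLYT.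
(* The norm of [Y] pulled back along [T0] lies below the simple norm on the extension of [X0] and
   obeys every bound of [LX], thanks to the copies of these bounds in [LYT]; maximality of the norm
   of [X] does the rest. *)
have T0n u : AX u -> nnorm Y (T0 u) <= nnorm X u.
  apply: (Xmax (nnorm Y \o T0)).
  - have [NZ ND] := nY; split=> [s v Av|v v' Av Av'] /=.
      by rewrite -[s *: v]addr0 T0lin// T00 addr0 NZ//; exact: T0A.
    by rewrite -{1}[v]scale1r T0lin// scale1r ND//; exact: T0A.
  - by move=> v Av /=; rewrite (le_trans (YP _ (T0A _ Av)))// T0P.
  - move=> wr wrL /=; apply: (YL (T0 wr.1, wr.2)).
    by rewrite mem_cat (map_f (fun wr => (T0 wr.1, wr.2)))// orbT.
pose T u := if u \in AX then T0 u else 0.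
have TE u : AX u -> T u = T0 u by move=> Au; rewrite /T mem_set.
have YLY wr : wr \in LY -> nnorm Y wr.1 <= ratr wr.2.
  by move=> wrL; apply: YL; rewrite mem_cat wrL.
have [EX1 EX2] := LXS _ nX nuXX XP XL.
have [EY1 EY2] := LYS _ nY nuYY YP YLY.
exists X, Y, T, (fun i => bU (mU + i)%N), (fun j => bV (mV + j)%N).
split; [split=> //|split].
- split; rewrite ?cX ?cY.
  + by move=> s u v Au Av; rewrite !TE ?T0lin//; exact: AXlin.
  + by move=> _ [u Au <-]; rewrite TE//; exact: T0A.
  + by move=> u Au; rewrite TE//; exact: T0n.
  + by move=> u Au Qu; rewrite TE//; exact: T0Q.
  + by move=> u Au; rewrite /T memNset.
- have head0 i : (i < p.+1)%N -> ext_head bU coU mU p.+1 (bU (mU + i)%N) = 0.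
    by move=> ip; exact: ext_head_new.
  have F00 : F0 0 = 0.
    by have := F0lin (-1) 0 0 X00 X00; rewrite scaler0 addr0 scaleN1r addNr.
  split; rewrite ?cX ?cY.
  + move=> u Xu; rewrite TE; last exact: ext_carrier_old.
    rewrite /T0 (ext_head_old bU p.+1 hmU)// big1 ?addr0// => i _.
    by rewrite (coord_old hmU)// scale0r.
  + by move=> i ip; exact: (ext_carrier_new coUP mU ratX0).
  + by move=> j jp; exact: (ext_carrier_new coVP mV ratY0).
  + move=> i ip; rewrite TE; last exact: (ext_carrier_new coUP mU ratX0).
    rewrite /T0 head0// F00 add0r (bigD1 (Ordinal ip))//=.
    rewrite (coord_basis coUP) eqxx scale1r big1 ?addr0// => j.
    rewrite -val_eqE/= => /negPf ji.
    by rewrite (coord_basis coUP) eqn_add2l eq_sym ji scale0r.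
- by split.
Qed.

End RationalAmalgam.

(** * The constructed operator *)

Lemma linear_on_comb (R : realType) (E F : lmodType R) (A : set E) (f : E -> F)
    (I : finType) (c : I -> R) (x : I -> E) :
  Defs.subspace A -> linear_on A f -> (forall i, A (x i)) ->
  A (\sum_i c i *: x i) /\ f (\sum_i c i *: x i) = \sum_i c i *: f (x i).
Proof.
move=> [A0 Alin] flin Ax.
have f0 : f 0 = 0.
  by have := flin (-1) 0 0 A0 A0; rewrite scaler0 addr0 scaleN1r addNr.
apply: (big_ind2 (fun u w => A u /\ f u = w)) => //.
  move=> u1 w1 u2 w2 [Au1 <-] [Au2 <-]; rewrite -{1 2}[u1]scale1r.
  by split; [exact: Alin|rewrite flin// scale1r].
move=> i _; rewrite -{1 2}[c i *: _]addr0.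
by split; [exact: Alin|rewrite flin// f0 addr0].
Qed.

Lemma opnorm_on_span_le (R : realType) (E F : normedModType R) n (v : 'I_n -> E)
    (f : E -> F) (M r eps : R) :
  linear_on (Defs.span v) f -> Defs.subspace (Defs.span v) ->
  (forall k, Defs.span v (v k)) ->
  (forall x, Defs.span v x -> exists2 c : 'I_n -> R, x = \sum_i c i *: v i &
     \sum_i `|c i| <= M * `|x|) ->
  0 <= M -> 0 <= r -> (forall k, `|f (v k)| <= r) -> r * M <= eps ->
  (opnorm_on (Defs.span v) f <= eps%:E)%E.
Proof.
move=> flin sub vk hM M0 r0 fr rM; apply: opnorm_on_le => x /hM[c xE cM] x1.
have [_ fE] := linear_on_comb c sub flin vk.
rewrite {1}xE fE (le_trans (ler_norm_sum _ _ _))//; apply: le_trans rM.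
apply: (@le_trans _ _ (\sum_i r * `|c i|)).
  by apply: ler_sum => k _; rewrite normrZ mulrC ler_wpM2r.
rewrite -mulr_sumr ler_wpM2l// (le_trans cM)// -[leRHS]mulr1.
by rewrite ler_wpM2l.
Qed.

Section Construction.
Variables (R : realType) (UU VV : lmodType R) (bU : nat -> UU) (bV : nat -> VV).
Variables (e : nat -> triple UU VV).
Variables (U : nat -> nspace UU) (V : nat -> nspace VV) (F : nat -> UU -> VV).
Hypotheses (hbU : vector_basis bU) (hbV : vector_basis bV)
  (he : enumerates_infinitely_often bU bV e) (hC : construction bU bV e U V F).
Variables (Ui Vi : completeNormedModType R) (W : {linear Ui -> Vi}).
Variables (iU : UU -> Ui) (iV : VV -> Vi).
Hypotheses (hiU : is_completion U iU) (hiV : is_completion V iV)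
  (cW : continuous W)
  (WF : forall n x, carrier (U n) x -> W (iU x) = iV (F n x)).

Definition extends (G : lmodType R) (S T : nspace G) : Prop :=
  forall x, carrier S x -> carrier T x /\ nnorm T x = nnorm S x.

Lemma extends_embedding (G : lmodType R) (b : nat -> G) (S T : nspace G) :
  rational_embedding b b S T (inclusion S) -> extends S T.
Proof.
move=> [[_ im _ _ _] iso] x Sx.
have incl : inclusion S x = x by rewrite /inclusion mem_set.
by split; [rewrite -incl; apply: im; exists x|have := iso x Sx; rewrite incl].
Qed.

Lemma chain_step n : [/\ extends (U n) (U n.+1), extends (V n) (V n.+1) &
  forall x, carrier (U n) x -> F n.+1 x = F n x].
Proof.
have [_ [_ [nstar star_]]] := hC.
have [/star_|/nstar[-> -> ->]] := pselect (star e U V F n.+1); last by split.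
move=> [i' [j' [[hU _ _ _] [[hV _ _ _] [hF _]]]]].
split; [exact: extends_embedding hU|exact: extends_embedding hV|exact: hF].
Qed.

Lemma chain_le n m : (n <= m)%N -> [/\ extends (U n) (U m), extends (V n) (V m) &
  forall x, carrier (U n) x -> F m x = F n x].
Proof.
move=> /subnK <-; elim: (m - n)%N => [|k [h1 h2 h3]] //.
have [h1' h2' h3'] := chain_step (k + n)%N; rewrite addSn; split.
- by move=> x /h1[/h1'[? ->] ->].
- by move=> x /h2[/h2'[? ->] ->].
- by move=> x Ux; rewrite h3' ?h3//; have [] := h1 x Ux.
Qed.

Lemma completion_linear (G : lmodType R) (S : nat -> nspace G)
    (H : completeNormedModType R) (iota : G -> H) n :
  is_completion S iota -> linear_on (carrier (S n)) iota.
Proof. by move=> [lin _ _] s x y Sx Sy; apply: lin; exists n. Qed.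

Lemma completion_dense (G : lmodType R) (S : nat -> nspace G)
    (H : completeNormedModType R) (iota : G -> H) y (eta : R) :
  is_completion S iota -> 0 < eta ->
  exists n x, carrier (S n) x /\ `|y - iota x| < eta.
Proof.
move=> [_ _ dns] eta0.
have [||z [yz [x [n _ Sx] xz]]] := dns (ball y eta).
  by exists y; exact: ballxx.
  exact: ball_open.
by exists n, x; split=> //; move: yz; rewrite -xz -ball_normE.
Qed.

(** The chain increases, so the approximants found in various stages lie in all late ones. Freedom
    in [m] lets domain and codomain share a stage. *)
Lemma completion_approx (G : lmodType R) (S : nat -> nspace G)
    (H : completeNormedModType R) (iota : G -> H) p (y : nat -> H) (eta : R) :
  is_completion S iota -> (forall n m, (n <= m)%N -> extends (S n) (S m)) ->
  0 < eta ->
  exists n (x : nat -> G), forall m, (n <= m)%N -> forall i, (i < p)%N ->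
    carrier (S m) (x i) /\ `|y i - iota (x i)| <= eta.
Proof.
move=> hS mono eta0.
have /choice[nx nxP] : forall i, exists nx : nat * G,
    carrier (S nx.1) nx.2 /\ `|y i - iota nx.2| < eta.
  by move=> i; have [n [x ?]] := completion_dense (y i) hS eta0; exists (n, x).
exists (\max_(i < p) (nx i).1), (fun i => (nx i).2) => m hm i ip.
have [Sx /ltW yx] := nxP i; split=> //.
have im : ((nx i).1 <= m)%N.
  by apply: leq_trans hm; exact: (leq_bigmax (Ordinal ip)).
by have [] := mono _ _ im _ Sx.
Qed.

Lemma construction_nonexpansive x : `|W x| <= `|x|.
Proof.
apply/ler_addgt0Pr => eta eta0.
have eta20 : 0 < eta / 2 by rewrite divr_gt0.
have /cvgrPdist_lt /(_ _ eta20) /nbhs_ballP[r /= r0 hr] := @cW x.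
have m0 : 0 < Num.min r (eta / 2) by rewrite lt_min r0.
have [n [u [Un]]] := completion_dense x hiU m0.
rewrite lt_min => /andP[xr xeta].
have := hr (iU u); rewrite -ball_normE /= => /(_ xr) h1.
have [_ isoU _] := hiU; have [_ isoV _] := hiV.
have FV : carrier (V n) (F n u).
  by have [_ _ [_ im _ _ _]] := hC.2.1 n; apply: im; exists u.
have h2 : `|W (iU u)| <= `|iU u|.
  rewrite (WF Un) (isoV _ _ FV) (isoU _ _ Un).
  by have [_ _ [_ _ nF _ _]] := hC.2.1 n; exact: nF.
have := ler_distD (W (iU u)) (W x) 0; rewrite !subr0.
have := ler_distD x (iU u) 0; rewrite !subr0 [`|iU u - x|]distrC.
move: h1 h2 xeta; lra.
Qed.

(* The triple <T, (inclusion, inclusion), n> occurs after step n, and then the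
   pushouts embed X and Y into the construction. *)
Lemma construction_extension n (X : nspace UU) (Y : nspace VV) (T : UU -> VV) :
  rational_subspace bU X -> rational_subspace bV Y ->
  rational_operator bU bV X Y T ->
  rational_embedding bU bU (U n) X (inclusion (U n)) ->
  rational_embedding bV bV (V n) Y (inclusion (V n)) ->
  (forall u, carrier (U n) u -> T u = F n u) ->
  exists (i : UU -> Ui) (j : VV -> Vi),
    [/\ linear_on (carrier X) i, forall x, carrier X x -> `|i x| = nnorm X x &
        forall u, carrier (U n) u -> i u = iU u] /\
    [/\ linear_on (carrier Y) j, forall y, carrier Y y -> `|j y| = nnorm Y y,
        forall v, carrier (V n) v -> j v = iV v &
        forall x, carrier X x -> W (i x) = j (T x)].
Proof.
move=> rX rY rT eX eY TF.
have [rU rV rF] := hC.2.1 n.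
pose t := Triple X Y T (U n) (inclusion (U n)) (V n) (inclusion (V n)) n.
have [_ /(_ t) occ] := he.
(* An occurrence at an index beyond [n] meets the requirement of [star] that the stage [n] named in
   the triple come earlier. *)
have [|[|m] nm em] := occ _ n.+1; [by split; split|by []|].
have inclU u : carrier (U n) u -> inclusion (U n) u = u.
  by move=> Uu; rewrite /inclusion mem_set.
have inclV v : carrier (V n) v -> inclusion (V n) v = v.
  by move=> Vv; rewrite /inclusion mem_set.
have FV u : carrier (U n) u -> carrier (V n) (F n u).
  by move=> Uu; case: rF => _ im _ _ _; apply: im; exists u.
have st : star e U V F m.+1.
  rewrite /star em /=; split=> // x Ux.
  by rewrite inclU// inclV ?TF//; exact: FV.
have := hC.2.2.2 m st; rewrite /extension_step em /=.
move=> [i' [j' [[_ [[li' imi _ _ _] isoi] i'U _] [[_ [[lj' imj _ _ _] isoj] j'V _] [_ Fi']]]]].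
have [_ isoU _] := hiU; have [_ isoV _] := hiV.
have Ai x : carrier X x -> carrier (U m.+1) (i' x) by move=> Xx; apply: imi; exists x.
have Aj y : carrier Y y -> carrier (V m.+1) (j' y) by move=> Yy; apply: imj; exists y.
exists (iU \o i'), (iV \o j'); split; split.
- move=> s x y Xx Xy /=; rewrite li'//.
  by apply: (completion_linear hiU (n := m.+1)); exact: Ai.
- by move=> x Xx /=; rewrite (isoU _ _ (Ai _ Xx)) isoi.
- by move=> u Uu /=; have := i'U u Uu; rewrite inclU// => ->.
- move=> s x y Yx Yy /=; rewrite lj'//.
  by apply: (completion_linear hiV (n := m.+1)); exact: Aj.
- by move=> y Yy /=; rewrite (isoV _ _ (Aj _ Yy)) isoj.
- by move=> v Vv /=; have := j'V v Vv; rewrite inclV// => ->.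
- by move=> x Xx /=; rewrite (WF (Ai _ Xx)) Fi'.
Qed.

(** Replacing [a'], [b'] by stage vectors within [eps / 2] gives a stage of error [2 * eps], so the
    glueing constant in the domain is [6 * eps]. With [eps] for the rational norm and [eps / 2] for
    the replacement, displacements stay below [10 * eps]. *)
Lemma construction_one_step : one_step W.
Proof.
move=> U' V' Om p eps delta a a' b b' u v nOm eps0 delta0 st0.
have [coU coUP] := coordinates_exist hbU.
have [coV coVP] := coordinates_exist hbV.
have eta0 : 0 < eps / 2 by rewrite divr_gt0.
have [nU [z zP]] := completion_approx p a' hiU
  (fun n m nm => let: And3 h _ _ := chain_le nm in h) eta0.
have [nV [w wP]] := completion_approx p.*2 b' hiV
  (fun n m nm => let: And3 _ h _ := chain_le nm in h) eta0.
pose n := maxn nU nV.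
have {}zP := zP n (leq_maxl _ _); have {}wP := wP n (leq_maxr _ _).
have [rU rV rF] := hC.2.1 n.
have eps20 : 0 < 2 * eps by rewrite mulr_gt0.
(* The precision of the rational norm enters both the new error and the displacement. *)
have d0 : 0 < Num.min delta eps by rewrite lt_min delta0.
have st : stage Om W p (2 * eps) a (iU \o z) b (iV \o w).
  have [h1 h2 h3 h4] := st0; split.
  - have h : almost_isometric p (eps + 0 + eps / 2) a (iU \o z).
      apply: almost_isometric_perturb h1 _ _ => i ip.
        by rewrite subrr normr0.
      by have [] := zP i ip.
    by apply: almost_isometric_le h; lra.
  - have h : almost_isometric p.*2 (eps + 0 + eps / 2) b (iV \o w).
      apply: almost_isometric_perturb h2 _ _ => i ip.
        by rewrite subrr normr0.
      by have [] := wP i ip.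
    by apply: almost_isometric_le h; lra.
  - by move=> i ip; have := h3 i ip; lra.
  - move=> i ip /=; have [_ za] := zP i ip.
    have ip2 : (i.*2 < p.*2)%N by rewrite ltn_double.
    have [_ wb] := wP _ ip2; have h5 := h4 i ip.
    have := construction_nonexpansive (a' i - iU (z i)); rewrite linearB => h6.
    have := ler_distD (W (a' i)) (W (iU (z i))) (iV (w i.*2)).
    have := ler_distD (b' i.*2) (W (a' i)) (iV (w i.*2)).
    rewrite [`|W (iU _) - W _|]distrC; lra.
pose x i := if (i < p)%N then a i else u.
pose y j := if odd j then (if (j < p.*2)%N then b j else v) else Om (x j./2).
have yx i : y i.*2 = Om (x i) by rewrite /y odd_double doubleK.
have [_ isoU _] := hiU; have [_ isoV _] := hiV.
have zU i : (i < p)%N -> carrier (U n) (z i) by move=> /zP[].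
have wV j : (j < p.*2)%N -> carrier (V n) (w j) by move=> /wP[].
have [X [Y [T [ee [f [[rX rY rT eX eY] [[TF Xe Yf Tef] [E1 E2 E3 E4]]]]]]]] :=
  rational_amalgam coUP coVP rU rV rF construction_nonexpansive
    (completion_linear hiU (n := n)) (completion_linear hiV (n := n))
    (isoU n) (isoV n) (WF (n := n)) nOm eps20 d0 st zU wV yx.
have [i [j [[il iiso iold] [jl jiso jold Wij]]]] :=
  construction_extension rX rY rT eX eY TF.
have subX := subspace_old rX; have subY := subspace_old rY.
have XU := extends_embedding eX; have YV := extends_embedding eY.
have yb k : (k < p.*2)%N -> `|y k - b k| <= 2 * eps.
  move=> kp; rewrite /y; case: ifPn => ok.
    by rewrite kp subrr normr0 ltW.
  have kE : k = k./2.*2 by rewrite -[LHS]odd_double_half (negPf ok).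
  have kp2 : (k./2 < p)%N by rewrite -ltn_double -kE.
  by rewrite /x kp2 {2}kE; have [_ _ h _] := st; exact: h.
exists x, (i \o ee), y, (j \o f); split.
- split.
  + move=> c.
    have [Xs is_] := linear_on_comb (fun k : 'I_p.+1 => c k) subX il (fun k => Xe k (ltn_ord k)).
    rewrite -is_ iiso//; apply: le_trans (E1 c) _.
    by rewrite ler_wpM2r ?sumr_ge0// ge_min lexx.
  + move=> c.
    have [Ys js] := linear_on_comb (fun k : 'I_p.+1.*2 => c k) subY jl (fun k => Yf k (ltn_ord k)).
    rewrite -js jiso//; apply: le_trans (E2 c) _.
    by rewrite ler_wpM2r ?sumr_ge0// ge_min lexx.
  + by move=> k kp; rewrite yx subrr normr0 ltW.
  + move=> k kp /=; rewrite Wij ?Tef ?subrr ?normr0 ?(ltW delta0)//; exact: Xe.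
- split=> k kp; first by rewrite /x kp subrr normr0 mulr_ge0// ltW.
  have [_ za] := zP k kp; have [Xz _] := XU _ (zU _ kp).
  have iez : i (ee k) - iU (z k) = i (ee k - z k).
    rewrite [ee k - _]addrC -scaleN1r il//; last exact: Xe (leqW kp).
    by rewrite (iold _ (zU _ kp)) scaleN1r addrC.
  have Xez : carrier X (ee k - z k).
    by rewrite addrC -scaleN1r; case: subX => _; apply=> //; exact: Xe (leqW kp).
  have h1 := E3 k kp; rewrite -iiso// -iez {1}/x kp in h1.
  have eps60 : 0 < 3 * (2 * eps) by rewrite mulr_gt0.
  have h2 := amalgam_glue a (iU \o z) eps60 kp.
  have h3 : Num.min delta eps <= eps by rewrite ge_min lexx orbT.
  have := ler_distD (iU (z k)) (i (ee k)) (a' k); rewrite [`|iU _ - a' _|]distrC.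
  by move: h1 h2 h3 za; rewrite /=; lra.
- split=> k kp; first by have := yb k kp; lra.
  have [_ wb] := wP k kp; have [Yw _] := YV _ (wV _ kp).
  have kp2 : (k < p.+1.*2)%N by rewrite doubleS; do 2 apply: leqW.
  have jfw : j (f k) - iV (w k) = j (f k - w k).
    rewrite [f k - _]addrC -scaleN1r jl//; last exact: Yf kp2.
    by rewrite (jold _ (wV _ kp)) scaleN1r addrC.
  have Yfw : carrier Y (f k - w k).
    by rewrite addrC -scaleN1r; case: subY => _; apply=> //; exact: Yf kp2.
  have h1 := E4 k kp; rewrite -jiso// -jfw in h1.
  have h2 := amalgam_glue b (iV \o w) eps20 kp.
  have [_ isob _ _] := st.
  have h4 : amalgam p.*2 (2 * eps) b (iV \o w) (y k, - iV (w k)) <=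
      `|y k - b k| + amalgam p.*2 (2 * eps) b (iV \o w) (b k, - iV (w k)).
    rewrite -(amalgam_left eps20 isob).
    have -> : (y k, - iV (w k)) = (y k - b k, 0) + (b k, - iV (w k)).
      by congr (_, _); rewrite /= ?subrK ?add0r.
    by have [_ _ ND] := amalgam_norm p.*2 b (iV \o w) eps20; exact: ND.
  have h3 : Num.min delta eps <= eps by rewrite ge_min lexx orbT.
  have h5 := yb k kp.
  have := ler_distD (iV (w k)) (j (f k)) (b' k); rewrite [`|iV _ - b' _|]distrC.
  by move: h1 h2 h3 h4 h5 wb; rewrite /=; lra.
- by rewrite /x ltnn.
- by rewrite /y/= odd_double/= ltnNge leqnSn.
Qed.

End Construction.

(** * Isometry with the constructed operator and almost homogeneity *)

Section Consequences.
Variable R : realType.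

Lemma separable_isometry (E F : completeNormedModType R) (f : {linear E -> F}) :
  bijective_isometry f -> separable F -> separable E.
Proof.
move=> [[g fK gK] fiso] /dense_seq[d dP].
exists (range (g \o d)).
  apply: sub_countable (card_image_le (g \o d) setT) _; exact: countableP.
move=> O [x Ox]; rewrite openE => /(_ x Ox)/nbhs_ballP[r /= r0 xrO].
have [k xk] := dP (f x) r r0.
exists (g (d k)); split; last by exists k.
by apply: xrO; rewrite -ball_normE /= -fiso linearB gK.
Qed.

Lemma gurarii_nonexpansive (U V : completeNormedModType R) (Om : {linear U -> V}) :
  gurarii_property Om -> forall x, `|Om x| <= `|x|.
Proof. by move=> [/opnorm_le1P]. Qed.

Lemma gurarii_isometric_universal (U V : completeNormedModType R)
    (Om : {linear U -> V}) (G : completeNormedModType R) (W : {linear G -> G}) :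
  separable U -> separable V -> gurarii_property Om -> universal_operator W ->
  exists (I : {linear U -> G}) (J : {linear V -> G}),
    [/\ bijective_isometry I, bijective_isometry J &
        forall x, W (I x) = J (Om x)].
Proof.
move=> sU sV gur [[sG _] [Ui [Vi [Wi [a [c [cons ia ic Wac]]]]]]].
have [UU [VV [bU [bV [e [Un [Vn [F [iU [iV [[hbU hbV he hC] [hiU hiV cW WF]]]]]]]]]]]] := cons.
have st := gurarii_one_step gur.
have st' := construction_one_step hbU hbV he hC hiU hiV cW WF.
have n := gurarii_nonexpansive gur.
have n' := construction_nonexpansive hC hiU hiV cW WF.
(* Empty tuples form a stage of any accuracy, so the back-and-forth can start with error 1. *)
have [|I [J [[bI iI] [bJ iJ] IJ _ _]]] := @back_and_forth R U V Ui Vi Om Wi 0 1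
  (fun=> 0) (fun=> 0) (fun=> 0) (fun=> 0) sU sV (separable_isometry ia sG)
  (separable_isometry ic sG) st st' n n' ltr01.
  by split=> // k; rewrite !big_ord0 !normr0 subrr normr0 mulr0.
have [ba isoa] := ia; have [bc isoc] := ic.
exists (a \o I), (c \o J); split.
- by split; [exact: bij_comp|move=> x /=; rewrite isoa iI].
- by split; [exact: bij_comp|move=> x /=; rewrite isoc iJ].
- by move=> x /=; rewrite Wac IJ.
Qed.

(** The given partial isometries serve as starting stage, with [Om] on both sides. Bounded
    coefficients turn the error [80 * eta] at finitely many spanning vectors into at most [eps] in
    operator norm, which fixes [eta]. *)
Lemma gurarii_almost_homogeneous (U V : completeNormedModType R)
    (Om : {linear U -> V}) :
  separable U -> separable V -> gurarii_property Om -> almost_homogeneous Om.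
Proof.
move=> sU sV gur eps X0 X1 Y0 Y1 i j eps0 [n [v X0E]] _ [m [w Y0E]] _ OmX _
  [il iiso] _ [jl jiso] _ Omij.
have span_sub (E : lmodType R) k (s : 'I_k -> E) : Defs.subspace (Defs.span s).
  split; first by exists (fun=> 0) => //; rewrite big1// => l _; rewrite scale0r.
  move=> t _ _ [d _ <-] [d' _ <-]; exists (fun l => t * d l + d' l) => //.
  rewrite scaler_sumr -big_split/=; apply: eq_bigr => l _.
  by rewrite scalerDl scalerA.
have subX : Defs.subspace X0 by rewrite X0E.
have subY : Defs.subspace Y0 by rewrite Y0E.
have span_mem (E : lmodType R) k (s : 'I_k -> E) l : Defs.span s (s l).
  exists (fun l' => (l' == l)%:R) => //.
  rewrite (bigD1 l)//= eqxx scale1r big1 ?addr0// => l' /negPf ->.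
  by rewrite scale0r.
have [M1 M10 hM1] := findim_bounded_coefs v.
have [M2 M20 hM2] := findim_bounded_coefs w.
pose eta := eps / (80 * (M1 + M2)).
have M0 : 0 < 80 * (M1 + M2) by rewrite mulr_gt0// addr_gt0.
have eta0 : 0 < eta by rewrite divr_gt0.
have etaE : eta * (80 * (M1 + M2)) = eps by rewrite divfK// gt_eqF.
pose p := maxn n m.
(* Spanning vectors of [X0], padded by 0 to a common length; the odd entries of [b] are those of
   [Y0], the even ones the images of the [a k]. *)
pose a k : U := if insub k is Some l then v l else 0.
pose b k : V := if odd k then (if insub k./2 is Some l then w l else 0) else Om (a k./2).
have aX k : X0 (a k).
  by rewrite /a; case: insubP => [l _ _|_]; [rewrite X0E|case: subX].
have bY k : Y0 (b k).
  rewrite /b; case: ifP => _; last by apply: OmX; exists (a k./2).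
  by case: insubP => [l _ _|_]; [rewrite Y0E|case: subY].
have bE k : b k.*2 = Om (a k) by rewrite /b odd_double doubleK.
have st := gurarii_one_step gur.
have nOm := gurarii_nonexpansive gur.
have stg : stage Om Om p eta a (i \o a) b (j \o b).
  split.
  - move=> c; have [Xs is_] := linear_on_comb (fun k : 'I_p => c k) subX il (fun k => aX k).
    rewrite -is_ iiso// subrr normr0 mulr_ge0 ?sumr_ge0//; exact: ltW.
  - move=> c; have [Ys js] := linear_on_comb (fun k : 'I_p.*2 => c k) subY jl (fun k => bY k).
    rewrite -js jiso// subrr normr0 mulr_ge0 ?sumr_ge0//; exact: ltW.
  - by move=> k _; rewrite bE subrr normr0 ltW.
  - by move=> k _ /=; rewrite bE Omij// subrr normr0 ltW.
have [I [J [bI bJ IJ Ia Jb]]] :=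
  back_and_forth sU sV sU sV st st nOm nOm eta0 stg.
exists I, J; split=> //.
- rewrite X0E; apply: (@opnorm_on_span_le _ _ _ _ _ _ M1 (80 * eta)).
  + move=> s x y Xx Xy; rewrite linearP il ?X0E//; linear_identity R.
  + exact: span_sub.
  + exact: span_mem.
  + exact: hM1.
  + exact: ltW.
  + by rewrite mulr_ge0// ltW.
  + move=> k; have kp : (k < p)%N by rewrite leq_max ltn_ord.
    by have := Ia k kp; rewrite /= /a valK.
  + by rewrite -etaE [80 * eta]mulrC -mulrA ler_pM2l// ler_pM2l// lerDl ltW.
- rewrite Y0E; apply: (@opnorm_on_span_le _ _ _ _ _ _ M2 (80 * eta)).
  + move=> s x y Xx Xy; rewrite linearP jl ?Y0E//; linear_identity R.
  + exact: span_sub.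
  + exact: span_mem.
  + exact: hM2.
  + exact: ltW.
  + by rewrite mulr_ge0// ltW.
  + move=> k; have kp : (k.*2.+1 < p.*2)%N.
      by rewrite -doubleS leq_double leq_max ltn_ord orbT.
    by have := Jb _ kp; rewrite /= /b /= odd_double /= uphalf_double valK.
  + by rewrite -etaE [80 * eta]mulrC -mulrA ler_pM2l// ler_pM2l// lerDr ltW.
Qed.

End Consequences.

Theorem theorem4p5 (R : realType) (U V : completeNormedModType R)
    (Omega : {linear U -> V}) :
  separable U -> separable V -> gurarii_property Omega ->
  (forall (G : completeNormedModType R) (bOmega : {linear G -> G}),
     universal_operator bOmega ->
     exists (I : {linear U -> G}) (J : {linear V -> G}),
       [/\ bijective_isometry I, bijective_isometry J &
           forall x, bOmega (I x) = J (Omega x)]) /\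
  almost_homogeneous Omega.
Proof.
move=> sU sV gur; split; last exact: gurarii_almost_homogeneous.
by move=> G W; exact: gurarii_isometric_universal.
Qed.
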